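(* Let $P, P'$ be Fourier multipliers on $\mathbf{R}^2$ whose symbols lie in $C^\infty_0(\mathbf{R}^2)$ and do not vanish identically (neither symbol is the zero function). Then there does not exist a constant $C > 0$ for which one has the estimate $$ \| (e^{it\Delta} P f) (e^{it\Delta} P' g) \|_{L^1_t L^\infty_x(\mathbf{R} \times \mathbf{R}^2)} \leq C \|f\|_{L^2_x(\mathbf{R}^2)} \|g\|_{L^2_x(\mathbf{R}^2)}$$ for all $f, g \in L^2_x(\mathbf{R}^2)$.
   Context: Functions are complex-valued. The Fourier transform on $\mathbf{R}^2$ is $\hat f(\xi) := \int_{\mathbf{R}^2} e^{-2\pi i x\cdot \xi} f(x)\,dx$ (extended to $L^2_x(\mathbf{R}^2)$ in the usual way). The Schr\''odinger propagators $e^{it\Delta}$, $t \in \mathbf{R}$, are defined on $L^2_x(\mathbf{R}^2)$ by $\widehat{e^{it\Delta} f}(\xi) := e^{-4\pi^2 i t|\xi|^2} \hat f(\xi)$. A Fourier multiplier $P$ with symbol $\varphi \in C^\infty_0(\mathbf{R}^2)$ (smooth, compactly supported) is the operator defined by $\widehat{Pf} = \varphi \hat f$. The mixed norm is $\|F\|_{L^1_t L^\infty_x(\mathbf{R}\times\mathbf{R}^2)} := \int_{\mathbf{R}} \|F(t,\cdot)\|_{L^\infty_x(\mathbf{R}^2)}\,dt$, possibly $+\infty$. *)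

(* Defs.v *)
From HB Require Import structures.
From mathcomp Require Import all_boot all_order all_algebra.
From mathcomp Require Export complex.
From mathcomp Require Import all_classical all_reals all_analysis.

Set Implicit Arguments.
Unset Strict Implicit.
Unset Printing Implicit Defensive.
Import Order.TTheory GRing.Theory Num.Theory.
Import numFieldNormedType.Exports.

Local Open Scope classical_set_scope.
Local Open Scope ring_scope.

(* Functions on the plane are Borel measurable representatives R * R -> R[i];
   their a.e. classes are the elements of the L^p spaces. *)
Notation plane R := (measurableTypeR R * measurableTypeR R)%type.

Definition leb2 (R : realType) : {measure set (plane R) -> \bar R} :=
  (@lebesgue_measure R \x @lebesgue_measure R)%E.

Section complex_valued.
Context {R : realType}.
Implicit Types (f g h F m : plane R -> R[i]) (p : \bar R) (t : R).

Definition cabs (z : R[i]) : R := ComplexField.Normc.normc z.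

Definition expi (a : R) : R[i] := (cos a +i* sin a)%C.

Definition dot (x y : plane R) : R := x.1 * y.1 + x.2 * y.2.

Definition cmeasurable f : Prop :=
  measurable_fun setT (fun x => complex.Re (f x)) /\
  measurable_fun setT (fun x => complex.Im (f x)).

Definition cnorm p f : \bar R := Lnorm (@leb2 R) p (fun x => (cabs (f x))%:E).

Definition in_Lp p f : Prop := cmeasurable f /\ (cnorm p f < +oo)%E.

Definition cintegral f : R[i] :=
  ((\int[@leb2 R]_x complex.Re (f x)) +i* (\int[@leb2 R]_x complex.Im (f x)))%C.

Definition fourierL1 f (xi : plane R) : R[i] :=
  cintegral (fun x => expi (- (2 * pi * dot x xi)) * f x).

(* [fourier f F]: F is (a representative of) the Fourier transform of
   f \in L^2, i.e. the L^2 limit of the transforms of L^1 \cap L^2 functions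
   approximating f in L^2. *)
Definition fourier f F : Prop :=
  [/\ in_Lp 2%:E f, in_Lp 2%:E F &
    exists f_ : nat -> plane R -> R[i],
      [/\ forall n, in_Lp 1%:E (f_ n) /\ in_Lp 2%:E (f_ n),
          cnorm 2%:E (fun x => f_ n x - f x) @[n --> \oo] --> 0%E &
          cnorm 2%:E (fun xi => fourierL1 (f_ n) xi - F xi) @[n --> \oo]
            --> 0%E]].

(* Operators on L^2 are given by their graphs on representatives:
   [fourier_multiplier m f h] says that h represents the image of f under
   the Fourier multiplier with symbol m; it determines h up to a.e. equality. *)
Definition fourier_multiplier m f h : Prop :=
  exists F H, [/\ fourier f F, fourier h H &
    {ae @leb2 R, forall xi, H xi = m xi * F xi}].

Definition schrodinger t f h : Prop :=
  fourier_multiplier (fun xi => expi (- (4 * pi ^+ 2 * t * dot xi xi))) f h.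

Definition L1Linfty (u : R -> plane R -> R[i]) : \bar R :=
  (\int[@lebesgue_measure R]_t cnorm +oo (u t))%E.

Definition basis (i : bool) : R * R := if i then (1, 0) else (0, 1).

(* The iterated partial derivative of h along the multi-index s. *)
Definition partials (s : seq bool) (h : R * R -> R) : R * R -> R :=
  foldr (fun i k => 'D_(basis i) k) h s.

Definition smooth (h : R * R -> R) : Prop :=
  forall s, continuous (partials s h) /\
    forall i x, derivable (partials s h) x (basis i).

Definition C0infty (phi : R * R -> R[i]) : Prop :=
  [/\ smooth (fun x => complex.Re (phi x)), smooth (fun x => complex.Im (phi x)) &
    compact (closure [set x | phi x != 0])].

End complex_valued.

(* Main.v *)
(* The estimate fails because the quadratic exponentials exp(i n |xi|^2) do not
   form a Bessel system near a point, even up to free modulations in xi.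

   Let f^ be a bump at x0 times the sum S = sum_(n < N) exp(-i psi_n), where psi_n
   is the phase of a Schroedinger wave focusing at the space-time point
   (t_n, x_n), with t_n = n tau and x_n at our disposal. Then
   sum_n |e^(it Delta) P f|(t_n + s, x_n) >~ ||f||^2 for all s in a short window
   [0, d]. Let g^ be the analogous sum with random signs: on average
   ||g||^2 ~ N while |e^(it Delta) P' g|(t_n + s, x_n) >~ 1 for every n. Hence
   the estimate would give ||f||^2 <~ ||f|| N^(1/2), that is ||f||^2 <~ N
   uniformly in the x_n.

   Take N = 2^K and (after recentring and rescaling) the phases
   al n (X^2 + Y^2) - y_n X with y_n = sum of z_j over the binary digits j of n,
   so that |S|^2 / N is the Riesz product
   prod_(j < K) (1 + cos(al 2^j (X^2 + Y^2) - z_j X)).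
   Averaging z_j over the differences a - b with a, b < 2^(j/2) replaces the
   cosine by cos(al 2^j (X^2 + Y^2)) times a Fejer kernel in X. Where X ~ 2^-l
   and 0 <= Y <= 2^-l, the factors with j < 2l are close to 2 and the others
   have product bounded below, so the Riesz product is >~ 4^l. These boxes have
   area ~ 4^-l, so each l < K/2 contributes >~ 1 to the integral of |S|^2 / N,
   which is therefore >~ K and unbounded. *)

From HB Require Import structures.
Require Import Defs.
From mathcomp Require Import all_boot all_order all_algebra.
From mathcomp Require Import all_classical all_reals all_analysis.
From mathcomp Require Import measurable_realfun ess_sup_inf.
From mathcomp Require Import ring lra.

Set Implicit Arguments.
Unset Strict Implicit.
Unset Printing Implicit Defensive.
Import Order.TTheory GRing.Theory Num.Theory.
Import numFieldNormedType.Exports.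

Local Open Scope classical_set_scope.
Local Open Scope ring_scope.

(** * Complex numbers and complex-valued integrals *)

(** The modulations y_n cannot be dropped. Without them S is a function of X^2 + Y^2 alone; area is
    uniform in that variable, so orthogonality in it would give the Bessel bound. Averaging the
    modulation switches off the factors whose frequency is too high for the given X. Taking
    differences a - b makes that average a squared modulus, so an averaged factor stays between 0
    and 2 and the late ones can be bounded below one at a time. The result is comparable to 1 / (X^2
    + Y^2) on the boxes, which in dimension two only just fails to be integrable: the gain is
    logarithmic in N, and every other constant (window length, mass of the bumps) has to be
    independent of N.

    The other obstacle is that [fourier] is a relation defined by L^2 limits, whereas focusing is a
    statement about values at points. All functions are therefore given on the frequency side, as
    absolutely convergent integrals of continuous data with bounded support. Values at points then
    make sense, and of Fourier theory one needs inversion for such data and the bound of the L^2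
    norm of f by that of f^. *)

Section complex_modulus.
Context {R : realType}.
Implicit Types (z w : R[i]) (a b : R).

Lemma cabsE z : cabs z = Num.sqrt (complex.Re z ^+ 2 + complex.Im z ^+ 2).
Proof. by case: z. Qed.

Lemma cabs_ge0 z : 0 <= cabs z.
Proof. by rewrite cabsE sqrtr_ge0. Qed.

Lemma cabs_sqr z : cabs z ^+ 2 = complex.Re z ^+ 2 + complex.Im z ^+ 2.
Proof. by rewrite cabsE sqr_sqrtr// addr_ge0// sqr_ge0. Qed.

Lemma cabs0 : cabs (0 : R[i]) = 0.
Proof. exact: ComplexField.Normc.normc0. Qed.

Lemma cabsM z w : cabs (z * w) = cabs z * cabs w.
Proof. exact: ComplexField.Normc.normcM. Qed.

Lemma cabsN z : cabs (- z) = cabs z.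
Proof. by case: z => a b; rewrite !cabsE/= !sqrrN. Qed.

Lemma cabsD z w : cabs (z + w) <= cabs z + cabs w.
Proof. exact: le_normcD. Qed.

Lemma cabsB z w : cabs (z - w) = cabs (w - z).
Proof. by rewrite -cabsN opprB. Qed.

Lemma cabs_dist z w : `|cabs z - cabs w| <= cabs (z - w).
Proof.
have h1 : cabs z <= cabs (z - w) + cabs w by rewrite -{1}(subrK w z) cabsD.
have h2 : cabs w <= cabs (z - w) + cabs z by rewrite cabsB -{1}(subrK z w) cabsD.
rewrite ler_norml; lra.
Qed.

Lemma cabs_sum I (s : seq I) (P : pred I) (F : I -> R[i]) :
  cabs (\sum_(i <- s | P i) F i) <= \sum_(i <- s | P i) cabs (F i).
Proof.
apply: (big_rec2 (fun x y => cabs x <= y)) => [|i x y _ h]; first by rewrite cabs0.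
by apply: (le_trans (cabsD _ _)); rewrite lerD2l.
Qed.

Lemma cabsJ z : cabs (conjc z) = cabs z.
Proof. by case: z => a b; rewrite !cabsE/= sqrrN. Qed.

Lemma cabsR a : cabs a%:C%C = `|a|.
Proof. by rewrite cabsE/= expr0n/= addr0 sqrtr_sqr. Qed.

Lemma cabs_Re z : `|complex.Re z| <= cabs z.
Proof. by rewrite -sqrtr_sqr cabsE ler_sqrt ?lerDl ?sqr_ge0// addr_ge0 ?sqr_ge0. Qed.

Lemma cabs_Im z : `|complex.Im z| <= cabs z.
Proof. by rewrite -sqrtr_sqr cabsE ler_sqrt ?lerDr ?sqr_ge0// addr_ge0 ?sqr_ge0. Qed.

Lemma cabs_le z : cabs z <= `|complex.Re z| + `|complex.Im z|.
Proof.
rewrite -[leRHS]ger0_norm ?addr_ge0// -sqrtr_sqr cabsE ler_sqrt ?sqr_ge0//.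
rewrite sqrrD -!normrX !(ger0_norm (sqr_ge0 _)).
by rewrite addrAC lerDl mulrn_wge0// mulr_ge0.
Qed.

Lemma mulcJ z : z * conjc z = (cabs z ^+ 2)%:C%C.
Proof.
case: z => a b; rewrite cabs_sqr/= /real_complex_def.
by congr (_ +i* _)%C; ring.
Qed.

Lemma cRe_mulC a z : complex.Re (a%:C%C * z) = a * complex.Re z.
Proof. by case: z => x y /=; rewrite mul0r subr0. Qed.

Lemma cIm_mulC a z : complex.Im (a%:C%C * z) = a * complex.Im z.
Proof. by case: z => x y /=; rewrite mul0r addr0. Qed.

Lemma realcM a b : (a * b)%:C%C = a%:C%C * b%:C%C :> R[i].
Proof. exact: (rmorphM (real_complex R)). Qed.

Lemma cReM z w : complex.Re (z * w) =
  complex.Re z * complex.Re w - complex.Im z * complex.Im w.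
Proof. by case: z => ? ?; case: w. Qed.

Lemma cImM z w : complex.Im (z * w) =
  complex.Re z * complex.Im w + complex.Im z * complex.Re w.
Proof. by case: z => ? ?; case: w. Qed.

Lemma cReD z w : complex.Re (z + w) = complex.Re z + complex.Re w.
Proof. by case: z => ? ?; case: w. Qed.

Lemma cImD z w : complex.Im (z + w) = complex.Im z + complex.Im w.
Proof. by case: z => ? ?; case: w. Qed.

Lemma cReN z : complex.Re (- z) = - complex.Re z. Proof. by case: z. Qed.

Lemma cImN z : complex.Im (- z) = - complex.Im z. Proof. by case: z. Qed.

Lemma cReJ z : complex.Re (conjc z) = complex.Re z. Proof. by case: z. Qed.

Lemma cImJ z : complex.Im (conjc z) = - complex.Im z. Proof. by case: z. Qed.

Lemma complex_eqP z w : complex.Re z = complex.Re w ->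
  complex.Im z = complex.Im w -> z = w.
Proof. by case: z => ? ?; case: w => ? ? /= -> ->. Qed.

Lemma cabs_expi a : cabs (expi a) = 1.
Proof. by rewrite cabsE/= cos2Dsin2 sqrtr1. Qed.

Lemma expiD a b : expi (a + b) = expi a * expi b.
Proof. by apply: complex_eqP; rewrite ?cReM ?cImM/= ?cosD ?sinD; ring. Qed.

Lemma expi0 : expi (0 : R) = 1.
Proof. by apply: complex_eqP => /=; rewrite ?cos0 ?sin0. Qed.

Lemma expiN a : expi (- a) = conjc (expi a).
Proof. by apply: complex_eqP => /=; rewrite ?cosN ?sinN. Qed.

Lemma mulexpiN a : expi a * expi (- a) = 1.
Proof. by rewrite -expiD subrr expi0. Qed.

Lemma le_sin_id a : 0 <= a -> `|sin a| <= a.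
Proof.
rewrite le_eqVlt => /predU1P[<-|a0]; first by rewrite sin0 normr0.
have csin : {within `[0, a], continuous sin}.
  by apply: continuous_subspaceT => x; exact: continuous_sin.
have [c _] := MVT a0 (fun x _ => is_derive_sin x) csin.
rewrite sin0 !subr0 => ->.
rewrite normrM (gtr0_norm a0) ler_piMl ?(ltW a0)//.
by rewrite ler_norml cos_geN1 cos_le1.
Qed.

(** Half-angle formula and |sin x| <= |x|. The estimates of [expi], of the Fejer kernel and of the
    Riesz factors near phase 0 go through this bound. *)
Lemma cos_ge_quad a : 1 - a ^+ 2 / 2 <= cos a.
Proof.
have -> : cos a = 1 - (sin (a / 2) ^+ 2) *+ 2.
  have aE : a = (a / 2) *+ 2 by rewrite -mulr_natr; field.
  rewrite {1}aE cos_mulr2n cos2sin2; ring.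
have : sin (a / 2) ^+ 2 <= (a / 2) ^+ 2.
  wlog a0 : a / 0 <= a.
    move=> h; have [/h//|a0] := leP 0 a.
    have := h (- a); rewrite mulNr sinN !sqrrN; apply; lra.
  rewrite -[leLHS]ger0_norm ?sqr_ge0// normrX lerXn2r ?nnegrE ?divr_ge0//.
  by apply: le_sin_id; rewrite divr_ge0.
rewrite -mulr_natr expr_div_n; lra.
Qed.

Lemma cabs_expi_sub1 a : cabs (expi a - 1) <= `|a|.
Proof.
rewrite -[leRHS]ger0_norm// -sqrtr_sqr cabsE ler_sqrt ?sqr_ge0//.
rewrite cReD cImD cReN cImN /= subr0 real_normK ?num_real//.
have := cos_ge_quad a; have := cos2Dsin2 a; nra.
Qed.

Lemma cabs_expi_sub a b : cabs (expi a - expi b) <= `|a - b|.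
Proof.
have -> : expi a - expi b = expi b * (expi (a - b) - 1).
  by rewrite mulrBr mulr1 -expiD addrCA subrr addr0.
by rewrite cabsM cabs_expi mul1r cabs_expi_sub1.
Qed.

End complex_modulus.

Section complex_measurable.
Context {R : realType} {d} {T : measurableType d}.
Implicit Types (f g : T -> R[i]) (h : T -> R).

(** Agrees with [cmeasurable] on the plane, but over any measurable type, since Fubini involves
    functions on [plane R * plane R]. *)
Definition cmeas f : Prop :=
  measurable_fun setT (fun x => complex.Re (f x)) /\
  measurable_fun setT (fun x => complex.Im (f x)).

Lemma cmeas_cst z : cmeas (fun=> z).
Proof. by split; exact: measurable_cst. Qed.

Lemma cmeasD f g : cmeas f -> cmeas g -> cmeas (fun x => f x + g x).
Proof.
move=> [f1 f2] [g1 g2]; split.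
- by under eq_fun do rewrite cReD; exact: measurable_funD.
- by under eq_fun do rewrite cImD; exact: measurable_funD.
Qed.

Lemma cmeasM f g : cmeas f -> cmeas g -> cmeas (fun x => f x * g x).
Proof.
move=> [f1 f2] [g1 g2]; split.
- by under eq_fun do rewrite cReM; apply: measurable_funB; exact: measurable_funM.
- by under eq_fun do rewrite cImM; apply: measurable_funD; exact: measurable_funM.
Qed.

Lemma cmeasN f : cmeas f -> cmeas (fun x => - f x).
Proof.
move=> mf; have -> : (fun x => - f x) = (fun x => -1 * f x).
  by apply/funext => x; rewrite mulN1r.
by apply: cmeasM => //; exact: cmeas_cst.
Qed.

Lemma cmeasB f g : cmeas f -> cmeas g -> cmeas (fun x => f x - g x).
Proof. by move=> mf mg; apply: cmeasD => //; exact: cmeasN. Qed.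

Lemma cmeasJ f : cmeas f -> cmeas (fun x => conjc (f x)).
Proof.
move=> [f1 f2]; split.
- by under eq_fun do rewrite cReJ.
- by under eq_fun do rewrite cImJ; exact: measurableT_comp.
Qed.

Lemma cmeasR h : measurable_fun setT h -> cmeas (fun x => (h x)%:C%C).
Proof. by move=> mh; split => //=; exact: measurable_cst. Qed.

Lemma cmeas_expi h : measurable_fun setT h -> cmeas (fun x => expi (h x)).
Proof.
move=> mh; split => /=; apply: measurableT_comp => //.
- by apply: continuous_measurable_fun => x; exact: continuous_cos.
- by apply: continuous_measurable_fun => x; exact: continuous_sin.
Qed.

Lemma cmeas_sum I (s : seq I) (F : I -> T -> R[i]) :
  (forall i, cmeas (F i)) -> cmeas (fun x => \sum_(i <- s) F i x).
Proof.
move=> mF; elim: s => [|i s ih].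
  by under eq_fun do rewrite big_nil; exact: cmeas_cst.
by under eq_fun do rewrite big_cons; exact: cmeasD.
Qed.

Lemma measurable_cabs f : cmeas f -> measurable_fun setT (fun x => cabs (f x)).
Proof.
move=> [f1 f2]; under eq_fun do rewrite cabsE.
apply: measurableT_comp.
  by apply: continuous_measurable_fun; exact: sqrt_continuous.
by apply: measurable_funD; exact: measurable_funX.
Qed.

Lemma cmeas_cabs2 f : cmeas f -> measurable_fun setT (fun x => cabs (f x) ^+ 2).
Proof. by move=> mf; apply: measurable_funX; exact: measurable_cabs. Qed.

End complex_measurable.

Lemma cmeas_comp {R : realType} d1 d2 (T1 : measurableType d1)
    (T2 : measurableType d2) (f : T2 -> R[i]) (g : T1 -> T2) :
  cmeas f -> measurable_fun setT g -> cmeas (fun x => f (g x)).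
Proof.
by move=> [f1 f2] mg; split; [exact: (measurableT_comp f1 mg)|exact: (measurableT_comp f2 mg)].
Qed.

Section complex_integral.
Context {R : realType} {d} {T : measurableType d}.
Variable mu : {measure set T -> \bar R}.
Implicit Types (f g : T -> R[i]) (h : T -> R).

Definition Cint f : R[i] :=
  ((\int[mu]_x complex.Re (f x)) +i* (\int[mu]_x complex.Im (f x)))%C.

Definition rint h : Prop := mu.-integrable setT (EFin \o h).

Definition cint f : Prop :=
  rint (fun x => complex.Re (f x)) /\ rint (fun x => complex.Im (f x)).

Lemma cint_cmeas f : cint f -> cmeas f.
Proof. by move=> [/measurable_int/measurable_EFinP ? /measurable_int/measurable_EFinP]. Qed.

Lemma rint_le h1 h2 : measurable_fun setT h1 -> rint h2 ->
  (forall x, `|h1 x| <= h2 x) -> rint h1.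
Proof.
move=> m1 i2 le; apply: (le_integrable _ _ _ i2) => //.
  exact/measurable_EFinP.
by move=> x _ /=; rewrite lee_fin (le_trans (le x))// ler_norm.
Qed.

Lemma rintD h1 h2 : rint h1 -> rint h2 -> rint (fun x => h1 x + h2 x).
Proof. by move=> i1 i2; exact: (integrableD _ i1 i2). Qed.

Lemma rintB h1 h2 : rint h1 -> rint h2 -> rint (fun x => h1 x - h2 x).
Proof. by move=> i1 i2; exact: (integrableB _ i1 i2). Qed.

Lemma rintZ k h : rint h -> rint (fun x => k * h x).
Proof. by move=> ih; exact: (integrableZl _ k ih). Qed.

Lemma cint_dom f h : cmeas f -> rint h -> (forall x, cabs (f x) <= h x) -> cint f.
Proof.
move=> [m1 m2] ih le; split; apply: (rint_le _ ih) => // x.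
- exact: le_trans (cabs_Re _) (le x).
- exact: le_trans (cabs_Im _) (le x).
Qed.

Lemma cint_cabs f : cint f -> rint (fun x => cabs (f x)).
Proof.
move=> /[dup] /cint_cmeas mf [i1 i2].
apply: (@rint_le _ (fun x => `|complex.Re (f x)| + `|complex.Im (f x)|)).
- exact: measurable_cabs.
- by apply: rintD; exact: integrable_norm.
- by move=> x; rewrite ger0_norm ?cabs_ge0// cabs_le.
Qed.

Lemma cintD f g : cint f -> cint g -> cint (fun x => f x + g x).
Proof.
move=> [f1 f2] [g1 g2]; split.
- by under eq_fun do rewrite cReD; exact: rintD.
- by under eq_fun do rewrite cImD; exact: rintD.
Qed.

Lemma CintD f g : cint f -> cint g -> Cint (fun x => f x + g x) = Cint f + Cint g.
Proof.
move=> [f1 f2] [g1 g2]; apply: complex_eqP; rewrite ?cReD ?cImD /=.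
- by under eq_Rintegral do rewrite cReD; rewrite RintegralD.
- by under eq_Rintegral do rewrite cImD; rewrite RintegralD.
Qed.

Lemma cintZ z f : cint f -> cint (fun x => z * f x).
Proof.
move=> [f1 f2]; split.
- by under eq_fun do rewrite cReM; apply: rintB; exact: rintZ.
- by under eq_fun do rewrite cImM; apply: rintD; exact: rintZ.
Qed.

Lemma CintZ z f : cint f -> Cint (fun x => z * f x) = z * Cint f.
Proof.
move=> [f1 f2]; apply: complex_eqP; rewrite ?cReM ?cImM /=.
- under eq_Rintegral do rewrite cReM.
  by rewrite RintegralB ?RintegralZl//; exact: rintZ.
- under eq_Rintegral do rewrite cImM.
  by rewrite RintegralD ?RintegralZl//; exact: rintZ.
Qed.

Lemma cint0 : cint (fun=> 0).
Proof. by split; exact: integrable0. Qed.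

Lemma Cint0 : Cint (fun=> 0) = 0.
Proof. by apply: complex_eqP => /=; rewrite /Rintegral integral0. Qed.

Lemma cint_sum I (s : seq I) (F : I -> T -> R[i]) :
  (forall i, cint (F i)) -> cint (fun x => \sum_(i <- s) F i x).
Proof.
move=> iF; elim: s => [|i s ih]; first by under eq_fun do rewrite big_nil; exact: cint0.
by under eq_fun do rewrite big_cons; exact: cintD.
Qed.

Lemma Cint_sum I (s : seq I) (F : I -> T -> R[i]) : (forall i, cint (F i)) ->
  Cint (fun x => \sum_(i <- s) F i x) = \sum_(i <- s) Cint (F i).
Proof.
move=> iF; elim: s => [|i s ih].
  by under eq_fun do rewrite big_nil; rewrite big_nil Cint0.
under eq_fun do rewrite big_cons.
by rewrite big_cons CintD// ?ih//; exact: cint_sum.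
Qed.

Lemma eq_Cint f g : f =1 g -> Cint f = Cint g.
Proof. by move=> /funext ->. Qed.

Lemma cintJ f : cint f -> cint (fun x => conjc (f x)).
Proof.
move=> [f1 f2]; split; first by under eq_fun do rewrite cReJ.
by under eq_fun do rewrite cImJ -mulN1r; exact: rintZ.
Qed.

Lemma CintJ f : cint f -> Cint (fun x => conjc (f x)) = conjc (Cint f).
Proof.
move=> [f1 f2]; apply: complex_eqP; rewrite ?cReJ ?cImJ /=.
- by under eq_Rintegral do rewrite cReJ.
- by under eq_Rintegral do rewrite cImJ -mulN1r; rewrite RintegralZl// mulN1r.
Qed.

Lemma cintR h : rint h -> cint (fun x => (h x)%:C%C).
Proof. by move=> ih; split => //=; exact: integrable0. Qed.

Lemma CintR h : Cint (fun x => (h x)%:C%C) = (\int[mu]_x h x)%:C%C.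
Proof. by apply: complex_eqP => //=; rewrite /Rintegral integral0. Qed.

(** Multiplying by [conjc I] makes the integral real: |I|^2 is the integral of Re (conj I f), at
    most |I| times the integral of |f|. The factor |I| is then cancelled, hence the separate case I
    = 0. *)
Lemma cabs_Cint f : cint f -> cabs (Cint f) <= \int[mu]_x cabs (f x).
Proof.
move=> fi; set I := Cint f.
have [I0|I0] := eqVneq (cabs I) 0.
  by rewrite I0; apply: Rintegral_ge0 => x _; exact: cabs_ge0.
have I_gt0 : 0 < cabs I by rewrite lt_neqAle eq_sym I0 cabs_ge0.
rewrite -(ler_pM2l I_gt0) -expr2.
have -> : cabs I ^+ 2 = \int[mu]_x complex.Re (conjc I * f x).
  have : complex.Re (conjc I * I) = cabs I ^+ 2 by rewrite mulrC mulcJ.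
  by rewrite -{2}/I -CintZ//= => ->.
rewrite -RintegralZl//; last exact: cint_cabs.
apply: le_Rintegral => //.
- by have [] := cintZ (conjc I) fi.
- by apply: rintZ; exact: cint_cabs.
- move=> x _; apply: le_trans (ler_norm _) _; apply: le_trans (cabs_Re _) _.
  by rewrite cabsM cabsJ.
Qed.

End complex_integral.

Lemma cintegralE {R : realType} (f : plane R -> R[i]) :
  cintegral f = Cint (@leb2 R) f.
Proof. by []. Qed.

(** * Fubini and Tonelli on the plane *)

Section fubini_dominated.
Context {R : realType} {d1 d2} {T1 : measurableType d1} {T2 : measurableType d2}.
Variables (m1 : {sigma_finite_measure set T1 -> \bar R})
          (m2 : {sigma_finite_measure set T2 -> \bar R}).
Variables (h1 : T1 -> R) (h2 : T2 -> R).
Hypotheses (ih1 : rint m1 h1) (ih2 : rint m2 h2).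

(** Domination by a product [h1 x * h2 y] is the form of the Fubini hypothesis used throughout: it
    makes every section integrable, not only almost every one, so all inner integrals are finite and
    commute with [fine]. *)
Lemma rint_prod : rint (m1 \x m2)%E (fun z => h1 z.1 * h2 z.2).
Proof.
have mh1 : measurable_fun setT h1 by move/measurable_int: ih1 => /measurable_EFinP.
have mh2 : measurable_fun setT h2 by move/measurable_int: ih2 => /measurable_EFinP.
apply/integrable12ltyP => /=.
  apply/measurable_EFinP; apply: measurable_funM; exact: measurableT_comp.
under eq_integral => x _.
  under eq_integral => y _ do rewrite normrM EFinM.
  rewrite ge0_integralZl//; last first.
    by apply/measurable_EFinP; exact: measurableT_comp.
  over.
rewrite ge0_integralZr//.
- by move/integrableP: ih1 => [_ /= l1]; move/integrableP: ih2 => [_ /= l2];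
  rewrite lte_mul_pinfty// ?integral_ge0// ge0_fin_numE// integral_ge0.
- by apply/measurable_EFinP; exact: measurableT_comp.
- by rewrite integral_ge0.
Qed.

Section real.
Variable F : T1 * T2 -> R.
Hypotheses (mF : measurable_fun setT F)
  (FM : forall x y, `|F (x, y)| <= h1 x * h2 y).

Let iF : (m1 \x m2)%E.-integrable setT (EFin \o F).
Proof. by apply: (rint_le mF rint_prod) => -[x y]; exact: FM. Qed.

Lemma rint_section1 x : rint m2 (fun y => F (x, y)).
Proof.
apply: (@rint_le _ _ _ _ _ (fun y => h1 x * h2 y)).
- exact: measurableT_comp.
- exact: rintZ.
- by move=> y; exact: FM.
Qed.

Lemma rint_section2 y : rint m1 (fun x => F (x, y)).
Proof.
apply: (@rint_le _ _ _ _ _ (fun x => h2 y * h1 x)).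
- exact: measurableT_comp.
- exact: rintZ.
- by move=> x; rewrite mulrC; exact: FM.
Qed.

Let E1 : (fun x => (\int[m2]_y (F (x, y))%:E)%E) =
  EFin \o (fun x => \int[m2]_y F (x, y)).
Proof.
apply/funext => x /=; rewrite fineK//; apply: integrable_fin_num => //.
exact: rint_section1.
Qed.

Let E2 : (fun y => (\int[m1]_x (F (x, y))%:E)%E) =
  EFin \o (fun y => \int[m1]_x F (x, y)).
Proof.
apply/funext => y /=; rewrite fineK//; apply: integrable_fin_num => //.
exact: rint_section2.
Qed.

Lemma rint_Rintegral1 : rint m1 (fun x => \int[m2]_y F (x, y)).
Proof. by rewrite /rint -E1; exact: (integrable_fubini_F iF). Qed.

Lemma Rintegral_Fubini :
  \int[m1]_x \int[m2]_y F (x, y) = \int[m2]_y \int[m1]_x F (x, y).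
Proof.
rewrite /Rintegral; congr fine.
transitivity (\int[m1]_x \int[m2]_y (F (x, y))%:E)%E.
  by apply: eq_integral => x _; rewrite (congr1 (@^~ x) E1).
rewrite (Fubini iF); apply: eq_integral => y _.
by rewrite (congr1 (@^~ y) E2).
Qed.

Lemma Rintegral_prod1 :
  \int[(m1 \x m2)%E]_z F z = \int[m1]_x \int[m2]_y F (x, y).
Proof.
rewrite /Rintegral; congr fine.
rewrite -(integral12_prod_meas1 iF); apply: eq_integral => x _.
exact: (congr1 (@^~ x) E1).
Qed.

End real.

Section complex.
Variable F : T1 * T2 -> R[i].
Hypotheses (mF : cmeas F) (FM : forall x y, cabs (F (x, y)) <= h1 x * h2 y).

Let FMr x y : `|complex.Re (F (x, y))| <= h1 x * h2 y.
Proof. exact: le_trans (cabs_Re _) (FM _ _). Qed.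

Let FMi x y : `|complex.Im (F (x, y))| <= h1 x * h2 y.
Proof. exact: le_trans (cabs_Im _) (FM _ _). Qed.

Lemma cint_Cint1 : cint m1 (fun x => Cint m2 (fun y => F (x, y))).
Proof. by split; [exact: (rint_Rintegral1 mF.1 FMr)|exact: (rint_Rintegral1 mF.2 FMi)]. Qed.

Lemma Cint_Fubini : Cint m1 (fun x => Cint m2 (fun y => F (x, y))) =
  Cint m2 (fun y => Cint m1 (fun x => F (x, y))).
Proof.
apply: complex_eqP => /=.
- exact: (Rintegral_Fubini mF.1 FMr).
- exact: (Rintegral_Fubini mF.2 FMi).
Qed.

Lemma Cint_prod1 :
  Cint (m1 \x m2)%E F = Cint m1 (fun x => Cint m2 (fun y => F (x, y))).
Proof.
apply: complex_eqP => /=.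
- exact: (Rintegral_prod1 mF.1 FMr).
- exact: (Rintegral_prod1 mF.2 FMi).
Qed.

End complex.
End fubini_dominated.

Lemma leb2_sigma_finite (R : realType) : sigma_finite setT (@leb2 R).
Proof.
have /sigma_finiteP[F [FT Fnd Foo]] := sigma_finiteT (@lebesgue_measure R).
exists (fun n => F n `*` F n).
  rewrite -setXTT FT predeqE => -[x y]; split.
    move=> [/= [n _ Fnx] [k _ Fky]]; exists (maxn n k) => //; split.
    - by move: x Fnx; exact/subsetPset/Fnd/leq_maxl.
    - by move: y Fky; exact/subsetPset/Fnd/leq_maxr.
  by move=> [n _ []/= ? ?]; split; exists n.
move=> k; have [? ?] := Foo k; split; first exact: measurableX.
have -> : leb2 R (F k `*` F k) = (lebesgue_measure (F k) * lebesgue_measure (F k))%E.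
  exact: product_measure1E.
by rewrite lte_mul_pinfty// ge0_fin_numE.
Qed.

(** [leb2] is typed as a mere measure; repackaging it with its sigma-finiteness makes Fubini
    available on [plane R * plane R]. *)
Definition leb2s (R : realType) : {sigma_finite_measure set (plane R) -> \bar R} :=
  let H := Measure_isSigmaFinite.Build _ _ _ (@leb2 R) (@leb2_sigma_finite R) in
  HB.pack_for {sigma_finite_measure set (plane R) -> \bar R} (Measure.sort (@leb2 R)) H.

Section plane_fubini.
Context {R : realType}.
Notation mu := (@leb2 R).
Variables h1 h2 : plane R -> R.
Hypotheses (ih1 : rint mu h1) (ih2 : rint mu h2).
Variable F : plane R * plane R -> R[i].
Hypotheses (mF : cmeas F) (FM : forall x y, cabs (F (x, y)) <= h1 x * h2 y).

Lemma plane_Fubini : Cint mu (fun x => Cint mu (fun y => F (x, y))) =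
  Cint mu (fun y => Cint mu (fun x => F (x, y))).
Proof. exact: (@Cint_Fubini _ _ _ _ _ (leb2s R) (leb2s R) _ _ ih1 ih2 F mF FM). Qed.

Lemma plane_cint_Cint : cint mu (fun x => Cint mu (fun y => F (x, y))).
Proof. exact: (@cint_Cint1 _ _ _ _ _ (leb2s R) (leb2s R) _ _ ih1 ih2 F mF FM). Qed.

End plane_fubini.

Section plane_tonelli.
Context {R : realType}.
Notation mu := (@leb2 R).
Variable f : plane R * plane R -> \bar R.
Hypotheses (f0 : forall z, (0 <= f z)%E) (mf : measurable_fun setT f).

Lemma plane_tonelli :
  (\int[mu]_x \int[mu]_y f (x, y) = \int[mu]_y \int[mu]_x f (x, y))%E.
Proof. exact: (@fubini_tonelli _ _ _ _ _ (leb2s R) (leb2s R) f mf f0). Qed.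

Lemma plane_measurable_integral : measurable_fun setT (fun x => (\int[mu]_y f (x, y))%E).
Proof. exact: (@measurable_fun_fubini_tonelli_F _ _ _ _ _ (leb2s R) f mf f0). Qed.

End plane_tonelli.

(** * Open sets and continuous functions for the product sigma-algebra of the plane *)

Section plane.
Context {R : realType}.

(** The sigma-algebra of the plane is the product one, so an open set is exhausted by the countably
    many rational rectangles that it contains. *)
Lemma open_measurable2 (U : set (R * R)) : open U -> measurable (U : set (plane R)).
Proof.
move=> oU.
pose B (a b c e : rat) : set (plane R) :=
  [set x | `]ratr a, ratr b[%classic x.1 /\ `]ratr c, ratr e[%classic x.2].
pose A (a b c e : rat) : set (plane R) :=
  if pselect (B a b c e `<=` U) then B a b c e else set0.
have mA a b c e : measurable (A a b c e).
  rewrite /A; case: pselect => //= _.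
  by apply: measurableX; exact: measurable_itv.
rewrite (_ : U = \bigcup_a \bigcup_b \bigcup_c \bigcup_e A a b c e).
  by do 4 apply: bigcupT_measurable_rat => ?.
apply/seteqP; split => [[x y] Uxy|z [a _ [b _ [c _ [e _]]]]]; last first.
  by rewrite /A; case: pselect => //= BU; exact: BU.
have /nbhs_ballP[eps /= e0 He] : nbhs (x, y) U by exact: open_nbhs_nbhs.
have [a] : exists q : rat, ratr q \in `](x - eps), x[%R by apply: rat_in_itvoo; lra.
have [b] : exists q : rat, ratr q \in `]x, (x + eps)[%R by apply: rat_in_itvoo; lra.
have [c] : exists q : rat, ratr q \in `](y - eps), y[%R by apply: rat_in_itvoo; lra.
have [e] : exists q : rat, ratr q \in `]y, (y + eps)[%R by apply: rat_in_itvoo; lra.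
rewrite !in_itv/= => /andP[e1 e2] /andP[c1 c2] /andP[b1 b2] /andP[a1 a2].
exists a => //; exists b => //; exists c => //; exists e => //.
rewrite /A; case: pselect => [?|[]]; first by split; rewrite /= in_itv/=; apply/andP.
move=> [u v] [/=]; rewrite !in_itv/= => /andP[u1 u2] /andP[v1 v2].
by apply: He; split; rewrite /ball/= ltr_norml; lra.
Qed.

Lemma continuous_measurable2 (h : R * R -> R) :
  continuous h -> measurable_fun setT (h : plane R -> R).
Proof.
move=> /continuousP ch; apply: (measurability _ (RGenOpens.measurableE R)).
move=> _ [_ [a [b ->] <-]]; rewrite setTI; apply: open_measurable2.
exact/ch/interval_open.
Qed.

End plane.

(** * The Laplace and Cauchy kernels *)

Section kernels.
Context {R : realType}.
Notation leb := (@lebesgue_measure R).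
Implicit Types (a b c l : R).

Lemma ge0_integral_halves (f : R -> R) : (forall x, 0 <= f x) -> continuous f ->
  (\int[leb]_x (f x)%:E = \int[leb]_(x in `[0%R, +oo[) (f x)%:E +
     \int[leb]_(x in `[0%R, +oo[) (f (- x)%R)%:E)%E.
Proof.
move=> f0 cf.
have mf : measurable_fun [set: R] f by exact: continuous_measurable_fun.
have mposnums : measurable [set x : R | 0 <= x]%R by rewrite -set_itvcy.
rewrite -{1}(setUv [set x : R | 0 <= x]%R) ge0_integral_setU//= ; last 4 first.
  exact: measurableC.
  by apply/measurable_EFinP; rewrite setUv.
  by move=> x _; rewrite lee_fin.
  exact/disj_setPCl.
rewrite -set_itvcy//; congr (_ + _)%E.
rewrite setCitvr.
rewrite integral_itv_bndo_bndc; last exact/measurable_EFinP/measurable_funTS.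
rewrite -{1}oppr0 ge0_integration_by_substitutionNy//.
exact: continuous_subspaceT.
Qed.

Lemma is_derive1_continuous (f : R -> R) (x df : R) :
  is_derive x 1 f df -> {for x, continuous f}.
Proof. by case=> /derivable1_diffP/differentiable_continuous. Qed.

(** Primitive of exp(-l x) (1 + A cos(b x) + B sin(b x)). The summand 1 keeps this integrand
    nonnegative when |A| + |B| <= 1, so that the fundamental theorem on a half-line for nonnegative
    functions applies. *)
Definition damped_primitive l b A B (x : R) : R := expR (- (l * x)) *
  (- l^-1 + (A * (b * sin (b * x) - l * cos (b * x)) -
             B * (l * sin (b * x) + b * cos (b * x))) / (l ^+ 2 + b ^+ 2)).

Lemma is_derive_damped l b A B (x : R) : 0 < l ->
  is_derive x 1 (damped_primitive l b A B)
    (expR (- (l * x)) * (1 + A * cos (b * x) + B * sin (b * x))).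
Proof.
move=> l0; rewrite /damped_primitive; apply: is_derive_eq.
have : l ^+ 2 + b ^+ 2 != 0 by rewrite gt_eqF// ltr_pwDl ?exprn_gt0// sqr_ge0.
rewrite /GRing.scale/= => lb0; field; rewrite lb0 gt_eqF//.
Qed.

Lemma cvg_damped l b A B : 0 < l ->
  damped_primitive l b A B x @[x --> +oo] --> 0.
Proof.
move=> l0.
have ce : expR (- (l * x)) @[x --> +oo] --> 0.
  apply: (@cvg_comp _ _ _ (fun x => l * x) (fun y => expR (- y)) _ +oo).
    by apply: gt0_cvgMry => //; exact: cvg_id.
  exact: cvgr_expR.
pose D := l ^+ 2 + b ^+ 2.
have D0 : 0 < D by rewrite /D ltr_pwDl ?exprn_gt0// sqr_ge0.
pose K := l^-1 + (`|A| * (`|b| + l) + `|B| * (l + `|b|)) / D.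
apply: (@squeeze_cvgr _ _ _ _ (fun x => - K * expR (- (l * x)))
    (fun x => K * expR (- (l * x)))).
- apply: nearW => x; rewrite mulNr -ler_norml /damped_primitive normrM.
  rewrite (ger0_norm (expR_ge0 _)) mulrC ler_wpM2r ?expR_ge0//.
  apply: le_trans (ler_normD _ _) _; rewrite normrN gtr0_norm ?invr_gt0// lerD2l.
  rewrite normrM [in leLHS]normfV (gtr0_norm D0) ler_pM2r ?invr_gt0//.
  apply: le_trans (ler_normB _ _) _; rewrite !normrM lerD// ler_wpM2l//.
  + apply: le_trans (ler_normB _ _) _; rewrite !normrM (gtr0_norm l0).
    by rewrite lerD// ler_piMr ?(ltW l0)// ler_norml ?sin_geN1 ?cos_geN1 ?sin_le1 ?cos_le1.
  + apply: le_trans (ler_normD _ _) _; rewrite !normrM (gtr0_norm l0).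
    by rewrite lerD// ler_piMr ?(ltW l0)// ler_norml ?sin_geN1 ?cos_geN1 ?sin_le1 ?cos_le1.
- by rewrite -[X in _ --> X](mulr0 (- K)); exact: cvgMr.
- by rewrite -[X in _ --> X](mulr0 K); exact: cvgMr.
Qed.

Lemma damped_half l b A B : 0 < l -> `|A| + `|B| <= 1 ->
  (\int[leb]_(x in `[0%R, +oo[)
     (expR (- (l * x)) * (1 + A * cos (b * x) + B * sin (b * x)))%:E =
   (l^-1 + (A * l + B * b) / (l ^+ 2 + b ^+ 2))%:E)%E.
Proof.
move=> l0 AB.
have D0 : l ^+ 2 + b ^+ 2 != 0 by rewrite gt_eqF// ltr_pwDl ?exprn_gt0// sqr_ge0.
have dF x := @is_derive_damped l b A B x l0.
rewrite (@ge0_continuous_FTC2y _ _ (damped_primitive l b A B) 0 0).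
- rewrite /damped_primitive !mulr0 oppr0 expR0 sin0 cos0 -EFinB; congr EFin.
  by field; rewrite D0 gt_eqF.
- move=> x _; rewrite mulr_ge0 ?expR_ge0//.
  have : `|A * cos (b * x)| <= `|A|.
    by rewrite normrM ler_piMr// ler_norml cos_geN1 cos_le1.
  have : `|B * sin (b * x)| <= `|B|.
    by rewrite normrM ler_piMr// ler_norml sin_geN1 sin_le1.
  rewrite !ler_norml; lra.
- by apply: continuous_subspaceT => x; exact: is_derive1_continuous.
- exact: cvg_damped.
- by move=> x _; have [] := dF x.
- by apply: cvg_at_right_filter; exact: is_derive1_continuous (dF 0).
- by move=> x _; rewrite derive1E; have [] := dF x.
Qed.

Lemma continuous_expR_abs l : continuous (fun x : R => expR (- (l * `|x|))).
Proof.
move=> x; apply: (@continuous_comp _ _ _ (fun x => - (l * `|x|)) expR).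
  by apply: cvgN; apply: cvgMr; exact: norm_continuous.
exact: continuous_expR.
Qed.

Lemma continuous_trig A B b :
  continuous (fun x : R => 1 + A * cos (b * x) + B * sin (b * x)).
Proof. by move=> x; exact: is_derive1_continuous. Qed.

Lemma trig_ge0 A B (x : R) : `|A| + `|B| <= 1 -> 0 <= 1 + A * cos x + B * sin x.
Proof.
move=> AB.
have : `|A * cos x| <= `|A| by rewrite normrM ler_piMr// ler_norml cos_geN1 cos_le1.
have : `|B * sin x| <= `|B| by rewrite normrM ler_piMr// ler_norml sin_geN1 sin_le1.
rewrite !ler_norml; lra.
Qed.

Lemma damped_line l b A B : 0 < l -> `|A| + `|B| <= 1 ->
  (\int[leb]_x (expR (- (l * `|x|)) * (1 + A * cos (b * x) + B * sin (b * x)))%:E =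
   (2 / l + 2 * A * l / (l ^+ 2 + b ^+ 2))%:E)%E.
Proof.
move=> l0 AB.
have D0 : l ^+ 2 + b ^+ 2 != 0 by rewrite gt_eqF// ltr_pwDl ?exprn_gt0// sqr_ge0.
rewrite ge0_integral_halves; last 2 first.
- by move=> x; rewrite mulr_ge0 ?expR_ge0// trig_ge0.
- move=> x; apply: (@continuousM _ _ (fun x => expR (- (l * `|x|)))).
    exact: continuous_expR_abs.
  exact: continuous_trig.
under eq_integral => x.
  rewrite inE/= in_itv/= andbT => x0; rewrite (ger0_norm x0); over.
rewrite damped_half//.
under eq_integral => x.
  rewrite inE/= in_itv/= andbT => x0.
  rewrite normrN (ger0_norm x0) mulrN cosN sinN mulrN -mulNr; over.
rewrite damped_half ?normrN// -EFinD; congr EFin.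
by field; rewrite D0 gt_eqF.
Qed.

(** This kernel replaces a Gaussian because it and its transform [cauchy c] are both integrated by
    elementary primitives: exponential times trigonometric for the one, an arctangent for the
    other. *)
Definition laplace c (x : R) : R := expR (- (2 * pi * c * `|x|)).

Definition cauchy c a : R := c / (pi * (c ^+ 2 + a ^+ 2)).

Lemma laplace_ge0 c (x : R) : 0 <= laplace c x. Proof. exact: expR_ge0. Qed.

Lemma laplace_le1 c (x : R) : 0 <= c -> laplace c x <= 1.
Proof. by move=> c0; rewrite expR_le1 oppr_le0 !mulr_ge0// pi_ge0. Qed.

Lemma measurable_laplace c : measurable_fun setT (laplace c).
Proof. by apply: continuous_measurable_fun; exact: continuous_expR_abs. Qed.

Lemma cauchy_ge0 c a : 0 <= c -> 0 <= cauchy c a.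
Proof. by move=> c0; rewrite divr_ge0// mulr_ge0 ?pi_ge0// addr_ge0 ?sqr_ge0. Qed.

Lemma rint_laplace c : 0 < c -> rint leb (laplace c).
Proof.
move=> c0; apply/integrableP; split.
  by apply/measurable_EFinP; exact: measurable_laplace.
have l0 : 0 < 2 * pi * c by rewrite !mulr_gt0// pi_gt0.
have := @damped_line (2 * pi * c) 0 0 0 l0; rewrite !normr0 addr0 => /(_ ler01) H.
have -> : (\int[leb]_x `|(EFin \o laplace c) x| =
    (2 / (2 * pi * c) + 2 * 0 * (2 * pi * c) / ((2 * pi * c) ^+ 2 + 0 ^+ 2))%:E)%E.
  rewrite -H; apply: eq_integral => x _ /=.
  by rewrite ger0_norm ?laplace_ge0// !mul0r !addr0 mulr1.
exact: ltry.
Qed.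

Lemma rint_damped c a A B : 0 < c -> `|A| + `|B| <= 1 ->
  rint leb (fun x => laplace c x * (1 + A * cos (2 * pi * a * x) + B * sin (2 * pi * a * x))).
Proof.
move=> c0 AB; apply: (rint_le _ (rintZ 2 (rint_laplace c0))).
  apply: measurable_funM; first exact: measurable_laplace.
  by apply: continuous_measurable_fun; exact: continuous_trig.
move=> x; rewrite normrM (ger0_norm (laplace_ge0 _ _)) mulrC ler_wpM2r ?laplace_ge0//.
rewrite ger0_norm ?trig_ge0//.
have : `|A * cos (2 * pi * a * x)| <= `|A|.
  by rewrite normrM ler_piMr// ler_norml cos_geN1 cos_le1.
have : `|B * sin (2 * pi * a * x)| <= `|B|.
  by rewrite normrM ler_piMr// ler_norml sin_geN1 sin_le1.
rewrite !ler_norml; lra.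
Qed.

Lemma Rint_damped c a A B : 0 < c -> `|A| + `|B| <= 1 ->
  \int[leb]_x (laplace c x * (1 + A * cos (2 * pi * a * x) + B * sin (2 * pi * a * x)))
  = (pi * c)^-1 + A * cauchy c a.
Proof.
move=> c0 AB; rewrite /Rintegral damped_line ?mulr_gt0 ?pi_gt0//=.
have D0 : c ^+ 2 + a ^+ 2 != 0 by rewrite gt_eqF// ltr_pwDl ?exprn_gt0// sqr_ge0.
have -> : (2 * pi * c) ^+ 2 + (2 * pi * a) ^+ 2 =
  (2 * pi) ^+ 2 * (c ^+ 2 + a ^+ 2) :> R by ring.
have : (pi : R) != 0 by rewrite gt_eqF// pi_gt0.
rewrite /cauchy; move: pi => p p0; field.
by rewrite D0 p0 (gt_eqF c0).
Qed.

Lemma laplace_fourier c a : 0 < c ->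
  cint leb (fun x => (laplace c x)%:C%C * expi (2 * pi * a * x)) /\
  Cint leb (fun x => (laplace c x)%:C%C * expi (2 * pi * a * x)) = (cauchy c a)%:C%C.
Proof.
move=> c0.
(* The cosine and sine parts are the nonnegative cases (A, B) = (1, 0) and (0, 1) minus the case (0,
   0). *)
have AB10 : `|1 : R| + `|0 : R| <= 1 by rewrite normr1 normr0 addr0.
have AB01 : `|0 : R| + `|1 : R| <= 1 by rewrite normr1 normr0 add0r.
have AB00 : `|0 : R| + `|0 : R| <= 1 by rewrite normr0 add0r ler01.
have i00 := rint_damped a c0 AB00.
have i01 := rint_damped a c0 AB01.
have i10 := rint_damped a c0 AB10.
have E00 := Rint_damped a c0 AB00.
have E01 := Rint_damped a c0 AB01.
have E10 := Rint_damped a c0 AB10.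
have Er : (fun x => complex.Re ((laplace c x)%:C%C * expi (2 * pi * a * x))) =
  (fun x => laplace c x * (1 + 1 * cos (2 * pi * a * x) + 0 * sin (2 * pi * a * x)) -
    laplace c x * (1 + 0 * cos (2 * pi * a * x) + 0 * sin (2 * pi * a * x))).
  by apply/funext => x; rewrite cRe_mulC/=; ring.
have Ei : (fun x => complex.Im ((laplace c x)%:C%C * expi (2 * pi * a * x))) =
  (fun x => laplace c x * (1 + 0 * cos (2 * pi * a * x) + 1 * sin (2 * pi * a * x)) -
    laplace c x * (1 + 0 * cos (2 * pi * a * x) + 0 * sin (2 * pi * a * x))).
  by apply/funext => x; rewrite cIm_mulC/=; ring.
split; first by split; rewrite ?Er ?Ei; exact: rintB.
rewrite /Cint Er Ei !RintegralB// E00 E01 E10.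
by congr (_ +i* _)%C; ring.
Qed.

Lemma cauchy_mass c b : 0 < c ->
  (\int[leb]_a (cauchy c (a - b))%:E = 1)%E.
Proof.
move=> c0.
have D0 x : c ^+ 2 + x ^+ 2 != 0 by rewrite gt_eqF// ltr_pwDl ?exprn_gt0// sqr_ge0.
have dA (s x : R) : is_derive x 1 (fun x => pi^-1 * atan ((x - s) / c)) (cauchy c (x - s)).
  apply: is_derive_eq; rewrite /GRing.scale/= /cauchy.
  have := D0 (x - s) => D0s.
  have : (pi : R) != 0 by rewrite gt_eqF// pi_gt0.
  move: pi => p p0; field.
  by rewrite D0s p0 (gt_eqF c0).
have cc (s : R) : continuous (fun x => cauchy c (x - s)).
  move=> x; apply: cvgMr; apply: cvgV.
    by rewrite mulf_neq0// gt_eqF// pi_gt0.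
  exact: (@is_derive1_continuous (fun x => pi * (c ^+ 2 + (x - s) ^+ 2))).
have half (s : R) : (\int[leb]_(a in `[0%R, +oo[) (cauchy c (a - s))%:E =
    (pi^-1 * (pi / 2) - pi^-1 * atan ((0 - s) / c))%:E)%E.
  rewrite (@ge0_continuous_FTC2y _ _ (fun x => pi^-1 * atan ((x - s) / c)) 0
    (pi^-1 * (pi / 2))).
  - by [].
  - by move=> x _; apply: cauchy_ge0; exact: ltW.
  - exact: continuous_subspaceT.
  - apply: cvgMr.
    apply: (@cvg_comp _ _ _ (fun x => (x - s) / c) (@atan R) _ +oo); last exact: cvgy_atan.
    apply: gt0_cvgMly; first by rewrite invr_gt0.
    apply/cvgryPge => M; near=> x; rewrite lerBrDr; near: x.
    by apply: nbhs_pinfty_ge; rewrite num_real.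
  - by move=> x _; have [] := dA s x.
  - by apply: cvg_at_right_filter; exact: is_derive1_continuous (dA s 0).
  - by move=> x _; rewrite derive1E; have [] := dA s x.
rewrite ge0_integral_halves => [||//]; last by move=> x; apply: cauchy_ge0; exact: ltW.
rewrite half.
have E x : cauchy c (- x - b) = cauchy c (x - (- b)).
  by rewrite /cauchy; congr (c / (pi * (_ + _))); ring.
under eq_integral do rewrite E.
rewrite half -EFinD; congr EFin.
rewrite !sub0r opprK mulNr atanN.
have : (pi : R) != 0 by rewrite gt_eqF// pi_gt0.
by move: pi => p p0; field.
Unshelve. all: by end_near. Qed.

Lemma measurable_cauchy c : 0 < c -> measurable_fun setT (cauchy c).
Proof.
move=> c0; apply: continuous_measurable_fun => x; apply: cvgMr; apply: cvgV.
  by rewrite mulf_neq0// gt_eqF ?pi_gt0// ltr_pwDl ?exprn_gt0// sqr_ge0.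
exact: (@is_derive1_continuous (fun x => pi * (c ^+ 2 + x ^+ 2))).
Qed.

Lemma measurable_subr (b : R) : measurable_fun setT (fun a : R => a - b).
Proof. by apply: measurable_funB => //; exact: measurable_cst. Qed.

Lemma rint_cauchy c b : 0 < c -> rint leb (fun a => cauchy c (a - b)).
Proof.
move=> c0; apply/integrableP; split.
  apply/measurable_EFinP; apply: measurableT_comp (measurable_cauchy c0) _.
  exact: measurable_subr.
have := cauchy_mass b c0.
under [X in _ -> (X < _)%E]eq_integral => x _ do
  rewrite /= ger0_norm ?cauchy_ge0// ?(ltW c0)//.
by move=> ->; exact: ltry.
Qed.

Lemma Rint_cauchy c b : 0 < c -> \int[leb]_a cauchy c (a - b) = 1.
Proof. by move=> c0; rewrite /Rintegral cauchy_mass. Qed.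

(** Bounded substitute for a^2: the Cauchy kernel has no second moment, but its integral against
    [sqfrac] is at most c, which makes it an approximate identity as c tends to 0. *)
Definition sqfrac a : R := a ^+ 2 / (1 + a ^+ 2).

Lemma sqfrac_ge0 a : 0 <= sqfrac a.
Proof. by rewrite divr_ge0 ?addr_ge0 ?sqr_ge0. Qed.

Lemma sqfrac_le1 a : sqfrac a <= 1.
Proof. by rewrite /sqfrac ler_pdivrMr ?mul1r ?lerDr// ltr_pwDl// sqr_ge0. Qed.

Lemma measurable_sqfrac : measurable_fun setT sqfrac.
Proof.
apply: continuous_measurable_fun => x; apply: cvgM.
  exact: (@is_derive1_continuous (fun x => x ^+ 2)).
apply: cvgV; first by rewrite gt_eqF// ltr_pwDl// sqr_ge0.
exact: (@is_derive1_continuous (fun x => 1 + x ^+ 2)).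
Qed.

Lemma cauchy_sqfrac c a : 0 < c -> cauchy c a * sqfrac a <= c * cauchy 1 a.
Proof.
move=> c0; rewrite /cauchy /sqfrac expr1n.
have A0 : 0 < 1 + a ^+ 2 by rewrite ltr_pwDl// sqr_ge0.
have C0 : 0 < c ^+ 2 + a ^+ 2 by rewrite ltr_pwDl ?exprn_gt0// sqr_ge0.
have p0 := pi_gt0 R; move: pi p0 => p p0.
(* The two denominators change places, and the remaining fraction a^2 / (c^2 + a^2) is at most 1. *)
have -> : c / (p * (c ^+ 2 + a ^+ 2)) * (a ^+ 2 / (1 + a ^+ 2)) =
   (c * (1 / (p * (1 + a ^+ 2)))) * (a ^+ 2 / (c ^+ 2 + a ^+ 2)).
  by field; rewrite !gt_eqF.
apply: ler_piMr; last by rewrite ler_pdivrMr// mul1r lerDr sqr_ge0.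
by rewrite mulr_ge0 ?(ltW c0)// divr_ge0// mulr_ge0 ?ltW.
Qed.

Lemma rint_cauchy_sqfrac c b : 0 < c ->
  rint leb (fun a => cauchy c (a - b) * sqfrac (a - b)).
Proof.
move=> c0; apply: (rint_le _ (rint_cauchy b c0)).
  apply: measurable_funM; apply: measurableT_comp (measurable_subr b).
    exact: measurable_cauchy.
  exact: measurable_sqfrac.
move=> x; have h := cauchy_ge0 (x - b) (ltW c0).
rewrite ger0_norm; last exact: mulr_ge0 h (sqfrac_ge0 _).
exact: ler_piMr h (sqfrac_le1 _).
Qed.

Lemma Rint_cauchy_sqfrac c b : 0 < c ->
  \int[leb]_a (cauchy c (a - b) * sqfrac (a - b)) <= c.
Proof.
move=> c0; rewrite -[leRHS]mulr1 -(Rint_cauchy b ltr01) -RintegralZl//; last first.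
  exact: rint_cauchy.
apply: le_Rintegral => //; first exact: rint_cauchy_sqfrac.
  by apply: rintZ; exact: rint_cauchy.
by move=> x _; exact: cauchy_sqfrac.
Qed.

Definition laplace2 c (x : plane R) : R := laplace c x.1 * laplace c x.2.

Definition cauchy2 c (x : plane R) : R := cauchy c x.1 * cauchy c x.2.

Lemma laplace2_ge0 c (z : plane R) : 0 <= laplace2 c z.
Proof. by rewrite mulr_ge0 ?laplace_ge0. Qed.

Lemma laplace2_le1 c (z : plane R) : 0 <= c -> laplace2 c z <= 1.
Proof. by move=> c0; rewrite mulr_ile1 ?laplace_ge0 ?laplace_le1. Qed.

Lemma rint_laplace2 c : 0 < c -> rint (@leb2 R) (laplace2 c).
Proof. by move=> c0; have := rint_prod (rint_laplace c0) (rint_laplace c0). Qed.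

Lemma measurable_laplace2 c : measurable_fun setT (laplace2 c).
Proof. by apply: measurable_funM; apply: measurableT_comp (measurable_laplace c) _. Qed.

Lemma cauchy2_ge0 c (z : plane R) : 0 <= c -> 0 <= cauchy2 c z.
Proof. by move=> c0; rewrite mulr_ge0 ?cauchy_ge0. Qed.

Lemma laplace2_fourier c xi : 0 < c ->
  Cint (@leb2 R) (fun x => (laplace2 c x)%:C%C * expi (2 * pi * dot x xi)) =
  (cauchy2 c xi)%:C%C.
Proof.
move=> c0.
have [i1 E1] := laplace_fourier xi.1 c0; have [i2 E2] := laplace_fourier xi.2 c0.
transitivity (Cint leb (fun x => Cint leb (fun y =>
  ((laplace c x)%:C%C * expi (2 * pi * xi.1 * x)) *
  ((laplace c y)%:C%C * expi (2 * pi * xi.2 * y))))).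
  rewrite -(@Cint_prod1 _ _ _ _ _ leb leb _ _ (rint_laplace c0) (rint_laplace c0)
    (fun z => ((laplace c z.1)%:C%C * expi (2 * pi * xi.1 * z.1)) *
  ((laplace c z.2)%:C%C * expi (2 * pi * xi.2 * z.2)))).
  - apply: eq_Cint => -[x y] /=; rewrite /laplace2/= rmorphM/= mulrACA -expiD.
    by congr (_ * expi _); rewrite /dot/=; ring.
  - apply: cmeasM; first exact: (cmeas_comp (cint_cmeas i1) measurable_fst).
    exact: (cmeas_comp (cint_cmeas i2) measurable_snd).
  - move=> x y; rewrite !cabsM !cabs_expi !mulr1 !cabsR.
    by rewrite !ger0_norm ?laplace_ge0.
under eq_fun do rewrite CintZ// E2 mulrC.
by rewrite CintZ// E1 mulrC -rmorphM.
Qed.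

Definition pshift (eta x : plane R) : plane R := (x.1 - eta.1, x.2 - eta.2).

Section cauchy2_shift.
Variables (c : R) (eta : plane R).
Hypothesis c0 : 0 < c.

Lemma rint_cauchy2 : rint (@leb2 R) (fun x => cauchy2 c (pshift eta x)).
Proof. by have := rint_prod (rint_cauchy eta.1 c0) (rint_cauchy eta.2 c0). Qed.

Lemma Rint_cauchy2 : \int[@leb2 R]_x cauchy2 c (pshift eta x) = 1.
Proof.
have i1 := rint_cauchy eta.1 c0; have i2 := rint_cauchy eta.2 c0.
rewrite (@Rintegral_prod1 _ _ _ _ _ leb leb _ _ i1 i2) => [||x y].
- rewrite /cauchy2 /pshift/=.
  under eq_Rintegral do rewrite RintegralZl//= Rint_cauchy// mulr1.
  exact: Rint_cauchy.
- by have /measurable_int/measurable_EFinP := rint_cauchy2.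
- by rewrite ger0_norm// cauchy2_ge0// ltW.
Qed.

Let defect (x : plane R) := sqfrac (x.1 - eta.1) + sqfrac (x.2 - eta.2).

Lemma rint_cauchy2_sqfrac :
  rint (@leb2 R) (fun x => cauchy2 c (pshift eta x) * defect x).
Proof.
have i1 := rint_cauchy eta.1 c0; have i2 := rint_cauchy eta.2 c0.
have j1 := rint_cauchy_sqfrac eta.1 c0; have j2 := rint_cauchy_sqfrac eta.2 c0.
have := rintD (rint_prod j1 i2) (rint_prod i1 j2).
by congr rint; apply/funext => x; rewrite /cauchy2 /defect/=; ring.
Qed.

Lemma Rint_cauchy2_sqfrac :
  \int[@leb2 R]_x (cauchy2 c (pshift eta x) * defect x) <= 2 * c.
Proof.
have i1 := rint_cauchy eta.1 c0; have i2 := rint_cauchy eta.2 c0.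
have j1 := rint_cauchy_sqfrac eta.1 c0; have j2 := rint_cauchy_sqfrac eta.2 c0.
pose f1 (z : plane R) := cauchy c (z.1 - eta.1) * sqfrac (z.1 - eta.1) * cauchy c (z.2 - eta.2).
pose f2 (z : plane R) := cauchy c (z.1 - eta.1) * (cauchy c (z.2 - eta.2) * sqfrac (z.2 - eta.2)).
have k1 : rint (@leb2 R) f1 := rint_prod j1 i2.
have k2 : rint (@leb2 R) f2 := rint_prod i1 j2.
have -> : \int[@leb2 R]_x (cauchy2 c (pshift eta x) * defect x) =
    \int[@leb2 R]_x f1 x + \int[@leb2 R]_x f2 x.
  rewrite -RintegralD//; apply: eq_Rintegral => x _.
  by rewrite /f1 /f2 /cauchy2 /defect/=; ring.
have c0' := ltW c0.
rewrite mulr_natl mulr2n lerD//.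
- rewrite (@Rintegral_prod1 _ _ _ _ _ leb leb _ _ j1 i2 f1) => [||x y].
  + under eq_Rintegral do rewrite /f1/= RintegralZl//= Rint_cauchy// mulr1.
    exact: Rint_cauchy_sqfrac.
  + by have /measurable_int/measurable_EFinP := k1.
  + rewrite /f1/= ger0_norm; first exact: lexx.
    by do ![exact: cauchy_ge0 | exact: sqfrac_ge0 | apply: mulr_ge0].
- rewrite (@Rintegral_prod1 _ _ _ _ _ leb leb _ _ i1 j2 f2) => [||x y].
  + under eq_Rintegral do rewrite /f2/= RintegralZl//=.
    rewrite RintegralZr// Rint_cauchy// mul1r.
    exact: Rint_cauchy_sqfrac.
  + by have /measurable_int/measurable_EFinP := k2.
  + rewrite /f2/= ger0_norm; first exact: lexx.
    by do ![exact: cauchy_ge0 | exact: sqfrac_ge0 | apply: mulr_ge0].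
Qed.

End cauchy2_shift.

End kernels.

(** * Fourier inversion for compactly supported continuous data *)

Section plane_analysis.
Context {R : realType}.
Notation mu := (@leb2 R).
Implicit Types (f G : plane R -> R[i]) (c : R) (x y eta xi : plane R).

Lemma cnorm2E f : rint mu (fun x => cabs (f x) ^+ 2) ->
  cnorm 2%:E f = (Num.sqrt (\int[mu]_x cabs (f x) ^+ 2))%:E.
Proof.
move=> fi; rewrite /cnorm unlock.
have -> : (\int[mu]_x `|(cabs (f x))%:E| `^ 2 = (\int[mu]_x cabs (f x) ^+ 2)%:E)%E.
  rewrite /Rintegral fineK; last exact: integrable_fin_num.
  apply: eq_integral => x _ /=; rewrite ger0_norm ?cabs_ge0//.
  by rewrite powR_mulrn ?cabs_ge0.
rewrite poweR_EFin powR12_sqrt//.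
by apply: Rintegral_ge0 => x _; rewrite sqr_ge0.
Qed.

Lemma cnorm1E f : cint mu f -> (cnorm 1%:E f < +oo)%E.
Proof.
move=> /cint_cabs /integrableP[_]; rewrite /cnorm Lnorm1.
by under [X in _ -> (X < _)%E]eq_integral => x _ do rewrite /= .
Qed.

Lemma lipschitz_continuous2 (h : R * R -> R) (K : R) :
  (forall x y, `|h x - h y| <= K * (`|x.1 - y.1| + `|x.2 - y.2|)) -> continuous h.
Proof.
move=> hK x; apply/cvgrPdist_lt => e e0.
have K0 : 0 < `|K| + 1 by rewrite ltr_wpDl.
near=> y.
have y1 : `|x.1 - y.1| < e / (2 * (`|K| + 1)).
  near: y; apply: (@cvgr_dist_lt _ _ _ (nbhs x) _ fst x.1); last first.
    by rewrite divr_gt0// mulr_gt0.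
  exact: cvg_fst.
have y2 : `|x.2 - y.2| < e / (2 * (`|K| + 1)).
  near: y; apply: (@cvgr_dist_lt _ _ _ (nbhs x) _ snd x.2); last first.
    by rewrite divr_gt0// mulr_gt0.
  exact: cvg_snd.
apply: le_lt_trans (hK _ _) _.
apply: (@le_lt_trans _ _ ((`|K| + 1) * (`|x.1 - y.1| + `|x.2 - y.2|))).
  by rewrite ler_wpM2r ?addr_ge0// (le_trans (ler_norm K))// lerDl.
rewrite mulrC -ltr_pdivlMr//.
have -> : e / (`|K| + 1) = e / (2 * (`|K| + 1)) + e / (2 * (`|K| + 1)).
  by field; rewrite gt_eqF.
exact: ltrD.
Unshelve. all: by end_near. Qed.

(** Continuous data of bounded support; vanishing outside a square centred at the origin expresses
    compact support in the form in which phases are estimated. *)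
Definition Cc G : Prop :=
  [/\ continuous (fun x : R * R => complex.Re (G x)),
      continuous (fun x : R * R => complex.Im (G x)),
      exists M, forall x, cabs (G x) <= M &
      exists2 r, 0 < r & forall x, G x != 0 -> `|x.1| <= r /\ `|x.2| <= r].

Lemma Cc_cmeas G : Cc G -> cmeas G.
Proof. by case=> [c1 c2 _ _]; split; exact: continuous_measurable2. Qed.

Definition square_indic (r : R) x : R := \1_`[-r, r] x.1 * \1_`[-r, r] x.2.

Lemma rint_square_indic r : rint mu (square_indic r).
Proof. exact: rint_prod (integrable_indic_itv _ _ _ _) (integrable_indic_itv _ _ _ _). Qed.

Lemma square_indic_ge0 r x : 0 <= square_indic r x.
Proof. by rewrite mulr_ge0. Qed.

Lemma square_indic1 r x : `|x.1| <= r -> `|x.2| <= r -> square_indic r x = 1.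
Proof.
rewrite !ler_norml => x1 x2; rewrite /square_indic !indicE.
by rewrite !mem_set ?mulr1//= in_itv.
Qed.

Lemma Cc_bounded_support G : Cc G -> exists M, exists2 r, 0 < r &
  (forall x, cabs (G x) <= M * square_indic r x) /\
  (forall x, G x != 0 -> `|x.1| <= r /\ `|x.2| <= r).
Proof.
case=> _ _ [M GM] [r r0 Gr]; exists M, r => //; split => // x.
have M0 : 0 <= M := le_trans (cabs_ge0 _) (GM x).
have [->|/Gr[x1 x2]] := eqVneq (G x) 0; first by rewrite cabs0 mulr_ge0// square_indic_ge0.
by rewrite square_indic1// mulr1.
Qed.

Lemma Cc_cint G : Cc G -> cint mu G.
Proof.
move=> CG; have [M [r _ [GM _]]] := Cc_bounded_support CG.
by apply: (cint_dom (Cc_cmeas CG) _ GM); apply: rintZ; exact: rint_square_indic.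
Qed.

Lemma Cc_rint2 G : Cc G -> rint mu (fun x => cabs (G x) ^+ 2).
Proof.
move=> CG; have [_ _ [M GM] _] := CG.
apply: (rint_le _ (rintZ M (cint_cabs (Cc_cint CG)))).
  exact: cmeas_cabs2 (Cc_cmeas CG).
by move=> x; rewrite ger0_norm ?sqr_ge0// expr2 ler_wpM2r ?cabs_ge0.
Qed.

Lemma cint_mul_expi G (th : plane R -> R) : cint mu G -> measurable_fun setT th ->
  cint mu (fun xi => G xi * expi (th xi)).
Proof.
move=> iG mth; apply: (cint_dom _ (cint_cabs iG)) => [|x].
  by apply: cmeasM; [exact: cint_cmeas iG|exact: cmeas_expi].
by rewrite cabsM cabs_expi mulr1.
Qed.

(** Common source of continuity in x ([ift_lipschitz]) and in t ([evolution_continuous_time]). The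
    phases are compared on the support of G only, where xi is bounded. *)
Lemma osc_lipschitz G (th1 th2 : plane R -> R) (L : R) : cint mu G ->
  measurable_fun setT th1 -> measurable_fun setT th2 -> 
  (forall x, G x != 0 -> `|th1 x - th2 x| <= L) ->
  cabs (Cint mu (fun xi => G xi * expi (th1 xi)) - Cint mu (fun xi => G xi * expi (th2 xi)))
    <= L * \int[mu]_x cabs (G x).
Proof.
move=> iG m1 m2 thL.
have i1 := cint_mul_expi iG m1; have i2 := cint_mul_expi iG m2.
rewrite -[X in _ - X]mul1r -mulNr -CintZ// -CintD//; last exact: cintZ.
have i3 := cintD i1 (cintZ (-1) i2).
apply: le_trans (cabs_Cint i3) _.
rewrite -RintegralZl//; last exact: cint_cabs.
apply: le_Rintegral => //; first exact: cint_cabs.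
  by apply: rintZ; exact: cint_cabs.
move=> x _; rewrite mulN1r -mulrBr cabsM mulrC.
have [->|/thL h] := eqVneq (G x) 0; first by rewrite cabs0 !mulr0.
by rewrite ler_wpM2r ?cabs_ge0// (le_trans (cabs_expi_sub _ _)).
Qed.

Lemma measurable_dot y : measurable_fun setT (fun x => dot x y).
Proof.
by apply: measurable_funD; apply: measurable_funM => //; exact: measurable_cst.
Qed.

Lemma dotC x y : dot x y = dot y x.
Proof. by rewrite /dot mulrC [X in _ + X]mulrC. Qed.

Lemma measurable_dotr x : measurable_fun setT (fun y => dot x y).
Proof. by under eq_fun do rewrite dotC; exact: measurable_dot. Qed.

(** The inverse Fourier integral; that it inverts the relation [fourier] is proved in
    [fourier_ift]. *)
Definition ift G x : R[i] := Cint mu (fun xi => G xi * expi (2 * pi * dot x xi)).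

Lemma measurable_phase (k : R) y : measurable_fun setT (fun xi => k * dot y xi).
Proof. by apply: measurable_funM; [exact: measurable_cst|exact: measurable_dotr]. Qed.

Lemma measurable_phasel (k : R) y : measurable_fun setT (fun x => k * dot x y).
Proof. by apply: measurable_funM; [exact: measurable_cst|exact: measurable_dot]. Qed.

Lemma cabs_ift G x : cint mu G -> cabs (ift G x) <= \int[mu]_y cabs (G y).
Proof.
move=> iG; apply: le_trans (cabs_Cint (cint_mul_expi iG (measurable_phase _ _))) _.
by under eq_Rintegral do rewrite cabsM cabs_expi mulr1.
Qed.

Lemma ift_lipschitz G : Cc G -> exists K, forall x y,
  cabs (ift G x - ift G y) <= K * (`|x.1 - y.1| + `|x.2 - y.2|).
Proof.
move=> CG; have [M [r r0 [_ Gr]]] := Cc_bounded_support CG.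
exists (2 * pi * r * \int[mu]_x cabs (G x)) => x y.
rewrite mulrAC; apply: osc_lipschitz;
  [exact: Cc_cint|exact: measurable_phase|exact: measurable_phase|].
move=> z /Gr[z1 z2].
rewrite -mulrBr normrM ger0_norm ?mulr_ge0 ?pi_ge0// -[leRHS]mulrA.
rewrite ler_wpM2l ?mulr_ge0 ?pi_ge0//.
have -> : dot x z - dot y z = z.1 * (x.1 - y.1) + z.2 * (x.2 - y.2).
  by rewrite /dot; ring.
apply: le_trans (ler_normD _ _) _; rewrite !normrM mulrDr.
by apply: lerD; exact: ler_wpM2r.
Qed.

Lemma ift_continuous G : Cc G ->
  continuous (fun x : R * R => complex.Re (ift G x)) /\
  continuous (fun x : R * R => complex.Im (ift G x)).
Proof.
move=> /ift_lipschitz[K hK]; split; apply: (@lipschitz_continuous2 _ K) => x y;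
  apply: le_trans (hK x y).
- by rewrite -cReN -cReD; exact: cabs_Re.
- by rewrite -cImN -cImD; exact: cabs_Im.
Qed.

Lemma ift_cmeas G : Cc G -> cmeas (ift G).
Proof. by move=> /ift_continuous[]; split; exact: continuous_measurable2. Qed.

End plane_analysis.

Section inversion.
Context {R : realType}.
Notation mu := (@leb2 R).
Implicit Types (c : R) (x y eta xi : plane R).
Variable G : plane R -> R[i].
Hypothesis CG : Cc G.

Let iG : cint mu G := Cc_cint CG.
Let N1 := \int[mu]_x cabs (G x).
Let E := \int[mu]_x cabs (G x) ^+ 2.

(* [fourierL1 (damped_ift c) = smoothed c]: multiplying by the Laplace kernel
   makes [ift G] integrable and convolves its transform with the Cauchy kernel,
   an approximate identity as c tends to 0. *)
Definition damped_ift c x : R[i] := (laplace2 c x)%:C%C * ift G x.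

Definition smoothed c eta : R[i] :=
  Cint mu (fun xi => G xi * (cauchy2 c (pshift eta xi))%:C%C).

Lemma cmeas_laplace2 c : cmeas (fun x => (laplace2 c x)%:C%C).
Proof. by apply: cmeasR; exact: measurable_laplace2. Qed.

Lemma cmeas_damped_ift c : cmeas (damped_ift c).
Proof. by apply: cmeasM; [exact: cmeas_laplace2|exact: ift_cmeas]. Qed.

Lemma cabs_damped_ift c x : cabs (damped_ift c x) <= laplace2 c x * N1.
Proof.
rewrite cabsM cabsR ger0_norm ?laplace2_ge0// ler_wpM2l ?laplace2_ge0//.
exact: cabs_ift.
Qed.

Lemma cint_damped_ift c : 0 < c -> cint mu (damped_ift c).
Proof.
move=> c0; apply: (cint_dom (cmeas_damped_ift c) (rintZ N1 (rint_laplace2 c0))) => x.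
by rewrite mulrC cabs_damped_ift.
Qed.

Lemma measurable_dot2 : measurable_fun setT (fun z : plane R * plane R => dot z.1 z.2).
Proof.
by apply: measurable_funD; apply: measurable_funM;
  do 2 (apply: measurableT_comp => //).
Qed.

Lemma fourierL1_damped_ift c eta : 0 < c ->
  fourierL1 (damped_ift c) eta = smoothed c eta.
Proof.
move=> c0; rewrite /fourierL1 cintegralE /smoothed.
pose F (z : plane R * plane R) := (laplace2 c z.1)%:C%C * G z.2 *
   expi (2 * pi * dot z.1 z.2 - 2 * pi * dot z.1 eta).
have mF : cmeas F.
  apply: cmeasM; first apply: cmeasM.
  - exact: (cmeas_comp (cmeas_laplace2 c) measurable_fst).
  - exact: (cmeas_comp (Cc_cmeas CG) measurable_snd).
  - apply: cmeas_expi; apply: measurable_funB; apply: measurable_funM => //.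
    + exact: measurable_dot2.
    + exact: (measurableT_comp (measurable_dot eta) measurable_fst).
have bF x xi : cabs (F (x, xi)) <= laplace2 c x * cabs (G xi).
  by rewrite /F/= !cabsM cabs_expi mulr1 cabsR ger0_norm// laplace2_ge0.
have iw := rint_laplace2 c0; have iaG := cint_cabs iG.
have H := plane_Fubini iw iaG mF bF.
transitivity (Cint mu (fun x => Cint mu (fun y => F (x, y)))).
  apply: eq_Cint => x; rewrite /damped_ift /ift mulrA.
  rewrite -CintZ; last exact: cint_mul_expi (measurable_phase _ _).
  apply: eq_Cint => xi; rewrite /F/= expiD; ring.
apply: (etrans H); apply: eq_Cint => xi.
have E1 := laplace2_fourier (pshift eta xi) c0.
have i1 : cint mu (fun x => (laplace2 c x)%:C%C *
    expi (2 * pi * dot x (pshift eta xi))).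
  apply: cint_mul_expi; first by apply: cintR; exact: rint_laplace2.
  exact: measurable_phasel.
rewrite -E1 -(CintZ (G xi) i1).
apply: eq_Cint => x; rewrite /F/=.
have -> : 2 * pi * dot x xi - 2 * pi * dot x eta =
  2 * pi * dot x (pshift eta xi) by rewrite /dot/pshift/=; ring.
by rewrite mulrA [G xi * _]mulrC.
Qed.

(** Plancherel before the limit c -> 0: expand the conjugate factor of |ift G|^2 as an integral over
    eta and exchange the integrals; the inner one is then [fourierL1 (damped_ift c)], that is
    [smoothed c]. *)
Lemma damped_energy c : 0 < c ->
  \int[mu]_x (laplace2 c x * cabs (ift G x) ^+ 2) =
  complex.Re (Cint mu (fun eta => conjc (G eta) * smoothed c eta)).
Proof.
move=> c0.
pose F (z : plane R * plane R) := damped_ift c z.1 *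
  (conjc (G z.2) * expi (- (2 * pi * dot z.1 z.2))).
have mF : cmeas F.
  apply: cmeasM; first exact: (cmeas_comp (cmeas_damped_ift c) measurable_fst).
  apply: cmeasM; first exact: (cmeas_comp (cmeasJ (Cc_cmeas CG)) measurable_snd).
  apply: cmeas_expi; apply: measurable_funN.
  by apply: measurable_funM; [exact: measurable_cst|exact: measurable_dot2].
have bF x xi : cabs (F (x, xi)) <= (N1 * laplace2 c x) * cabs (G xi).
  rewrite /F/= cabsM [cabs (conjc _ * _)]cabsM cabs_expi mulr1 cabsJ.
  rewrite ler_wpM2r ?cabs_ge0// [N1 * _]mulrC; exact: cabs_damped_ift.
have iw := rintZ N1 (rint_laplace2 c0); have iaG := cint_cabs iG.
have H := plane_Fubini iw iaG mF bF.
have E1 : Cint mu (fun x => Cint mu (fun y => F (x, y))) =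
   (\int[mu]_x (laplace2 c x * cabs (ift G x) ^+ 2))%:C%C.
  rewrite -CintR; apply: eq_Cint => x.
  rewrite realcM -mulcJ mulrA -/(damped_ift c x) /ift -CintJ; last first.
    exact: cint_mul_expi (measurable_phase _ _).
  rewrite -CintZ; last by apply: cintJ; exact: cint_mul_expi (measurable_phase _ _).
  by apply: eq_Cint => xi; rewrite /F/= rmorphM/= expiN.
have E2 : Cint mu (fun xi => Cint mu (fun x => F (x, xi))) =
   Cint mu (fun eta => conjc (G eta) * smoothed c eta).
  apply: eq_Cint => xi; rewrite -(fourierL1_damped_ift xi c0) /fourierL1 cintegralE -CintZ.
    by apply: eq_Cint => x; rewrite /F/= ; ring.
  under eq_fun do rewrite mulrC.
  apply: cint_mul_expi; first exact: cint_damped_ift.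
  by apply: measurable_funN; exact: measurable_phasel.
by have := congr1 (@complex.Re R) (etrans (esym E1) (etrans H E2)).
Qed.

(** Measurability is extracted from Fubini, whose dominating function must be integrable in eta as
    well; hence the factor [laplace2 1], undone afterwards by its inverse [v]. *)
Lemma cmeas_smoothed c : 0 < c -> cmeas (smoothed c).
Proof.
move=> c0.
pose F (z : plane R * plane R) := (laplace2 1 z.1)%:C%C *
  (expi (- (2 * pi * dot z.2 z.1)) * damped_ift c z.2).
have mF : cmeas F.
  apply: cmeasM; first exact: (cmeas_comp (cmeas_laplace2 1) measurable_fst).
  apply: cmeasM; last exact: (cmeas_comp (cmeas_damped_ift c) measurable_snd).
  apply: cmeas_expi; apply: measurable_funN.
  apply: measurable_funM; first exact: measurable_cst.
  by under eq_fun do rewrite dotC; exact: measurable_dot2.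
have bF eta x : cabs (F (eta, x)) <= laplace2 1 eta * (N1 * laplace2 c x).
  rewrite /F cabsM [cabs (expi _ * _)]cabsM cabs_expi mul1r cabsR.
  rewrite ger0_norm ?laplace2_ge0// ler_wpM2l ?laplace2_ge0// [N1 * _]mulrC.
  exact: cabs_damped_ift.
have := plane_cint_Cint (rint_laplace2 ltr01)
  (rintZ N1 (rint_laplace2 c0)) mF bF.
move=> /cint_cmeas mS.
pose v (x : plane R) := expR (2 * pi * 1 * `|x.1|) * expR (2 * pi * 1 * `|x.2|).
have mv : measurable_fun setT v.
  have me : measurable_fun setT (fun a : R => expR (2 * pi * 1 * `|a|)).
    apply: continuous_measurable_fun => a.
    apply: (@continuous_comp _ _ _ (fun a => 2 * pi * 1 * `|a|) expR).
      by apply: cvgMr; exact: norm_continuous.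
    exact: continuous_expR.
  by apply: measurable_funM; apply: measurableT_comp me _.
have vl x : v x * laplace2 1 x = 1.
  rewrite /v /laplace2 /laplace mulrACA !expRxMexpNx_1 mulr1//.
have -> : smoothed c = (fun eta => (v eta)%:C%C * Cint mu (fun x => F (eta, x))).
  apply/funext => eta; rewrite -(fourierL1_damped_ift eta c0) /fourierL1 cintegralE /F/=.
  rewrite CintZ; last first.
    under eq_fun do rewrite mulrC.
    apply: cint_mul_expi; first exact: cint_damped_ift.
    by apply: measurable_funN; exact: measurable_phasel.
  by rewrite mulrA -realcM vl mul1r.
by apply: cmeasM => //; exact: cmeasR.
Qed.

Lemma cauchy2_shiftC c eta xi : cauchy2 c (pshift eta xi) = cauchy2 c (pshift xi eta).
Proof.
rewrite /cauchy2 /cauchy /pshift/=; do 2 congr (_ * _);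
  by congr (_^-1); congr (_ * _); ring.
Qed.

Lemma measurable_cauchy2_shift c : 0 < c ->
  measurable_fun setT (fun z : plane R * plane R => cauchy2 c (pshift z.1 z.2)).
Proof.
move=> c0; apply: measurable_funM; apply: measurableT_comp (measurable_cauchy c0) _;
  by apply: measurable_funB; do 2 (apply: measurableT_comp => //).
Qed.

Lemma measurable_cauchy2_shift2 c eta : 0 < c ->
  measurable_fun setT (fun xi => cauchy2 c (pshift eta xi)).
Proof. by move=> /(rint_cauchy2 eta) /measurable_int/measurable_EFinP. Qed.

Lemma rint_bounded_cauchy2 c eta (h : plane R -> R) (M : R) : 0 < c ->
  measurable_fun setT h -> (forall x, `|h x| <= M) ->
  rint mu (fun xi => h xi * cauchy2 c (pshift eta xi)).
Proof.
move=> c0 mh hM; apply: (rint_le _ (rintZ M (rint_cauchy2 eta c0))).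
  by apply: measurable_funM => //; exact: measurable_cauchy2_shift2.
move=> x; rewrite normrM; have h0 := cauchy2_ge0 (pshift eta x) (ltW c0).
by rewrite (ger0_norm h0); exact: ler_wpM2r.
Qed.

Lemma cabs_smoothed c eta : 0 < c ->
  cabs (smoothed c eta) <= \int[mu]_xi (cabs (G xi) * cauchy2 c (pshift eta xi)).
Proof.
move=> c0; have [_ _ [M GM] _] := CG.
have mG := measurable_cabs (Cc_cmeas CG).
have i : cint mu (fun xi => G xi * (cauchy2 c (pshift eta xi))%:C%C).
  apply: (cint_dom _ (@rint_bounded_cauchy2 c eta _ M c0 mG _)).
  - by apply: cmeasM; [exact: Cc_cmeas|apply: cmeasR; exact: measurable_cauchy2_shift2].
  - by move=> x; rewrite ger0_norm ?cabs_ge0.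
  - by move=> x; rewrite cabsM cabsR ger0_norm// cauchy2_ge0// ltW.
apply: le_trans (cabs_Cint i) _.
rewrite le_eqVlt; apply/orP; left; apply/eqP; apply: eq_Rintegral => x _.
by rewrite cabsM cabsR ger0_norm// cauchy2_ge0// ltW.
Qed.

(** Jensen for the probability density [cauchy2 c (pshift eta _)]: the variance of |G| about its
    mean a is nonnegative. *)
Lemma cabs_smoothed_sqr c eta : 0 < c -> cabs (smoothed c eta) ^+ 2 <=
  \int[mu]_xi (cabs (G xi) ^+ 2 * cauchy2 c (pshift eta xi)).
Proof.
move=> c0; have [_ _ [M GM] _] := CG.
have M0 : 0 <= M := le_trans (cabs_ge0 _) (GM (0, 0)).
have mG := measurable_cabs (Cc_cmeas CG).
have i1 : rint mu (fun xi => cabs (G xi) * cauchy2 c (pshift eta xi)).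
  by apply: (@rint_bounded_cauchy2 c _ _ M) => // x; rewrite ger0_norm ?cabs_ge0.
have i2 : rint mu (fun xi => cabs (G xi) ^+ 2 * cauchy2 c (pshift eta xi)).
  apply: (@rint_bounded_cauchy2 c _ _ (M ^+ 2)) => //.
    exact: cmeas_cabs2 (Cc_cmeas CG).
  by move=> x; rewrite ger0_norm ?sqr_ge0// lerXn2r ?nnegrE ?cabs_ge0.
set a := \int[mu]_xi (cabs (G xi) * cauchy2 c (pshift eta xi)).
have a0 : 0 <= a.
  by apply: Rintegral_ge0 => x _; rewrite mulr_ge0 ?cabs_ge0 ?cauchy2_ge0// ltW.
apply: (@le_trans _ _ (a ^+ 2)).
  by rewrite lerXn2r ?nnegrE ?cabs_ge0// cabs_smoothed.
have ip := rint_cauchy2 eta c0.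
have : 0 <= \int[mu]_xi (cabs (G xi) ^+ 2 * cauchy2 c (pshift eta xi) -
    (2 * a) * (cabs (G xi) * cauchy2 c (pshift eta xi)) + a ^+ 2 * cauchy2 c (pshift eta xi)).
  apply: Rintegral_ge0 => x _.
  have -> : cabs (G x) ^+ 2 * cauchy2 c (pshift eta x) -
    (2 * a) * (cabs (G x) * cauchy2 c (pshift eta x)) + a ^+ 2 * cauchy2 c (pshift eta x)
    = (cabs (G x) - a) ^+ 2 * cauchy2 c (pshift eta x) by ring.
  by rewrite mulr_ge0 ?sqr_ge0// cauchy2_ge0// ltW.
rewrite RintegralD//; [|by apply: rintB => //; exact: rintZ|exact: rintZ].
rewrite RintegralB//; last exact: rintZ.
rewrite !RintegralZl// -/a Rint_cauchy2//; nra.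
Qed.

(** Convolution with a probability density contracts L^2: Tonelli moves the integral over eta onto
    the kernel, which is symmetric in eta and xi and has mass 1. *)
Lemma smoothed_energy c : 0 < c ->
  (\int[mu]_eta (cabs (smoothed c eta) ^+ 2)%:E <= E%:E)%E.
Proof.
move=> c0; have [_ _ [M GM] _] := CG.
have mG2 := cmeas_cabs2 (Cc_cmeas CG).
pose f (z : plane R * plane R) : \bar R :=
  (cabs (G z.2) ^+ 2 * cauchy2 c (pshift z.1 z.2))%:E.
have f0 z : (0 <= f z)%E by rewrite lee_fin mulr_ge0 ?sqr_ge0// cauchy2_ge0// ltW.
have mf : measurable_fun setT f.
  apply/measurable_EFinP; apply: measurable_funM.
    exact: measurableT_comp mG2 measurable_snd.
  exact: measurable_cauchy2_shift.
apply: (@le_trans _ _ (\int[mu]_eta \int[mu]_xi f (eta, xi))%E).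
  apply: ge0_le_integral => //.
  - by move=> x _; rewrite lee_fin sqr_ge0.
  - by apply/measurable_EFinP; apply: cmeas_cabs2; exact: cmeas_smoothed.
  - exact: plane_measurable_integral.
  - move=> eta _.
    have <- : (\int[mu]_xi (cabs (G xi) ^+ 2 * cauchy2 c (pshift eta xi)))%:E =
      (\int[mu]_xi f (eta, xi))%E.
      rewrite /Rintegral fineK//; apply: integrable_fin_num => //.
      apply: (@rint_bounded_cauchy2 c _ _ (M ^+ 2)) => //.
      move=> x; rewrite ger0_norm ?sqr_ge0// lerXn2r ?nnegrE ?cabs_ge0//.
      exact: le_trans (cabs_ge0 _) (GM x).
    by rewrite lee_fin cabs_smoothed_sqr.
rewrite plane_tonelli//.
have -> : E%:E = (\int[mu]_x (cabs (G x) ^+ 2)%:E)%E.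
  by rewrite /E /Rintegral fineK//; apply: integrable_fin_num => //; exact: Cc_rint2.
rewrite le_eqVlt; apply/orP; left; apply/eqP; apply: eq_integral => xi _.
rewrite /f/=.
under eq_integral do rewrite cauchy2_shiftC EFinM.
rewrite ge0_integralZl ?lee_fin ?sqr_ge0//=; last 2 first.
- by apply/measurable_EFinP; exact: measurable_cauchy2_shift2.
- by move=> x _; rewrite lee_fin cauchy2_ge0// ltW.
have -> : (\int[mu]_x (cauchy2 c (pshift xi x))%:E = 1)%E.
  rewrite -[1%E]/(1%R%:E) -(Rint_cauchy2 xi c0) /Rintegral fineK//.
  by apply: integrable_fin_num => //; exact: rint_cauchy2.
by rewrite mule1.
Qed.

End inversion.

(** * The Plancherel inequality, and the L^2 Fourier transform of [ift G] *)

Section plancherel.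
Context {R : realType}.
Notation mu := (@leb2 R).
Implicit Types (c : R) (x y eta xi : plane R) (f : plane R -> R[i]).

Lemma Rint_dominated (h_ : nat -> plane R -> R) (h g : plane R -> R) :
  (forall n, measurable_fun setT (h_ n)) ->
  (forall x, h_ n x @[n --> \oo] --> h x) ->
  rint mu g -> (forall n x, `|h_ n x| <= g x) ->
  \int[mu]_x h_ n x @[n --> \oo] --> \int[mu]_x h x.
Proof.
move=> mh hh ig hg.
have mE n : measurable_fun setT (EFin \o h_ n) by exact/measurable_EFinP.
have cE x : setT x -> (EFin \o h_ n) x @[n --> \oo] --> (EFin \o h) x.
  by move=> _; apply: cvg_EFin; [exact: nearW|exact: hh].
have bE n x : setT x -> (`|(EFin \o h_ n) x| <= (EFin \o g) x)%E.
  by move=> _; rewrite lee_fin.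
have fg x : setT x -> (EFin \o g) x \is a fin_num by [].
have ih : rint mu h.
  have mh' : measurable_fun setT h.
    apply/measurable_EFinP; exact: emeasurable_fun_cvg mE cE.
  apply: (rint_le mh' ig) => x.
  have cx : cvg (h_ n x @[n --> \oo]) by apply/cvg_ex; exists (h x); exact: hh.
  have <- : lim (h_ n x @[n --> \oo]) = h x by apply: cvg_lim => //; exact: hh.
  rewrite ler_norml; apply/andP; split; [apply: limr_ge => //|apply: limr_le => //];
    by apply: nearW => n; have := hg n x; rewrite ler_norml => /andP[].
apply: fine_cvg; rewrite fineK; last exact: integrable_fin_num.
exact: dominated_cvg mE cE fg ig bE.
Qed.

Lemma cvg_cnorm2 (f_ : nat -> plane R -> R[i]) (b : nat -> R) :
  (forall n, rint mu (fun x => cabs (f_ n x) ^+ 2)) ->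
  (forall n, \int[mu]_x cabs (f_ n x) ^+ 2 <= b n) ->
  b n @[n --> \oo] --> 0 ->
  cnorm 2%:E (f_ n) @[n --> \oo] --> 0%E.
Proof.
move=> fi fb b0.
have a0 : \int[mu]_x cabs (f_ n x) ^+ 2 @[n --> \oo] --> 0.
  apply: (@squeeze_cvgr _ _ _ _ (fun=> 0) b) => //; last exact: cvg_cst.
  by apply: nearW => n; rewrite fb andbT; apply: Rintegral_ge0 => x _; rewrite sqr_ge0.
have sqrt0 : {for (0 : R), continuous (@Num.sqrt R)} by exact: sqrt_continuous.
have := continuous_cvg _ sqrt0 a0; rewrite sqrtr0 => s0.
under eq_fun do rewrite cnorm2E//.
by apply: cvg_EFin; [exact: nearW|exact: s0].
Qed.

Variable G : plane R -> R[i].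
Hypothesis CG : Cc G.

Let iG : cint mu G := Cc_cint CG.
Let E := \int[mu]_x cabs (G x) ^+ 2.

Lemma rint_smoothed2 c : 0 < c -> rint mu (fun x => cabs (smoothed G c x) ^+ 2) /\
  \int[mu]_x cabs (smoothed G c x) ^+ 2 <= E.
Proof.
move=> c0; have le := smoothed_energy CG c0.
have i2 : rint mu (fun x => cabs (smoothed G c x) ^+ 2).
  apply/integrableP; split.
    by apply/measurable_EFinP; apply: cmeas_cabs2; exact: cmeas_smoothed.
  apply: le_lt_trans (ltry E); apply: le_trans le.
  rewrite le_eqVlt; apply/orP; left; apply/eqP; apply: eq_integral => x _ /=.
  by rewrite ger0_norm ?sqr_ge0.
split => //; rewrite -lee_fin; apply: le_trans le.
by rewrite /Rintegral fineK//; exact: integrable_fin_num.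
Qed.

Lemma cint_pairing c : 0 < c -> cint mu (fun x => conjc (G x) * smoothed G c x).
Proof.
move=> c0; have [i2 _] := rint_smoothed2 c0.
apply: (cint_dom _ (rintD (Cc_rint2 CG) i2)) => [|x].
  by apply: cmeasM; [apply: cmeasJ; exact: Cc_cmeas|exact: cmeas_smoothed].
rewrite cabsM cabsJ.
have := cabs_ge0 (G x); have := cabs_ge0 (smoothed G c x); nra.
Qed.

Lemma pairing_le c : 0 < c ->
  complex.Re (Cint mu (fun x => conjc (G x) * smoothed G c x)) <= E.
Proof.
move=> c0; have [i2 le2] := rint_smoothed2 c0; have ip := cint_pairing c0.
have i1 := Cc_rint2 CG.
have : \int[mu]_x complex.Re (conjc (G x) * smoothed G c x) <=
    \int[mu]_x (2^-1 * (cabs (G x) ^+ 2 + cabs (smoothed G c x) ^+ 2)).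
  apply: le_Rintegral => //; first exact: ip.1.
    by apply: rintZ; exact: rintD.
  move=> x _; apply: le_trans (ler_norm _) _; apply: le_trans (cabs_Re _) _.
  rewrite cabsM cabsJ.
  have := sqr_ge0 (cabs (G x) - cabs (smoothed G c x)); nra.
rewrite RintegralZl//; last exact: rintD.
rewrite RintegralD// -/E /=; lra.
Qed.

Lemma cvg_laplace2 x : laplace2 (harmonic n) x @[n --> \oo] --> (1 : R).
Proof.
have h (a : R) : laplace (harmonic n) a @[n --> \oo] --> (1 : R).
  have h0 : - (2 * pi * harmonic n * `|a|) @[n --> \oo] --> (0 : R).
    rewrite -oppr0; apply: cvgN.
    rewrite -(mul0r `|a|); apply: cvgMl.
    by rewrite -(mulr0 (2 * pi)); apply: cvgMr; exact: cvg_harmonic.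
  have exp0 : {for (0 : R), continuous (@expR R)} by exact: continuous_expR.
  by have := continuous_cvg _ exp0 h0; rewrite expR0; exact.
by rewrite -(mulr1 1); apply: cvgM.
Qed.

(** Fatou along c = [harmonic n] passes from the damped energies, all at most E, to the full one. An
    inequality suffices, because the norms of f and g enter the final estimate on its larger
    side. *)
Lemma rint_ift2 : rint mu (fun x => cabs (ift G x) ^+ 2) /\
  \int[mu]_x cabs (ift G x) ^+ 2 <= E.
Proof.
have m2 := cmeas_cabs2 (ift_cmeas CG).
pose h_ n x := (laplace2 (harmonic n) x * cabs (ift G x) ^+ 2)%:E.
have mh n : measurable_fun setT (h_ n).
  by apply/measurable_EFinP; apply: measurable_funM => //; exact: measurable_laplace2.
have h0 n x : setT x -> (0 <= h_ n x)%E.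
  by rewrite lee_fin mulr_ge0 ?sqr_ge0// laplace2_ge0.
have hE n : (\int[mu]_x h_ n x <= E%:E)%E.
  have c0 : 0 < harmonic n :> R by exact: harmonic_gt0.
  have iw : rint mu (fun x => laplace2 (harmonic n) x * cabs (ift G x) ^+ 2).
    apply: (rint_le _ (rintZ ((\int[mu]_y cabs (G y)) ^+ 2) (rint_laplace2 c0))).
      by apply: measurable_funM => //; exact: measurable_laplace2.
    move=> x; rewrite ger0_norm; last first.
      by apply: mulr_ge0; [exact: laplace2_ge0|exact: sqr_ge0].
    rewrite mulrC ler_wpM2r ?laplace2_ge0// lerXn2r ?nnegrE ?cabs_ge0 ?cabs_ift//.
    by apply: Rintegral_ge0 => y _; exact: cabs_ge0.
  have := pairing_le c0; rewrite -damped_energy// -lee_fin; apply: le_trans.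
  by rewrite /Rintegral fineK//; exact: integrable_fin_num.
have hl x : limn_einf (h_ ^~ x) = (cabs (ift G x) ^+ 2)%:E.
  apply: (cvg_limn_einf_sup _).1; apply: cvg_EFin; first exact: nearW.
  rewrite -[X in _ --> X]mul1r; apply: cvgMl; exact: cvg_laplace2.
have le : (\int[mu]_x (cabs (ift G x) ^+ 2)%:E <= E%:E)%E.
  have := fatou mu measurableT mh h0.
  under eq_integral do rewrite hl.
  move=> /le_trans; apply.
  rewrite limn_einf_lim; apply: lime_le; first exact: is_cvg_einfs.
  apply: nearW => n; apply: le_trans (hE n).
  by apply: ereal_inf_lbound; exists n => /=.
have i2 : rint mu (fun x => cabs (ift G x) ^+ 2).
  apply/integrableP; split; first exact/measurable_EFinP.
  apply: le_lt_trans (ltry E); apply: le_trans le.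
  rewrite le_eqVlt; apply/orP; left; apply/eqP; apply: eq_integral => x _ /=.
  by rewrite ger0_norm ?sqr_ge0.
split => //; rewrite -lee_fin; apply: le_trans le.
by rewrite /Rintegral fineK//; exact: integrable_fin_num.
Qed.

(** A modulus of continuity shaped for [Rint_cauchy2_sqfrac]: near eta continuity gives e; once a
    coordinate is off by d or more, its [sqfrac] is at least k, and K = 2 M / k pays for the trivial
    bound 2 M. *)
Lemma Cc_modulus eta (e : R) : 0 < e -> exists2 K, 0 <= K & forall xi,
  cabs (G xi - G eta) <= e + K * (sqfrac (xi.1 - eta.1) + sqfrac (xi.2 - eta.2)).
Proof.
move=> e0; have [c1 c2 [M GM] _] := CG.
have M0 : 0 <= M := le_trans (cabs_ge0 _) (GM (0, 0)).
have /nbhs_ballP[d /= d0 Hd] : \forall x \near (eta : R * R),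
    `|complex.Re (G eta) - complex.Re (G x)| < e / 2 /\
    `|complex.Im (G eta) - complex.Im (G x)| < e / 2.
  have e2 : 0 < e / 2 by rewrite divr_gt0.
  have /cvgrPdist_lt/(_ _ e2) h1 := c1 eta.
  have /cvgrPdist_lt/(_ _ e2) h2 := c2 eta.
  by near do split.
pose k := d ^+ 2 / (1 + d ^+ 2).
have D1 (a : R) : 0 < 1 + a ^+ 2 by rewrite ltr_pwDl// sqr_ge0.
have k0 : 0 < k by rewrite divr_gt0// exprn_gt0.
have C0 : 0 <= 2 * M / k by apply: divr_ge0; [exact: mulr_ge0|exact: ltW].
exists (2 * M / k) => //.
have big (a : R) : d <= `|a| -> 1 <= sqfrac a / k.
  move=> da; rewrite ler_pdivlMr// mul1r /k /sqfrac.
  have a2 : d ^+ 2 <= a ^+ 2.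
    by rewrite -(real_normK (num_real a)) lerXn2r ?nnegrE// ltW.
  rewrite ler_pdivrMr// mulrAC ler_pdivlMr//.
  lra.
have all2M xi : cabs (G xi - G eta) <= 2 * M.
  apply: le_trans (cabsD _ _) _; rewrite cabsN.
  have := GM xi; have := GM eta; lra.
move=> xi; have s1 := sqfrac_ge0 (xi.1 - eta.1); have s2 := sqfrac_ge0 (xi.2 - eta.2).
have [x1|x1] := ltP `|xi.1 - eta.1| d; last first.
  apply: le_trans (all2M xi) _; rewrite ler_wpDl ?(ltW e0)//.
  rewrite mulrDr ler_wpDr ?(mulr_ge0 C0)// -[leRHS]mulrA [k^-1 * _]mulrC.
  by apply: ler_peMr; [exact: mulr_ge0|exact: big].
have [x2|x2] := ltP `|xi.2 - eta.2| d; last first.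
  apply: le_trans (all2M xi) _; rewrite ler_wpDl ?(ltW e0)//.
  rewrite mulrDr ler_wpDl ?(mulr_ge0 C0)// -[leRHS]mulrA [k^-1 * _]mulrC.
  by apply: ler_peMr; [exact: mulr_ge0|exact: big].
have [h1 h2] : `|complex.Re (G eta) - complex.Re (G xi)| < e / 2 /\
    `|complex.Im (G eta) - complex.Im (G xi)| < e / 2.
  by apply: Hd; split; rewrite /ball/= distrC.
apply: (@le_trans _ _ e); last first.
  by rewrite lerDl (mulr_ge0 C0)// addr_ge0.
apply: le_trans (cabs_le _) _; rewrite cReD cImD cReN cImN distrC [X in _ + X]distrC; lra.
Unshelve. all: by end_near. Qed.

Lemma smoothed_close c eta (e K : R) : 0 < c -> 0 <= K ->
  (forall xi, cabs (G xi - G eta) <=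
    e + K * (sqfrac (xi.1 - eta.1) + sqfrac (xi.2 - eta.2))) ->
  cabs (smoothed G c eta - G eta) <= e + 2 * K * c.
Proof.
move=> c0 K0 GK; have [_ _ [M GM] _] := CG.
have iP := rint_cauchy2 eta c0; have iS := rint_cauchy2_sqfrac eta c0.
have P0 xi : 0 <= cauchy2 c (pshift eta xi) by rewrite cauchy2_ge0// ltW.
have i1 : cint mu (fun xi => G xi * (cauchy2 c (pshift eta xi))%:C%C).
  have mi1 : cmeas (fun xi => G xi * (cauchy2 c (pshift eta xi))%:C%C).
    exact: (cmeasM (Cc_cmeas CG) (cmeasR (measurable_cauchy2_shift2 eta c0))).
  apply: (cint_dom mi1 (rintZ M iP)) => x.
  by rewrite cabsM cabsR (ger0_norm (P0 x)); have := ler_wpM2r (P0 x) (GM x).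
have i2 := cintZ (- G eta) (cintR iP).
have E1 : smoothed G c eta - G eta =
    Cint mu (fun xi => G xi * (cauchy2 c (pshift eta xi))%:C%C +
      (- G eta) * (cauchy2 c (pshift eta xi))%:C%C).
  by rewrite CintD// CintZ ?CintR ?Rint_cauchy2 ?mulr1//; exact: cintR.
rewrite E1; apply: le_trans (cabs_Cint (cintD i1 i2)) _.
have i3 : rint mu (fun xi => e * cauchy2 c (pshift eta xi) + K *
    (cauchy2 c (pshift eta xi) * (sqfrac (xi.1 - eta.1) + sqfrac (xi.2 - eta.2)))).
  by apply: rintD; exact: rintZ.
apply: (@le_trans _ _ (\int[mu]_xi (e * cauchy2 c (pshift eta xi) + K *
    (cauchy2 c (pshift eta xi) * (sqfrac (xi.1 - eta.1) + sqfrac (xi.2 - eta.2)))))).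
  apply: le_Rintegral => //; first exact: cint_cabs (cintD i1 i2).
  move=> xi _; rewrite -mulrDl cabsM cabsR ger0_norm; last exact: P0.
  apply: le_trans (ler_wpM2r (P0 xi) (GK xi)) _.
  by rewrite le_eqVlt; apply/orP; left; apply/eqP; ring.
rewrite RintegralD//; [|exact: rintZ|exact: rintZ].
rewrite !RintegralZl// Rint_cauchy2// mulr1 lerD2l [2 * K]mulrC -mulrA.
by rewrite ler_wpM2l// Rint_cauchy2_sqfrac.
Qed.

Lemma cvg_smoothed eta (e : R) : 0 < e ->
  \forall n \near \oo, cabs (smoothed G (harmonic n) eta - G eta) <= e.
Proof.
move=> e0; have e2 : 0 < e / 2 by rewrite divr_gt0.
have [K K0 GK] := Cc_modulus eta e2.
have K1 : 0 < 4 * (K + 1) by rewrite mulr_gt0// ltr_wpDl.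
have hn : \forall n \near \oo, `|0 - harmonic n| < e / (4 * (K + 1)) :> R.
  by apply: cvgr_dist_lt; [exact: cvg_harmonic|rewrite divr_gt0].
near=> n.
have c0 : 0 < harmonic n :> R by exact: harmonic_gt0.
apply: le_trans (smoothed_close c0 K0 GK) _.
have : `|0 - harmonic n| < e / (4 * (K + 1)) :> R by near: n.
rewrite sub0r normrN gtr0_norm// ltr_pdivlMr//; nra.
Unshelve. all: by end_near. Qed.

Lemma cabs_smoothed_le c eta (M : R) : 0 < c -> (forall x, cabs (G x) <= M) ->
  cabs (smoothed G c eta) <= M.
Proof.
move=> c0 GM; apply: le_trans (cabs_smoothed CG eta c0) _.
have iP := rint_cauchy2 eta c0.
have P0 xi : 0 <= cauchy2 c (pshift eta xi) by rewrite cauchy2_ge0// ltW.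
rewrite -[leRHS]mulr1 -(Rint_cauchy2 eta c0) -RintegralZl//.
apply: le_Rintegral => //; last by move=> x _; exact: ler_wpM2r.
  apply: (@rint_bounded_cauchy2 _ c _ _ M) => //.
    exact: measurable_cabs (Cc_cmeas CG).
  by move=> x; rewrite ger0_norm ?cabs_ge0.
exact: rintZ.
Qed.

(** Dominated convergence: [smoothed] is bounded by M and tends to G at each point, and the factor
    [conjc (G x)] supplies the integrable majorant M |G|. *)
Lemma cvg_pairing :
  complex.Re (Cint mu (fun x => conjc (G x) * smoothed G (harmonic n) x))
    @[n --> \oo] --> E.
Proof.
have [_ _ [M GM] _] := CG.
apply: (@Rint_dominated (fun n x => complex.Re (conjc (G x) * smoothed G (harmonic n) x))
  (fun x => cabs (G x) ^+ 2) (fun x => M * cabs (G x))).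
- move=> n; have [] // : cmeas (fun x => conjc (G x) * smoothed G (harmonic n) x).
  apply: cmeasM; first by apply: cmeasJ; exact: Cc_cmeas.
  by apply: cmeas_smoothed => //; exact: harmonic_gt0.
- move=> x; apply/cvgrPdist_le => e e0.
  have [G0|G0] := eqVneq (G x) 0.
    by near=> n; rewrite G0 conjc0 mul0r cabs0 expr0n/= subr0 normr0 ltW.
  have g0 : 0 < cabs (G x) + 1 by rewrite ltr_wpDl// cabs_ge0.
  have := cvg_smoothed x (divr_gt0 e0 g0); apply: filterS => n h.
  have -> : cabs (G x) ^+ 2 - complex.Re (conjc (G x) * smoothed G (harmonic n) x) =
     - complex.Re (conjc (G x) * (smoothed G (harmonic n) x - G x)).
    by rewrite mulrBr [conjc (G x) * G x]mulrC mulcJ cReD cReN/=; ring.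
  rewrite normrN; apply: le_trans (cabs_Re _) _; rewrite cabsM cabsJ.
  apply: le_trans (ler_wpM2l (cabs_ge0 _) h) _.
  rewrite mulrA ler_pdivrMr// mulrC ler_wpM2l ?(ltW e0)// lerDl//.
- by apply: rintZ; apply: cint_cabs.
- move=> n x; apply: le_trans (cabs_Re _) _; rewrite cabsM cabsJ mulrC.
  apply: ler_wpM2r; first exact: cabs_ge0.
  by apply: cabs_smoothed_le => //; exact: harmonic_gt0.
Unshelve. all: by end_near. Qed.

(** Weak convergence with norms not exceeding that of the limit is strong: expand the square and
    bound the energy of [smoothed] by E; what remains is twice the defect of the pairing. *)
Lemma smoothed_dist c : 0 < c ->
  rint mu (fun x => cabs (smoothed G c x - G x) ^+ 2) /\
  \int[mu]_x cabs (smoothed G c x - G x) ^+ 2 <=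
    2 * (E - complex.Re (Cint mu (fun x => conjc (G x) * smoothed G c x))).
Proof.
move=> c0; have [i2 le2] := rint_smoothed2 c0; have ip := cint_pairing c0.
have i1 := Cc_rint2 CG.
have D x : cabs (smoothed G c x - G x) ^+ 2 = cabs (smoothed G c x) ^+ 2 +
   cabs (G x) ^+ 2 - 2 * complex.Re (conjc (G x) * smoothed G c x).
  rewrite !cabs_sqr cReM cReJ cImJ cReD cImD cReN cImN; ring.
have i12 := rintD i2 i1; have i3 := rintZ 2 ip.1.
split; first by under eq_fun do rewrite D; exact: rintB.
under eq_Rintegral do rewrite D.
rewrite RintegralB// RintegralD// RintegralZl//; last exact: ip.1.
rewrite -/E /=; lra.
Qed.

Lemma damped_dist n : rint mu (fun x => cabs (damped_ift G (harmonic n) x - ift G x) ^+ 2).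
Proof.
apply: (rint_le _ rint_ift2.1).
  apply: cmeas_cabs2; apply: cmeasB; last exact: ift_cmeas.
  exact: cmeas_damped_ift.
move=> x; rewrite ger0_norm ?sqr_ge0// /damped_ift.
have -> : (laplace2 (harmonic n) x)%:C%C * ift G x - ift G x =
  (laplace2 (harmonic n) x - 1)%:C%C * ift G x.
  by rewrite rmorphB/= mulrBl mul1r.
rewrite cabsM exprMn ler_piMl ?sqr_ge0// cabsR real_normK ?num_real//.
have c0 : 0 <= harmonic n :> R by exact: harmonic_ge0.
have := laplace2_le1 x c0; have := laplace2_ge0 (harmonic n) x; nra.
Qed.

Lemma cvg_damped_dist :
  \int[mu]_x cabs (damped_ift G (harmonic n) x - ift G x) ^+ 2 @[n --> \oo] --> 0.
Proof.
have -> : 0 = \int[mu]_x (fun=> 0) x by rewrite /Rintegral integral0.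
apply: (Rint_dominated _ _ rint_ift2.1).
- move=> n; apply: cmeas_cabs2; apply: cmeasB; last exact: ift_cmeas.
  exact: cmeas_damped_ift.
- move=> x.
  have -> : (fun n => cabs (damped_ift G (harmonic n) x - ift G x) ^+ 2) =
      (fun n => (laplace2 (harmonic n) x - 1) ^+ 2 * cabs (ift G x) ^+ 2).
    apply/funext => n; rewrite /damped_ift.
    have -> : (laplace2 (harmonic n) x)%:C%C * ift G x - ift G x =
      (laplace2 (harmonic n) x - 1)%:C%C * ift G x.
      by rewrite rmorphB/= mulrBl mul1r.
    by rewrite cabsM exprMn cabsR real_normK ?num_real.
  rewrite -(mul0r (cabs (ift G x) ^+ 2)); apply: cvgMl.
  have h : laplace2 (harmonic n) x - 1 @[n --> \oo] --> (0 : R).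
    by rewrite -(subrr 1); apply: cvgB; [exact: cvg_laplace2|exact: cvg_cst].
  by rewrite -(mulr0 0); apply: cvgM.
- move=> n x; rewrite ger0_norm ?sqr_ge0// /damped_ift.
  have -> : (laplace2 (harmonic n) x)%:C%C * ift G x - ift G x =
    (laplace2 (harmonic n) x - 1)%:C%C * ift G x.
    by rewrite rmorphB/= mulrBl mul1r.
  rewrite cabsM exprMn ler_piMl ?sqr_ge0// cabsR real_normK ?num_real//.
  have c0 : 0 <= harmonic n :> R by exact: harmonic_ge0.
  have := laplace2_le1 x c0; have := laplace2_ge0 (harmonic n) x; nra.
Qed.

Lemma in_L2 f : cmeas f -> rint mu (fun x => cabs (f x) ^+ 2) -> in_Lp 2%:E f.
Proof. by move=> mf i2; split => //; rewrite cnorm2E// ltry. Qed.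

Lemma in_L2_ift : in_Lp 2%:E (ift G).
Proof. by apply: in_L2 rint_ift2.1; exact: ift_cmeas. Qed.

Lemma cnorm_ift : (cnorm 2%:E (ift G) <= (Num.sqrt E)%:E)%E.
Proof.
have [i2 le] := rint_ift2.
rewrite cnorm2E// lee_fin ler_sqrt//; apply: le_trans le.
by apply: Rintegral_ge0 => x _; exact: sqr_ge0.
Qed.

(** The damped functions lie in both L^1 and L^2, so they can serve as the approximants demanded by
    [fourier]; their transforms are the functions [smoothed]. *)
Lemma fourier_ift : fourier (ift G) G.
Proof.
split; [exact: in_L2_ift|by apply: in_L2; [exact: Cc_cmeas|exact: Cc_rint2]|].
exists (fun n => damped_ift G (harmonic n)); split.
- move=> n; have c0 : 0 < harmonic n :> R by exact: harmonic_gt0.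
  have mD : cmeas (damped_ift G (harmonic n)) by exact: cmeas_damped_ift.
  split; first by split => //; apply: cnorm1E; exact: cint_damped_ift.
  apply: in_L2 => //; apply: (rint_le _ rint_ift2.1); first exact: cmeas_cabs2.
  move=> x; rewrite ger0_norm ?sqr_ge0// lerXn2r ?nnegrE ?cabs_ge0//.
  rewrite cabsM cabsR ger0_norm ?laplace2_ge0// ler_piMl ?cabs_ge0//.
  by apply: laplace2_le1; exact: ltW.
- by apply: cvg_cnorm2 cvg_damped_dist => // n; exact: damped_dist.
- have -> : (fun n => cnorm 2%:E (fun xi => fourierL1 (damped_ift G (harmonic n)) xi - G xi)) =
     (fun n => cnorm 2%:E (fun xi => smoothed G (harmonic n) xi - G xi)).
    apply/funext => n; congr cnorm; apply/funext => xi.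
    by rewrite fourierL1_damped_ift//; exact: harmonic_gt0.
  apply: (@cvg_cnorm2 _ (fun n => 2 * (E - complex.Re (Cint mu
     (fun x => conjc (G x) * smoothed G (harmonic n) x))))).
  + by move=> n; apply: (smoothed_dist _).1; exact: harmonic_gt0.
  + by move=> n; apply: (smoothed_dist _).2; exact: harmonic_gt0.
  + rewrite -(mulr0 2); apply: cvgMr; rewrite -(subrr E).
    by apply: cvgB; [exact: cvg_cst|exact: cvg_pairing].
Qed.

End plancherel.

(** * Riesz products *)

Section dirichlet_kernel.
Context {R : realType}.
Implicit Types (x : R) (L : nat).

Definition dirichlet L x : R[i] := \sum_(a < L) expi (a%:R * x).

(** Divided by L^2 and not by L, so that for L > 0 its maximum, at 0, equals 1 and it can damp a
    cosine inside a Riesz factor. *)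
Definition fejer L x : R := cabs (dirichlet L x) ^+ 2 / L%:R ^+ 2.

Lemma fejer_ge0 L x : 0 <= fejer L x.
Proof. by rewrite divr_ge0 ?sqr_ge0. Qed.

Lemma fejer_le1 L x : fejer L x <= 1.
Proof.
have [->|L0] := posnP L.
  by rewrite /fejer expr0n/= invr0 mulr0.
rewrite ler_pdivrMr ?exprn_gt0 ?ltr0n// mul1r lerXn2r ?nnegrE ?cabs_ge0//.
apply: le_trans (cabs_sum _ _ _) _.
under eq_bigr do rewrite cabs_expi.
by rewrite sumr_const card_ord.
Qed.

Lemma Re_sum I (s : seq I) (F : I -> R[i]) :
  complex.Re (\sum_(i <- s) F i) = \sum_(i <- s) complex.Re (F i).
Proof. by elim: s => [|i s ih]; rewrite ?big_nil// !big_cons cReD ih. Qed.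

(** Over all pairs the modulations factor into [conjc (dirichlet L x) * dirichlet L x], which is
    real and nonnegative: averaging shrinks the cosine without moving its phase. *)
Lemma sum_cos_fejer L x (th : R) : (0 < L)%N ->
  \sum_(p : 'I_L * 'I_L) cos (th - (p.1%:R - p.2%:R) * x) =
  L%:R ^+ 2 * (cos th * fejer L x).
Proof.
move=> L0; have Ln0 : (L%:R : R) != 0 by rewrite pnatr_eq0 -lt0n.
have E : \sum_(p : 'I_L * 'I_L) expi (th - (p.1%:R - p.2%:R) * x) =
    expi th * (conjc (dirichlet L x) * dirichlet L x).
  have -> : conjc (dirichlet L x) = \sum_(a < L) expi (- (a%:R * x)).
    rewrite /dirichlet rmorph_sum; apply: eq_bigr => a _; exact/esym/expiN.
  rewrite /dirichlet big_distrl/= mulr_sumr.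
  under [RHS]eq_bigr do rewrite big_distrr/= mulr_sumr.
  rewrite pair_bigA/=; apply: eq_bigr => -[a b] _ /=.
  by rewrite -!expiD; congr expi; ring.
have -> : \sum_(p : 'I_L * 'I_L) cos (th - (p.1%:R - p.2%:R) * x) =
   complex.Re (\sum_(p : 'I_L * 'I_L) expi (th - (p.1%:R - p.2%:R) * x)).
  by rewrite Re_sum.
rewrite E [conjc _ * _]mulrC mulcJ [expi th * _]mulrC cRe_mulC/= /fejer.
by rewrite [cos th * _]mulrC mulrA [_ ^+ 2 * (_ / _)]mulrC divfK// expf_neq0.
Qed.

(** Each of the L cosines is at least 1 - (L x)^2 / 2, and (1 - u/2)^2 >= 1 - u. Squaring needs a
    nonnegative lower bound, hence the case distinction. *)
Lemma fejer_ge L x : (0 < L)%N -> 1 - (L%:R * x) ^+ 2 <= fejer L x.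
Proof.
move=> L0; have L1 : 0 < (L%:R : R) by rewrite ltr0n.
have [h|h] := leP (1 - (L%:R * x) ^+ 2 / 2) 0.
  by apply: le_trans (fejer_ge0 L x); have := sqr_ge0 (L%:R * x); lra.
rewrite /fejer ler_pdivlMr ?exprn_gt0//.
apply: (@le_trans _ _ ((L%:R * (1 - (L%:R * x) ^+ 2 / 2)) ^+ 2)).
  rewrite [leRHS]exprMn [leRHS]mulrC ler_wpM2r ?sqr_ge0//.
  have := sqr_ge0 ((L%:R * x) ^+ 2); nra.
rewrite lerXn2r ?nnegrE ?cabs_ge0 ?mulr_ge0 ?(ltW h) ?(ltW L1)//.
apply: le_trans (cabs_Re _); apply: le_trans (ler_norm _).
rewrite /dirichlet Re_sum/=.
have -> : L%:R * (1 - (L%:R * x) ^+ 2 / 2) = \sum_(a < L) (1 - (L%:R * x) ^+ 2 / 2).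
  by rewrite sumr_const card_ord mulr_natl.
apply: ler_sum => a _; apply: le_trans (cos_ge_quad _).
rewrite lerD2l lerN2 ler_wpM2r ?invr_ge0// !exprMn ler_wpM2r ?sqr_ge0//.
by rewrite lerXn2r ?nnegrE// ler_nat ltnW.
Qed.

Lemma sin_ge_half x : 0 <= x <= 1 -> x / 2 <= sin x.
Proof.
move=> /andP[]; rewrite le_eqVlt => /predU1P[<- _|x0 x1]; first by rewrite mul0r sin0.
have csin : {within `[0, x], continuous sin}.
  by apply: continuous_subspaceT => a; exact: continuous_sin.
have [c] := MVT x0 (fun a _ => is_derive_sin a) csin.
rewrite in_itv/= => /andP[c0 cx]; rewrite sin0 !subr0 => ->.
have := cos_ge_quad c; have : c ^+ 2 <= 1 by rewrite expr_le1// ltW// (lt_le_trans cx).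
rewrite [x / 2]mulrC => c1 c2; rewrite ler_wpM2r ?(ltW x0)//; lra.
Qed.

Lemma dirichlet_telescope L x : dirichlet L x * (expi x - 1) = expi (L%:R * x) - 1.
Proof.
rewrite /dirichlet; elim: L => [|L ih]; first by rewrite big_ord0 mul0r mul0r expi0 subrr.
rewrite big_ord_recr/= mulrDl ih mulrBr mulr1 -expiD.
have -> : L%:R * x + x = L.+1%:R * x by rewrite -natr1; ring.
ring.
Qed.

(** The geometric sum gives |dirichlet| |expi x - 1| <= 2, and |expi x - 1| >= sin x >= x / 2 on
    this range; so |dirichlet| x <= 4, and 16 = 4^2. *)
Lemma fejer_le L x : (0 < L)%N -> 0 < x <= 1 -> fejer L x <= 16 / (L%:R * x) ^+ 2.
Proof.
move=> L0 /andP[x0 x1]; have L1 : 0 < (L%:R : R) by rewrite ltr0n.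
have e1 : x / 2 <= cabs (expi x - 1).
  apply: le_trans (sin_ge_half _) _; first by rewrite (ltW x0).
  apply: le_trans (ler_norm _) _; apply: le_trans (cabs_Im _).
  by rewrite cImD cImN/= subr0.
have D4 : cabs (dirichlet L x) * x <= 4.
  have : cabs (dirichlet L x) * cabs (expi x - 1) <= 2.
    rewrite -cabsM dirichlet_telescope; apply: le_trans (cabsD _ _) _.
    by rewrite cabsN cabs_expi -(expi0 (R := R)) cabs_expi.
  have := cabs_ge0 (dirichlet L x); nra.
rewrite ler_pdivlMr ?exprn_gt0 ?mulr_gt0//.
have -> : fejer L x * (L%:R * x) ^+ 2 = (cabs (dirichlet L x) * x) ^+ 2.
  by rewrite /fejer; field; rewrite gt_eqF.
have -> : (16 : R) = 4 ^+ 2 by ring.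
by rewrite lerXn2r ?nnegrE ?mulr_ge0 ?cabs_ge0// ltW.
Qed.

End dirichlet_kernel.

Lemma ler_eq {R : realType} (a b : R) : a = b -> a <= b.
Proof. by move=> ->. Qed.

Section riesz_product.
Context {R : realType}.
Notation mu := (@leb2 R).
Variables om X : plane R -> R.
Hypotheses (mom : measurable_fun setT om) (mX : measurable_fun setT X).
Variable L : nat -> nat.
Hypothesis L0 : forall j, (0 < L j)%N.

Definition expsum (N : nat) (y : nat -> R) (xi : plane R) : R[i] :=
  \sum_(n < N) expi (n%:R * om xi - y n * X xi).

Definition riesz_factor (j : nat) (xi : plane R) : R :=
  1 + cos (2 ^+ j * om xi) * fejer (L j) (X xi).

Lemma measurable_cosc (f : plane R -> R) : measurable_fun setT f ->
  measurable_fun setT (fun x => cos (f x)).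
Proof. by move=> /cmeas_expi[]. Qed.

Lemma cmeas_expsum N y : cmeas (expsum N y).
Proof.
apply: cmeas_sum => n; apply: cmeas_expi; apply: measurable_funB; apply: measurable_funM => //.
Qed.

Lemma cabs_expsum N y xi : cabs (expsum N y xi) <= N%:R.
Proof.
apply: le_trans (cabs_sum _ _ _) _.
by under eq_bigr do rewrite cabs_expi; rewrite sumr_const card_ord.
Qed.

Lemma measurable_riesz_factor j : measurable_fun setT (riesz_factor j).
Proof.
apply: measurable_funD => //; apply: measurable_funM.
  by apply: measurable_cosc; exact: measurable_funM.
apply: measurable_funM => //; apply: cmeas_cabs2; apply: cmeas_sum => a.
by apply: cmeas_expi; exact: measurable_funM.
Qed.

Lemma riesz_factor_bounds j xi : 0 <= riesz_factor j xi <= 2.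
Proof.
rewrite /riesz_factor.
have := fejer_ge0 (L j) (X xi); have := fejer_le1 (L j) (X xi).
have := cos_geN1 (2 ^+ j * om xi); have := cos_le1 (2 ^+ j * om xi); nra.
Qed.

Lemma rint_mul_bounded (w h : plane R -> R) (M : R) : rint mu w ->
  measurable_fun setT h -> (forall x, `|h x| <= M) -> rint mu (fun x => w x * h x).
Proof.
move=> iw mh hM.
have iaw : rint mu (fun x => `|w x|) by exact: integrable_norm.
apply: (rint_le _ (rintZ M iaw)).
  by apply: measurable_funM => //; move/measurable_int: iw => /measurable_EFinP.
by move=> x; rewrite normrM mulrC ler_wpM2r.
Qed.

Lemma Rint_sum I (s : seq I) (F : I -> plane R -> R) :
  (forall i, rint mu (F i)) ->
  rint mu (fun x => \sum_(i <- s) F i x) /\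
  \int[mu]_x (\sum_(i <- s) F i x) = \sum_(i <- s) \int[mu]_x F i x.
Proof.
move=> iF; elim: s => [|i s [ih1 ih2]].
  split; first by under eq_fun do rewrite big_nil; exact: integrable0.
  by under eq_Rintegral do rewrite big_nil; rewrite big_nil /Rintegral integral0.
split; first by under eq_fun do rewrite big_cons; exact: rintD.
under eq_Rintegral do rewrite big_cons.
by rewrite big_cons -ih2; exact: (RintegralD measurableT (iF i) ih1).
Qed.

(** The upper half of the indices repeats the lower half with n moved by 2^k and y by z, so the sum
    factors; then |1 + expi a|^2 = 2 (1 + cos a). *)
Lemma expsum_double k (y : nat -> R) z xi :
  let y' n := if (n < 2 ^ k)%N then y n else y (n - 2 ^ k)%N + z in
  cabs (expsum (2 ^ k.+1) y' xi) ^+ 2 =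
  2 * (cabs (expsum (2 ^ k) y xi) ^+ 2 * (1 + cos (2 ^+ k * om xi - z * X xi))).
Proof.
move=> y'.
have -> : expsum (2 ^ k.+1) y' xi =
    expsum (2 ^ k) y xi * (1 + expi (2 ^+ k * om xi - z * X xi)).
  rewrite /expsum expnS mul2n -addnn big_split_ord/= mulrDr mulr1; congr (_ + _).
    by apply: eq_bigr => i _; rewrite /y' ltn_ord.
  rewrite mulr_suml; apply: eq_bigr => i _.
  rewrite /y' ltnNge leq_addr/= addKn -expiD natrD natrX; congr expi; ring.
have E (a : R) : cabs (1 + expi a) ^+ 2 = 2 * (1 + cos a).
  rewrite cabs_sqr cReD cImD/= add0r.
  have := cos2Dsin2 a; move: (cos a) (sin a) => c s cs.
  have -> : s ^+ 2 = 1 - c ^+ 2 by rewrite -cs; ring.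
  ring.
by rewrite cabsM exprMn E; ring.
Qed.

(* Passing from 2^k to 2^(k+1) terms multiplies |expsum|^2 by
   2 (1 + cos(2^k om - z X)); the average of this factor over z = a - b,
   a, b < L k, is 2 riesz_factor k, so some z does at least as well. *)
Lemma riesz_product_lower k (w : plane R -> R) : rint mu w -> (forall x, 0 <= w x) ->
  exists y, 2 ^+ k * \int[mu]_x (w x * \prod_(j < k) riesz_factor j x) <=
    \int[mu]_x (w x * cabs (expsum (2 ^ k) y x) ^+ 2).
Proof.
elim: k w => [|k ih] w iw w0.
  exists (fun=> 0); rewrite expr0 mul1r; apply: ler_eq.
  apply: eq_Rintegral => x _; rewrite big_ord0 /expsum big_ord1.
  by rewrite cabs_expi expr1n.
(* The averaged factor is absorbed into the weight, which is why the induction ranges over all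
   nonnegative weights. *)
have iwq : rint mu (fun x => w x * riesz_factor k x).
  apply: (@rint_mul_bounded _ _ 2) => //; first exact: measurable_riesz_factor.
  by move=> x; have /andP[? ?] := riesz_factor_bounds k x; rewrite ger0_norm.
have [|y Hy] := ih _ iwq.
  by move=> x; rewrite mulr_ge0//; have /andP[] := riesz_factor_bounds k x.
pose g (p : 'I_(L k) * 'I_(L k)) x := w x * (cabs (expsum (2 ^ k) y x) ^+ 2 *
  (1 + cos (2 ^+ k * om x - (p.1%:R - p.2%:R) * X x))).
have ig p : rint mu (g p).
  apply: (@rint_mul_bounded _ _ ((2 ^ k)%:R ^+ 2 * 2)) => //.
    apply: measurable_funM; first by apply: cmeas_cabs2; exact: cmeas_expsum.
    apply: measurable_funD => //; apply: measurable_cosc; apply: measurable_funB.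
      exact: measurable_funM.
    exact: measurable_funM.
  move=> x; have c1 := cos_geN1 (2 ^+ k * om x - (p.1%:R - p.2%:R) * X x).
  have c2 := cos_le1 (2 ^+ k * om x - (p.1%:R - p.2%:R) * X x).
  rewrite ger0_norm; last by apply: mulr_ge0; [exact: sqr_ge0|lra].
  apply: ler_pM; [exact: sqr_ge0|lra| |lra].
  by rewrite lerXn2r ?nnegrE ?cabs_ge0// cabs_expsum.
have [isum Esum] := Rint_sum (index_enum _) ig.
pose I0 := \int[mu]_x (w x * riesz_factor k x * cabs (expsum (2 ^ k) y x) ^+ 2).
have [p Hp] : exists p, I0 <= \int[mu]_x g p x.
  have Lk : 0 < (L k)%:R :> R by rewrite ltr0n.
  have E : \sum_p \int[mu]_x g p x = \sum_(p : 'I_(L k) * 'I_(L k)) I0.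
    rewrite sumr_const card_prod card_ord -Esum -mulr_natl natrM -expr2 /I0.
    rewrite -RintegralZl//; last first.
      apply: (@rint_mul_bounded _ _ ((2 ^ k)%:R ^+ 2)) => //.
        by apply: cmeas_cabs2; exact: cmeas_expsum.
      by move=> x; rewrite ger0_norm ?sqr_ge0// lerXn2r ?nnegrE ?cabs_ge0// cabs_expsum.
    apply: eq_Rintegral => x _; rewrite /g -mulr_sumr -mulr_sumr big_split/=.
    rewrite sum_cos_fejer// sumr_const card_prod card_ord -mulr_natl natrM -expr2.
    rewrite /riesz_factor; ring.
  apply: contrapT => /forallNP H.
  have : \sum_p \int[mu]_x g p x < \sum_(p : 'I_(L k) * 'I_(L k)) I0.
    apply: ltr_sum; first by apply/hasP; exists (Ordinal (L0 k), Ordinal (L0 k)); rewrite ?mem_index_enum.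
    by move=> p _; rewrite ltNge; apply/negP; exact: H.
  by rewrite E ltxx.
exists (fun n => if (n < 2 ^ k)%N then y n else y (n - 2 ^ k)%N + (p.1%:R - p.2%:R)).
have -> : \int[mu]_x (w x * cabs (expsum (2 ^ k.+1) (fun n => if (n < 2 ^ k)%N then y n
    else y (n - 2 ^ k)%N + (p.1%:R - p.2%:R)) x) ^+ 2) = 2 * \int[mu]_x g p x.
  transitivity (\int[mu]_x (2 * g p x)).
    apply: eq_Rintegral => x _.
    by rewrite expsum_double /g; ring.
  by apply: RintegralZl => //; exact: ig.
apply: (@le_trans _ _ (2 * I0)); last by rewrite ler_pM2l.
rewrite exprS -mulrA ler_pM2l//; apply: le_trans Hy.
rewrite ler_pM2l ?exprn_gt0//; apply: ler_eq.
by apply: eq_Rintegral => x _; rewrite big_ord_recr/=; ring.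
Qed.

End riesz_product.

(** * The averaged Riesz product at one point of scale 2^-l *)

Section dyadic_lower_bound.
Context {R : realType}.
Variables (al X W : R) (l : nat).
Hypotheses (al_gt0 : 0 < al) (al_small : al * 1024 <= 1).
Hypotheses (X_gt0 : 0 < X) (X_le1 : X <= 1).
Hypotheses (X_lower : 1 <= 4 * (4 ^+ l * X ^+ 2)) (X_upper : 4 ^+ l * X ^+ 2 <= 1).
Hypotheses (W_ge0 : 0 <= W) (W_upper : 4 ^+ l * W <= 2).

Let q (j : nat) : R := 1 + cos (2 ^+ j * (al * W)) * fejer (2 ^ j./2) X.

Let L0 j : (0 < 2 ^ j./2)%N. Proof. by rewrite expn_gt0. Qed.

Let q_ge0 j : 0 <= q j.
Proof.
rewrite /q; have := cos_geN1 (2 ^+ j * (al * W)).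
have := fejer_ge0 (2 ^ j./2) X; have := fejer_le1 (2 ^ j./2) X; nra.
Qed.

Let four (m : nat) : 0 < (4 : R) ^+ m. Proof. by rewrite exprn_gt0. Qed.

Let pow4 (m n : nat) : (m <= n)%N -> (4 : R) ^+ m <= 4 ^+ n.
Proof. by apply: ler_weXn2l; rewrite ler1n. Qed.

Let four5 : (4 : R) ^+ 5 = 1024. Proof. by ring. Qed.

Let al4 : 4 * al <= 256^-1. Proof. by move: al_small; lra. Qed.

(** The indices 2i and 2i + 1 share the Fejer length 2^i, so they are treated as a pair and all
    bounds become powers of 4. The angle is at most 2 * 4^i * al * 2 / 4^l. *)
Let theta_bound i j : (j = i.*2) \/ (j = i.*2.+1) ->
  0 <= 2 ^+ j * (al * W) <= 256^-1 * (4 ^+ i / 4 ^+ l).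
Proof.
move=> H; have W4 : W <= 2 / 4 ^+ l by rewrite ler_pdivlMr// mulrC.
have E : 2 ^+ j <= 2 * 4 ^+ i :> R.
  have e4 : 2 ^+ i.*2 = 4 ^+ i :> R.
    by rewrite -mul2n exprM; congr (_ ^+ _); ring.
  case: H => ->; rewrite ?exprS e4//; have := four i; lra.
have j0 : 0 < (2 : R) ^+ j by rewrite exprn_gt0.
have v0 : 0 < (4 ^+ l)^-1 :> R by rewrite invr_gt0.
apply/andP; split.
  apply: mulr_ge0; first exact: ltW.
  exact: mulr_ge0 (ltW al_gt0) W_ge0.
have a0 := four i; move: (4 ^+ i) a0 E => a a0 E.
move: ((4 ^+ l)^-1) v0 W4 => v v0 W4.
have W2 : al * W <= al * (2 * v) by rewrite ler_pM2l.
apply: (@le_trans _ _ ((2 * a) * (al * (2 * v)))).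
  by apply: ler_pM; [exact: ltW|exact: mulr_ge0 (ltW al_gt0) W_ge0|exact: E|exact: W2].
have av : 0 < a * v by exact: mulr_gt0.
have -> : 2 * a * (al * (2 * v)) = (4 * al) * (a * v) by ring.
by rewrite ler_pM2r.
Qed.

Let half_index i j : (j = i.*2) \/ (j = i.*2.+1) -> j./2 = i.
Proof. by case=> ->; rewrite /= ?uphalf_double ?doubleK. Qed.

Let LX i : ((2 ^ i)%:R * X) ^+ 2 = 4 ^+ i * X ^+ 2.
Proof. by rewrite exprMn natrX -exprM mulnC exprM; congr (_ ^+ _ * _); ring. Qed.

(** With u = 4^(i - l) the cosine is at least 1 - u/8 and the Fejer kernel at least 1 - u: the loss
    is linear in u, hence summable over i < l. *)
Let q_head i j : (i < l)%N -> (j = i.*2) \/ (j = i.*2.+1) ->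
  2 - 3 / 2 * (4 ^+ i / 4 ^+ l) <= q j.
Proof.
move=> il H; have /andP[t0 t1] := theta_bound H; rewrite /q (half_index H).
have F1 := fejer_ge X (L0 (i.*2)); rewrite doubleK LX in F1.
have F2 := fejer_le1 (2 ^ i) X; have F3 := fejer_ge0 (2 ^ i) X.
have C := cos_ge_quad (2 ^+ j * (al * W)).
have u0 : 0 < 4 ^+ i / 4 ^+ l :> R by rewrite divr_gt0.
have u1 : 4 ^+ i / 4 ^+ l <= 1 :> R.
  by rewrite ler_pdivrMr// mul1r pow4// ltnW.
have ux : 4 ^+ i * X ^+ 2 <= 4 ^+ i / 4 ^+ l.
  by rewrite ler_wpM2l ?(ltW (four i))// -[_^-1]mul1r ler_pdivlMr// mulrC.
move: (4 ^+ i / 4 ^+ l) u0 u1 ux t1 => u u0 u1 ux t1.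
move: (2 ^+ j * _) (cos _) C t0 t1 => th c C t0 t1.
move: (fejer _ _) F1 F2 F3 => F F1 F2 F3.
have F4 : 1 - u <= F by lra.
have c1 : 1 - u / 8 <= c.
  have th4 : th <= u / 4 by lra.
  have : th ^+ 2 <= (u / 4) ^+ 2 by rewrite lerXn2r ?nnegrE//; lra.
  nra.
nra.
Qed.

(** Up to i = l + 4 the angle is at most 4^4 / 256 = 1. This is what fixes the constant 1024 in
    [al_small]. *)
Let q_middle i j : (i < l + 5)%N -> (j = i.*2) \/ (j = i.*2.+1) -> 1 <= q j.
Proof.
move=> il H; have /andP[t0 t1] := theta_bound H; rewrite /q.
have u1 : 4 ^+ i / 4 ^+ l <= 4 ^+ 4 :> R.
  by rewrite ler_pdivrMr// -exprD pow4// addnC -ltnS -addnS.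
have C := cos_ge_quad (2 ^+ j * (al * W)).
have F3 := fejer_ge0 (2 ^ j./2) X.
move: (2 ^+ j * _) (cos _) C t0 t1 => th c C t0 t1.
have th1 : th <= 1 by apply: le_trans t1 _; lra.
have c0 : 0 <= c by nra.
by rewrite lerDl mulr_ge0.
Qed.

(** The angle is uncontrolled here, so the cosine is replaced by -1 and the Fejer kernel has to be
    small: 64 is the 16 of [fejer_le] times the 4 of [X_lower]. *)
Let q_tail i j : (j = i.*2) \/ (j = i.*2.+1) -> 1 - 64 * (4 ^+ l / 4 ^+ i) <= q j.
Proof.
move=> H; rewrite /q (half_index H).
have i0 : (0 < 2 ^ i)%N by rewrite expn_gt0.
have F1 := fejer_le i0 (introT andP (conj X_gt0 X_le1)); rewrite LX in F1.
have F3 := fejer_ge0 (2 ^ i) X.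
have C := cos_geN1 (2 ^+ j * (al * W)).
have F2 : 16 / (4 ^+ i * X ^+ 2) <= 64 * (4 ^+ l / 4 ^+ i).
  have x0 : 0 < X ^+ 2 by rewrite exprn_gt0.
  rewrite ler_pdivrMr ?mulr_gt0//.
  have -> : 64 * (4 ^+ l / 4 ^+ i) * (4 ^+ i * X ^+ 2) = 64 * (4 ^+ l * X ^+ 2).
    by field; rewrite gt_eqF.
  by move: X_lower; lra.
nra.
Qed.

Let P m := \prod_(j < m.*2) q j.

Let P_S m : P m.+1 = P m * q m.*2 * q m.*2.+1.
Proof. by rewrite /P doubleS !big_ord_recr. Qed.

Let P_ge0 m : 0 <= P m. Proof. exact: prodr_ge0. Qed.

(** The correction 1 - u/2 with u = 4^(m - l) is made to close the induction, in which u becomes 4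
    u: 4 (1 - 2 u) <= (1 - u/2) (2 - 3 u/2)^2 for 0 < u <= 1/4. *)
Let P_head m : (m <= l)%N -> 4 ^+ m * (1 - 2^-1 * (4 ^+ m / 4 ^+ l)) <= P m.
Proof.
elim: m => [_|m ih ml].
  by rewrite /P big_ord0 expr0 mul1r lerBlDr lerDl mulr_ge0// divr_ge0// ltW.
have h1 := q_head ml (or_introl erefl); have h2 := q_head ml (or_intror erefl).
have {}ih := ih (ltnW ml).
rewrite P_S exprS.
have u0 : 0 < 4 ^+ m / 4 ^+ l :> R by rewrite divr_gt0.
have u1 : 4 ^+ m / 4 ^+ l <= 4^-1 :> R.
  by rewrite ler_pdivrMr// mulrC ler_pdivlMr// mulrC -exprS pow4.
have -> : 4 * 4 ^+ m / 4 ^+ l = 4 * (4 ^+ m / 4 ^+ l) :> R by rewrite mulrA.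
have f0 := four m.
move: (4 ^+ m / 4 ^+ l) u0 u1 h1 h2 ih => u u0 u1 h1 h2 ih.
apply: (@le_trans _ _ (4 ^+ m * (1 - 2^-1 * u) * (2 - 3 / 2 * u) * (2 - 3 / 2 * u))).
  move: (4 ^+ m) f0 => a a0.
  have -> : a * (1 - 2^-1 * u) * (2 - 3 / 2 * u) * (2 - 3 / 2 * u) =
    a * ((1 - 2^-1 * u) * (2 - 3 / 2 * u) * (2 - 3 / 2 * u)) by ring.
  have -> : 4 * a * (1 - 2^-1 * (4 * u)) = a * (4 * (1 - 2^-1 * (4 * u))) by ring.
  rewrite ler_pM2l//; nra.
have v0 : 0 <= 2 - 3 / 2 * u by lra.
apply: ler_pM => //.
  by rewrite !mulr_ge0 ?(ltW f0)//; lra.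
by apply: ler_pM => //; rewrite mulr_ge0 ?(ltW f0)//; lra.
Qed.

Let P_middle m : (l <= m <= l + 5)%N -> 4 ^+ l / 2 <= P m.
Proof.
elim: m => [|m ih].
  rewrite leqn0 => /andP[/eqP l0 _].
  have := P_head (m := 0) (leq0n l); rewrite l0 expr0 invr1; lra.
rewrite leq_eqVlt => /andP[/orP[/eqP lm|lm] m5].
  have := P_head (m := l) (leqnn l); rewrite -lm divff ?gt_eqF//.
  by have := four l; lra.
have m6 : (m < l + 5)%N by [].
have {}ih := ih (introT andP (conj lm (ltnW m5))).
have h1 := q_middle m6 (or_introl erefl); have h2 := q_middle m6 (or_intror erefl).
rewrite P_S; apply: le_trans ih _.
have p1 := ler_peMr (P_ge0 m) h1.
exact: le_trans p1 (ler_peMr (le_trans (P_ge0 m) p1) h2).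
Qed.

(** The surplus 256 / 4^(k + 5) above 1/2 is a reserve: with u = 4^-(k + 5), its drop from 256 u to
    64 u covers the two new factors, each at least 1 - 64 u, so the bound never falls below half of
    the initial one. *)
Let P_tail k : 4 ^+ l / 2 * (2^-1 + 256 / 4 ^+ (k + 5)) <= P (l + 5 + k).
Proof.
elim: k => [|k ih].
  rewrite addn0 add0n; have := P_middle (m := l + 5); rewrite leqnn leq_addr => /(_ isT).
  apply: le_trans; rewrite four5 ger_pMr; [lra|exact: divr_gt0].
rewrite [(l + 5 + k.+1)%N]addnS P_S.
have h1 := q_tail (i := l + 5 + k) (or_introl erefl).
have h2 := q_tail (i := l + 5 + k) (or_intror erefl).
have E : 4 ^+ l / 4 ^+ (l + 5 + k) = (4 ^+ (k + 5))^-1 :> R.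
  by rewrite -addnA exprD [(5 + k)%N]addnC invfM mulrA divff ?mul1r// gt_eqF.
rewrite E in h1 h2; rewrite addSn exprS.
have u1 : (4 ^+ (k + 5))^-1 <= 1024^-1 :> R.
  by rewrite -four5 lef_pV2 ?posrE// pow4// leq_addl.
have u0 : 0 < (4 ^+ (k + 5))^-1 :> R by rewrite invr_gt0.
have -> : 256 / (4 * 4 ^+ (k + 5)) = 64 * (4 ^+ (k + 5))^-1 :> R.
  by field; rewrite gt_eqF.
move: ((4 ^+ (k + 5))^-1) u0 u1 h1 h2 ih => u u0 u1 h1 h2 ih.
have l0 : 0 < 4 ^+ l / 2 :> R by rewrite divr_gt0.
have v0 : 0 <= 1 - 64 * u by lra.
apply: (@le_trans _ _ (4 ^+ l / 2 * (2^-1 + 256 * u) * (1 - 64 * u) * (1 - 64 * u))).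
  move: (4 ^+ l / 2) l0 => a a0.
  have -> : a * (2^-1 + 256 * u) * (1 - 64 * u) * (1 - 64 * u) =
    a * ((2^-1 + 256 * u) * (1 - 64 * u) * (1 - 64 * u)) by ring.
  rewrite ler_pM2l//; nra.
have A : 0 <= 4 ^+ l / 2 * (2^-1 + 256 * u).
  by apply: (mulr_ge0 (ltW l0)); lra.
exact: ler_pM (mulr_ge0 A v0) v0 (ler_pM A v0 ih h1) h2.
Qed.

(* The three ranges of factors: j < 2l (close to 2), 2l <= j < 2l + 10 (at least
   1, as the cosine is still nonnegative) and j >= 2l + 10 (close to 1, by the
   decay of the Fejer kernel). *)
Lemma dyadic_product_lower m : (l <= m)%N -> 4 ^+ l / 4 <= P m.
Proof.
move=> lm; have l0 := four l.
have [m5|m5] := leqP m (l + 5).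
  apply: le_trans (P_middle _); last by rewrite lm.
  lra.
have := P_tail (m - (l + 5)); rewrite subnKC ?(ltnW m5)//; apply: le_trans.
have := four (m - (l + 5) + 5); rewrite -invr_gt0.
move: ((4 ^+ (_ + 5))^-1) => u u0; nra.
Qed.

End dyadic_lower_bound.

(** * Bumps, dyadic boxes and the failure of the Bessel bound *)

Section tent.
Context {R : realType}.
Notation mu := (@leb2 R).
Notation leb := (@lebesgue_measure R).
Implicit Types (a : R) (xi : plane R).

(** A piecewise linear bump is enough, since the data in [Cc] are only asked to be continuous; its
    Lipschitz bound gives continuity of [chi] directly. *)
Definition tent a : R := Num.max 0 (1 - `|a|).

Lemma tent_ge0 a : 0 <= tent a.
Proof. by rewrite le_max lexx. Qed.

Lemma tent_le1 a : tent a <= 1.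
Proof. by rewrite ge_max ler01/= gerBl. Qed.

Lemma tent_ge_half a : `|a| <= 2^-1 -> 2^-1 <= tent a.
Proof. by move=> ha; rewrite le_max; apply/orP; right; lra. Qed.

Lemma tent_support a : tent a != 0 -> `|a| <= 1.
Proof.
apply: contra_neqT; rewrite -ltNge => a1.
by apply/eqP; rewrite eq_le tent_ge0 andbT ge_max lexx/= subr_le0 ltW.
Qed.

Lemma tent_lipschitz a b : `|tent a - tent b| <= `|a - b|.
Proof.
have h1 : `|a| <= `|b| + `|a - b| by rewrite -{1}(subrK b a) addrC ler_normD.
have h2 : `|b| <= `|a| + `|a - b| by rewrite -{1}(subrK a b) addrC distrC ler_normD.
rewrite /tent ler_norml; apply/andP; split; rewrite /Num.max; case: ltP => A; case: ltP => B; lra.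
Qed.

Variables (x0 : plane R) (r : R).
Hypothesis r_gt0 : 0 < r.

Definition coord1 xi : R := (xi.1 - x0.1) / r.
Definition coord2 xi : R := (xi.2 - x0.2) / r.
Definition chi xi : R := tent (coord1 xi) * tent (coord2 xi).

Lemma chi_ge0 xi : 0 <= chi xi. Proof. by rewrite mulr_ge0 ?tent_ge0. Qed.

Lemma chi_le1 xi : chi xi <= 1.
Proof. by rewrite mulr_ile1 ?tent_ge0 ?tent_le1. Qed.

Lemma chi_support xi : chi xi != 0 -> `|xi.1 - x0.1| <= r /\ `|xi.2 - x0.2| <= r.
Proof.
rewrite mulf_eq0 negb_or => /andP[/tent_support h1 /tent_support h2].
move: h1 h2; rewrite /coord1 /coord2 !normrM !normfV (gtr0_norm r_gt0).
by rewrite !ler_pdivrMr// !mul1r.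
Qed.

Lemma continuous_chi : continuous (chi : R * R -> R).
Proof.
apply: (@lipschitz_continuous2 _ _ (r^-1)) => x y.
have E : chi x - chi y = tent (coord1 x) * (tent (coord2 x) - tent (coord2 y)) +
    (tent (coord1 x) - tent (coord1 y)) * tent (coord2 y) by rewrite /chi; ring.
have b1 : `|tent (coord1 x) - tent (coord1 y)| <= r^-1 * `|x.1 - y.1|.
  apply: le_trans (tent_lipschitz _ _) _; rewrite -mulrBl normrM normfV (gtr0_norm r_gt0) mulrC.
  by have -> : x.1 - x0.1 - (y.1 - x0.1) = x.1 - y.1 by ring.
have b2 : `|tent (coord2 x) - tent (coord2 y)| <= r^-1 * `|x.2 - y.2|.
  apply: le_trans (tent_lipschitz _ _) _; rewrite -mulrBl normrM normfV (gtr0_norm r_gt0) mulrC.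
  by have -> : x.2 - x0.2 - (y.2 - x0.2) = x.2 - y.2 by ring.
rewrite E; apply: le_trans (ler_normD _ _) _; rewrite !normrM addrC mulrDr.
rewrite !(ger0_norm (tent_ge0 _)); apply: lerD.
  apply: le_trans b1; by apply: ler_piMr => //; exact: tent_le1.
apply: le_trans b2; by apply: ler_piMl => //; exact: tent_le1.
Qed.

Lemma Cc_chiM (f : plane R -> R[i]) (M : R) :
  continuous (fun x : R * R => complex.Re (f x)) ->
  continuous (fun x : R * R => complex.Im (f x)) ->
  (forall x, chi x != 0 -> cabs (f x) <= M) ->
  Cc (fun x => (chi x)%:C%C * f x).
Proof.
move=> c1 c2 fM; split.
- under eq_fun do rewrite cRe_mulC; move=> x.
  by apply: (@continuousM _ _ chi _ x); [exact: continuous_chi|exact: c1].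
- under eq_fun do rewrite cIm_mulC; move=> x.
  by apply: (@continuousM _ _ chi _ x); [exact: continuous_chi|exact: c2].
- exists `|M| => x; rewrite cabsM cabsR (ger0_norm (chi_ge0 x)).
  have [->|/fM h] := eqVneq (chi x) 0; first by rewrite mul0r.
  apply: le_trans (ler_norm M).
  by apply: le_trans h; apply: ler_piMl; [exact: cabs_ge0|exact: chi_le1].
- exists (r + (`|x0.1| + `|x0.2|)); first by rewrite ltr_wpDr// addr_ge0.
  move=> x h; have {h}/chi_support[h1 h2] : chi x != 0.
    by apply: contra_neq h => ->; rewrite mul0r.
  have n1 : `|x.1| <= `|x.1 - x0.1| + `|x0.1| by rewrite -{1}(subrK x0.1 x.1) ler_normD.
  have n2 : `|x.2| <= `|x.2 - x0.2| + `|x0.2| by rewrite -{1}(subrK x0.2 x.2) ler_normD.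
  have m1 : 0 <= `|x0.1| by []. have m2 : 0 <= `|x0.2| by [].
  split; lra.
Qed.

Lemma rint_chi : rint mu chi.
Proof.
have /Cc_cint[] : Cc (fun x => (chi x)%:C%C * 1).
  apply: (@Cc_chiM (fun=> 1) 1); [by move=> x; exact: cst_continuous| |].
    by move=> x; exact: cst_continuous.
  by move=> x _; rewrite -(expi0 (R := R)) cabs_expi.
by under eq_fun do rewrite mulr1.
Qed.

(** In the coordinates [coord1], [coord2] this is [2^-(l+1), 2^-l[ times [0, 2^-l]; the half-open
    side makes the boxes of different l disjoint. *)
Definition dyadic_box (l : nat) xi : R :=
  \1_`[x0.1 + r / 2 ^+ l.+1, x0.1 + r / 2 ^+ l[ xi.1 *
  \1_`[x0.2, x0.2 + r / 2 ^+ l] xi.2.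

Lemma Rint_indic_itv a b c d : a <= b ->
  \int[leb]_x (\1_[set` Interval (BSide c a) (BSide d b)] x : R) = b - a.
Proof.
move=> ab; rewrite /Rintegral integral_indic//= setIT lebesgue_measure_itv/= lte_fin.
case: ltP => //= ba; have -> : a = b by apply/le_anti; rewrite ab.
by rewrite subrr.
Qed.

Lemma rint_dyadic_box l : rint mu (dyadic_box l).
Proof. exact: rint_prod (integrable_indic_itv _ _ _ _) (integrable_indic_itv _ _ _ _). Qed.

Lemma Rint_dyadic_box l : \int[mu]_x dyadic_box l x = r ^+ 2 / (2 * 4 ^+ l).
Proof.
have i1 : rint leb (\1_`[x0.1 + r / 2 ^+ l.+1, x0.1 + r / 2 ^+ l[).
  exact: integrable_indic_itv.
have i2 : rint leb (\1_`[x0.2, x0.2 + r / 2 ^+ l]).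
  exact: integrable_indic_itv.
have l0 : 0 < r / 2 ^+ l by rewrite divr_gt0// exprn_gt0.
rewrite (@Rintegral_prod1 _ _ _ _ _ leb leb _ _ i1 i2 (dyadic_box l)) => [||x y].
- rewrite /dyadic_box/=; under eq_Rintegral do rewrite RintegralZl//.
  rewrite RintegralZr// !Rint_indic_itv ?lerDl ?(ltW l0)//; last first.
    by rewrite lerD2l exprS invfM mulrCA ler_piMl ?(ltW l0)//; lra.
  have -> : 4 ^+ l = 2 ^+ l * 2 ^+ l :> R by rewrite -exprMn; congr (_ ^+ _); ring.
  by rewrite exprS; field; rewrite expf_neq0.
- by have /measurable_int/measurable_EFinP := rint_dyadic_box l.
- by rewrite /dyadic_box/= ger0_norm ?mulr_ge0.
Qed.

Lemma dyadic_boxP l xi : dyadic_box l xi = 0 \/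
  [/\ dyadic_box l xi = 1, (2 ^+ l.+1)^-1 <= coord1 xi < (2 ^+ l)^-1 &
      0 <= coord2 xi <= (2 ^+ l)^-1].
Proof.
rewrite /dyadic_box !indicE.
have [|] := boolP (xi.1 \in _); last by rewrite mul0r; left.
rewrite inE/= in_itv/= => /andP[a1 a2].
have [|] := boolP (xi.2 \in _); last by rewrite mulr0; left.
rewrite inE/= in_itv/= => /andP[b1 b2].
right; rewrite mulr1; split => //; rewrite /coord1 /coord2.
- rewrite ler_pdivlMr// ltr_pdivrMr// ![_^-1 * r]mulrC; lra.
- by rewrite divr_ge0 ?subr_ge0 ?(ltW r_gt0)//= ler_pdivrMr// [_^-1 * r]mulrC; lra.
Qed.

Variable al : R.
Hypotheses (al_gt0 : 0 < al) (al_small : al * 1024 <= 1).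

Definition phase_freq xi : R := al * (coord1 xi ^+ 2 + coord2 xi ^+ 2).

Let q := riesz_factor phase_freq coord1 (fun j => 2 ^ j./2)%N.

Let q_ge0 j xi : 0 <= q j xi.
Proof. by have /andP[] := riesz_factor_bounds phase_freq coord1 (fun j => 2 ^ j./2)%N j xi. Qed.

(** The boxes are used from l + 1 on, so that both coordinates are at most 1/2 and chi >= 1/4; the
    16 combines this with the 1/4 of [dyadic_product_lower]. *)
Lemma riesz_on_box (K l : nat) xi : (l < K)%N -> dyadic_box l.+1 xi = 1 ->
  4 ^+ l.+1 / 16 <= chi xi * \prod_(j < K.*2) q j xi.
Proof.
move=> lK; case: (dyadic_boxP l.+1 xi) => [->/eqP|[_ /andP[a1 a2] /andP[b1 b2] _]].
  by rewrite eq_sym oner_eq0.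
have v0 : 0 < (2 ^+ l.+1)^-1 :> R by rewrite invr_gt0 exprn_gt0.
have v1 : (2 ^+ l.+1)^-1 <= 2^-1 :> R.
  by rewrite exprS invfM ler_piMr// invf_le1 ?exprn_gt0// exprn_ege1// ler1n.
have E2 : (2 ^+ l.+2)^-1 = 2^-1 * (2 ^+ l.+1)^-1 :> R by rewrite exprS invfM.
have E4 : 4 ^+ l.+1 * ((2 ^+ l.+1)^-1) ^+ 2 = 1 :> R.
  have -> : 4 ^+ l.+1 = 2 ^+ l.+1 ^+ 2 :> R by rewrite -exprM mulnC exprM; congr (_ ^+ _); ring.
  by rewrite -exprMn divff ?expr1n// expf_neq0.
rewrite E2 in a1.
have f0 : 0 < 4 ^+ l.+1 :> R by rewrite exprn_gt0.
move: ((2 ^+ l.+1)^-1) v0 v1 E4 a1 a2 b2 => v v0 v1 E4 a1 a2 b2.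
have X0 : 0 < coord1 xi by lra.
have X1 : coord1 xi <= 1 by lra.
have Xl : 1 <= 4 * (4 ^+ l.+1 * coord1 xi ^+ 2).
  have : (2^-1 * v) ^+ 2 <= coord1 xi ^+ 2 by rewrite lerXn2r ?nnegrE//; lra.
  nra.
have Xu : 4 ^+ l.+1 * coord1 xi ^+ 2 <= 1.
  rewrite -[leRHS]E4 ler_pM2l// lerXn2r ?nnegrE ?ltW//.
have Y2 : coord2 xi ^+ 2 <= v ^+ 2 by rewrite lerXn2r ?nnegrE//; lra.
have W0 : 0 <= coord1 xi ^+ 2 + coord2 xi ^+ 2 by rewrite addr_ge0 ?sqr_ge0.
have Wu : 4 ^+ l.+1 * (coord1 xi ^+ 2 + coord2 xi ^+ 2) <= 2.
  have : 4 ^+ l.+1 * coord2 xi ^+ 2 <= 1 by rewrite -[leRHS]E4 ler_pM2l.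
  by rewrite mulrDr; lra.
have H := dyadic_product_lower al_gt0 al_small X0 X1 Xl Xu W0 Wu lK.
have c4 : 4^-1 <= chi xi.
  have h1 : 2^-1 <= tent (coord1 xi) by apply: tent_ge_half; rewrite ger0_norm; lra.
  have h2 : 2^-1 <= tent (coord2 xi) by apply: tent_ge_half; rewrite ger0_norm; lra.
  have -> : 4^-1 = 2^-1 * 2^-1 :> R by field.
  by apply: ler_pM.
have -> : 4 ^+ l.+1 / 16 = 4^-1 * (4 ^+ l.+1 / 4) :> R by field.
apply: ler_pM => //; exact: divr_ge0 (ltW f0) (ler0n _ _).
Qed.

Lemma sum_boxes_le (K : nat) xi :
  \sum_(l < K) 4 ^+ l.+1 / 16 * dyadic_box l.+1 xi <= chi xi * \prod_(j < K.*2) q j xi.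
Proof.
have P0 : 0 <= chi xi * \prod_(j < K.*2) q j xi.
  by apply: mulr_ge0; [exact: chi_ge0|exact: prodr_ge0].
have [[l Hl]|/forallNP H] := pselect (exists l : 'I_K, dyadic_box l.+1 xi = 1); last first.
  rewrite big1// => l _; case: (dyadic_boxP l.+1 xi) => [->|[E _ _]]; first by rewrite mulr0.
  by case: (H l).
rewrite (bigD1 l)//= Hl mulr1 big1 ?addr0 => [|k kl]; first exact: riesz_on_box.
case: (dyadic_boxP k.+1 xi) => [->|[_ /andP[k1 k2] _]]; first by rewrite mulr0.
case: (dyadic_boxP l.+1 xi) => [E|[_ /andP[l1 l2] _]].
  by move/eqP: Hl; rewrite E eq_sym oner_eq0.
have disj (m n : nat) : (m < n)%N -> (2 ^+ n.+1)^-1 <= (2 ^+ m.+2)^-1 :> R.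
  by move=> mn; rewrite lef_pV2 ?posrE ?exprn_gt0// ler_weXn2l// ler1n.
exfalso; move/negP: kl; apply; apply/eqP/val_inj => /=.
have [kl|lk|//] := ltngtP k l.
- by exfalso; have := disj _ _ kl; lra.
- by exfalso; have := disj _ _ lk; lra.
Qed.

(** Height 4^(l+1) / 16 times area r^2 / (2 * 4^(l+1)) is r^2 / 32 for every box, so K boxes with K
    r^2 / 32 >= A suffice. The length is N = 2^(2K): each scale uses two binary digits. *)
Lemma Riesz_Bessel_failure (A : R) : exists N y, (0 < N)%N /\
  A * N%:R <= \int[mu]_xi (chi xi * cabs (expsum phase_freq coord1 N y xi) ^+ 2).
Proof.
have [K AK] : exists K : nat, A <= K%:R * (r ^+ 2 / 32).
  have r2 : 0 < r ^+ 2 / 32 by rewrite divr_gt0 ?exprn_gt0.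
  exists (Num.bound `|A / (r ^+ 2 / 32)|); rewrite -ler_pdivrMr//.
  apply: le_trans (ler_norm _) _; exact: ltW (archi_boundP (normr_ge0 _)).
have mc1 : measurable_fun setT coord1.
  apply: measurable_funM => //; apply: measurable_funB => //.
have mc2 : measurable_fun setT coord2.
  apply: measurable_funM => //; apply: measurable_funB => //.
have mf : measurable_fun setT phase_freq.
  apply: measurable_funM => //; apply: measurable_funD; exact: measurable_funX.
have Lp j : (0 < 2 ^ j./2)%N by rewrite expn_gt0.
have [y Hy] := riesz_product_lower mf mc1 Lp K.*2 rint_chi chi_ge0.
exists (2 ^ K.*2)%N, y; split; first by rewrite expn_gt0.
apply: le_trans Hy; rewrite natrX mulrC ler_pM2l ?exprn_gt0//.
apply: (le_trans AK).
have ib (l : 'I_K) : rint mu (fun xi => 4 ^+ l.+1 / 16 * dyadic_box l.+1 xi).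
  by apply: rintZ; exact: rint_dyadic_box.
have [isum Esum] := Rint_sum (index_enum _) ib.
apply: (@le_trans _ _ (\int[mu]_xi \sum_(l < K) 4 ^+ l.+1 / 16 * dyadic_box l.+1 xi)).
  rewrite Esum; apply: ler_eq.
  under eq_bigr => l _.
    rewrite RintegralZl//; last exact: rint_dyadic_box.
    rewrite Rint_dyadic_box.
    have -> : 4 ^+ l.+1 / 16 * (r ^+ 2 / (2 * 4 ^+ l.+1)) = r ^+ 2 / 32.
      by field; rewrite expf_neq0.
    over.
  by rewrite sumr_const card_ord mulr_natl.
apply: le_Rintegral => //.
- apply: (@rint_mul_bounded _ _ _ (2 ^+ K.*2)); first exact: rint_chi.
    apply: measurable_prod => j _; exact: measurable_riesz_factor.
  move=> x; rewrite ger0_norm ?prodr_ge0//.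
  apply: (@le_trans _ _ (\prod_(j < K.*2) 2)); last by rewrite prodr_const card_ord.
  apply: ler_prod => j _; exact: riesz_factor_bounds.
- by move=> x _; exact: sum_boxes_le.
Qed.

End tent.

(** * Time windows and random signs *)

Section lower_bounds.
Context {R : realType}.
Notation mu := (@leb2 R).
Notation leb := (@lebesgue_measure R).

(* Monotonicity of the integral without measurability of the larger function:
   the integral of a nonnegative function is a supremum over simple functions. *)
Lemma ge0_le_integral_nonmeas d (T : measurableType d) (m : {measure set T -> \bar R})
    (f g : T -> \bar R) : (forall x, 0 <= f x)%E -> (forall x, f x <= g x)%E ->
  (\int[m]_x f x <= \int[m]_x g x)%E.
Proof.
move=> f0 fg; have g0 x : (0 <= g x)%E := le_trans (f0 x) (fg x).
rewrite !ge0_integralTE//; apply: le_ereal_sup => _ [h hf <-].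
by exists h => // x; exact: le_trans (hf x) (fg x).
Qed.

Lemma integral_shift (f : R -> R) (a d : R) : 0 <= d -> continuous f ->
  (\int[leb]_(x in `[a, (a + d)%R]) ((fun y : R => f (y - a)%R) x)%:E =
   \int[leb]_(x in `[0%R, d]) (f x)%:E)%E.
Proof.
move=> d0 cf.
have dF (x : R) : is_derive x 1 (fun s : R => a + s) 1.
  by apply: is_derive_eq; rewrite add0r mulr1.
have F1 : derive1 (fun s : R => a + s) = cst 1.
  by apply/funext => x; rewrite derive1E; have [_ ->] := dF x.
have cF : continuous (fun s : R => a + s).
  by move=> x; exact: is_derive1_continuous (dF x).
have cG : continuous (fun x : R => f (x - a)).
  move=> x; apply: (@continuous_comp _ _ _ (fun x => x - a) f); last exact: cf.
  by apply: cvgB; [exact: cvg_id|exact: cvg_cst].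
have := @integration_by_substitution_increasing R (fun s => a + s) (fun x => f (x - a)) 0 d d0.
rewrite addr0 F1 => ->.
- apply: eq_integral => x _; congr EFin; rewrite !fctE/= mulr1.
  by congr f; ring.
- by move=> x y _ _; rewrite ltrD2l.
- by move=> x _; exact: cst_continuous.
- exact: is_cvg_cst.
- exact: is_cvg_cst.
- split.
  + by move=> x _; have [] := dF x.
  + by apply: cvg_at_right_filter; exact: cF.
  + by apply: cvg_at_left_filter; exact: cF.
- exact: continuous_subspaceT.
Qed.

(** The windows [tau n, tau n + d] are disjoint as d < tau, so at each t at most one summand is
    nonzero. In the application [H t] is an essential supremum in x, compared with the windows by
    [ge0_le_integral_nonmeas]. *)
Lemma sum_windows_le (N : nat) (tau d : R) (h : nat -> R -> R) (H : R -> \bar R) :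
  0 <= d -> d < tau -> (forall n, continuous (h n)) -> (forall n s, 0 <= h n s) ->
  (forall t, 0 <= H t)%E -> (forall n s, (h n s)%:E <= H (tau * n%:R + s)%R)%E ->
  (\sum_(n < N) \int[leb]_(s in `[0%R, d]) (h n s)%:E <= \int[leb]_t H t)%E.
Proof.
move=> d0 dt ch h0 H0 hH.
pose I (n : nat) : set R := [set` `[tau * n%:R, tau * n%:R + d]%R].
pose g (n : nat) t : R := h n (t - tau * n%:R) * \1_(I n) t.
have tau0 : 0 < tau := le_lt_trans d0 dt.
have mg n : measurable_fun setT (g n).
  apply: measurable_funM; last by apply: measurable_indic; exact: measurable_itv.
  apply: continuous_measurable_fun => x.
  apply: (@continuous_comp _ _ _ (fun x => x - tau * n%:R) (h n)); last exact: ch.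
  by apply: cvgB; [exact: cvg_id|exact: cvg_cst].
have g0 n t : 0 <= g n t by rewrite mulr_ge0.
have E n : (\int[leb]_(s in `[0%R, d]) (h n s)%:E = \int[leb]_t (g n t)%:E)%E.
  rewrite -(@integral_shift _ (tau * n%:R))// integral_mkcond.
  apply: eq_integral => t _; rewrite /g patchE indicE /I.
  by case: ifPn => tI; rewrite ?(mem_set tI) /= ?mulr1 ?mulr0.
under eq_bigr do rewrite E.
rewrite -ge0_integral_sum//; last 2 first.
- by move=> n; apply/measurable_EFinP; exact: mg.
- by move=> n t _; rewrite lee_fin.
apply: ge0_le_integral_nonmeas => t; first by apply: sume_ge0 => n _; rewrite lee_fin.
have [[n tn]|/forallNP tn] := pselect (exists n : 'I_N, I n t); last first.
  rewrite big1// => n _; rewrite /g indicE memNset ?mulr0//; exact: tn.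
have nother (m : 'I_N) : m != n -> g m t = 0.
  move=> mn; rewrite /g indicE memNset ?mulr0// => tm.
  move: tn tm; rewrite /I /= !in_itv/= => /andP[n1 n2] /andP[m1 m2].
  have sep (i j : nat) : (i < j)%N -> tau * i%:R + tau <= tau * j%:R.
    by move=> ij; rewrite -[X in _ + X]mulr1 -mulrDr natr1 ler_pM2l// ler_nat.
  move/negP: mn; apply; apply/eqP/val_inj => /=.
  have [ij|ij|//] := ltngtP m n; exfalso; have := sep _ _ ij; lra.
rewrite (bigD1 n)//= big1 ?adde0 => [|m mn]; last by rewrite nother.
rewrite /g indicE mem_set// mulr1; apply: le_trans (hH n _) _.
by rewrite addrC subrK.
Qed.

Lemma box_measure_gt0 (x : plane R) (e : R) : 0 < e ->
  (0 < mu (ball x.1 e `*` ball x.2 e))%E.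
Proof.
move=> e0.
have -> : mu (ball x.1 e `*` ball x.2 e) = (leb (ball x.1 e) * leb (ball x.2 e))%E.
  by apply: product_measure1E; exact: measurable_ball.
by rewrite !lebesgue_measure_ball ?(ltW e0)// -EFinM lte_fin mulr_gt0// mulrn_wgt0.
Qed.

(** If a continuous function exceeded its essential supremum at x, it would do so on a box around x,
    which has positive measure. *)
Lemma cnorm_oo_ge (w : plane R -> R[i]) (x : plane R) :
  continuous (fun y : R * R => cabs (w y)) -> ((cabs (w x))%:E <= cnorm +oo%E w)%E.
Proof.
move=> cw; rewrite /cnorm unlock.
have ball_gt0 := @box_measure_gt0 x.
(* [Lnorm] at [+oo] is the essential supremum only on a space of positive measure. *)
have mu0 : (0 < mu setT)%E.
  apply: lt_le_trans (ball_gt0 1 ltr01) _; apply: le_measure; rewrite ?inE//.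
  by apply: measurableX; exact: measurable_ball.
rewrite mu0 leNgt; apply/negP => lt.
have := ess_sup_ge mu (abse \o (fun x => (cabs (w x))%:E)).
move: (ess_sup _ _) lt => m lt [A [mA A0 subA]].
have {lt}[y my yw] : exists2 y, (m <= y%:E)%E & y < cabs (w x).
  case: m lt {subA} => [m|//|]; first by rewrite lte_fin; exists m.
  by move=> _; exists (cabs (w x) - 1); [exact: leNye|lra].
have e0 : 0 < cabs (w x) - y by rewrite subr_gt0.
have /cvgrPdist_lt/(_ _ e0)/nbhs_ballP[d /= d0 Hd] := cw x.
have : (mu (ball x.1 d `*` ball x.2 d) <= mu A)%E.
  apply: le_measure; rewrite ?inE//; first by apply: measurableX; exact: measurable_ball.
  move=> z [z1 z2]; apply: subA => /= H.
  have : `|cabs (w x) - cabs (w z)| < cabs (w x) - y by apply: Hd; split.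
  have := le_trans H my; rewrite lee_fin ger0_norm ?cabs_ge0// ltr_norml; lra.
by rewrite A0 leNgt ball_gt0.
Qed.

End lower_bounds.

Section random_signs.
Context {R : realType}.
Variable N : nat.
Implicit Types (e : {ffun 'I_N -> bool}) (c : 'I_N -> R[i]) (n m : 'I_N).

Definition sgn e n : R[i] := ((-1) ^+ e n)%:C%C.

Definition signed_sum e c : R[i] := \sum_n sgn e n * c n.

Definition flip n e : {ffun 'I_N -> bool} := [ffun m => if m == n then ~~ e m else e m].

Lemma flipK n : involutive (flip n).
Proof.
by move=> e; apply/ffunP => m; rewrite !ffunE; case: (m == n); rewrite ?negbK.
Qed.

Lemma sgn_flip n e : sgn (flip n e) n = - sgn e n.
Proof. by rewrite /sgn ffunE eqxx; case: (e n); rewrite /= ?expr1 ?expr0 rmorphN ?opprK. Qed.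

Lemma sgn_flip_other n m e : m != n -> sgn (flip n e) m = sgn e m.
Proof. by move=> mn; rewrite /sgn ffunE (negbTE mn). Qed.

Lemma cabs_sgn e n : cabs (sgn e n) = 1.
Proof. by rewrite cabsR normrX normrN1 expr1n. Qed.

Lemma sgn_sqr e n : sgn e n * sgn e n = 1.
Proof. by rewrite /sgn -realcM -expr2 sqrr_sign. Qed.

Lemma sum_signs_cst (V : nzRingType) (a : V) :
  \sum_(e : {ffun 'I_N -> bool}) a = 2 ^+ N * a.
Proof.
rewrite sumr_const -[a *+ _]mulr_natl -natrX; congr (_%:R * a).
by have := card_ffun 'I_N bool; rewrite card_bool card_ord.
Qed.

(* Pairing each sign pattern with the one flipped at n isolates c_n. *)
Lemma signed_sum_lower c n : 2 ^+ N * cabs (c n) <= \sum_e cabs (signed_sum e c).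
Proof.
have h e : 2 * cabs (c n) <= cabs (signed_sum e c) + cabs (signed_sum (flip n e) c).
  have -> : 2 * cabs (c n) = cabs (2 * (sgn e n * c n)).
    rewrite !cabsM cabs_sgn mul1r; congr (_ * _).
    by have -> : 2 = (2 : R)%:C%C :> R[i] by [rewrite rmorph_nat]; rewrite cabsR ger0_norm.
  have -> : 2 * (sgn e n * c n) = signed_sum e c - signed_sum (flip n e) c.
    rewrite /signed_sum (bigD1 n)//= [X in _ - X](bigD1 n)//= sgn_flip.
    have -> : \sum_(i < N | i != n) sgn (flip n e) i * c i = \sum_(i < N | i != n) sgn e i * c i.
      by apply: eq_bigr => i ni; rewrite sgn_flip_other.
    ring.
  by apply: le_trans (cabsD _ _) _; rewrite cabsN.
have : \sum_(e : {ffun 'I_N -> bool}) 2 * cabs (c n) <=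
    \sum_e (cabs (signed_sum e c) + cabs (signed_sum (flip n e) c)).
  by apply: ler_sum => e _; exact: h.
rewrite big_split/=.
have <- : \sum_e cabs (signed_sum e c) = \sum_e cabs (signed_sum (flip n e) c).
  by rewrite (reindex_inj (inv_inj (flipK n))).
rewrite sum_signs_cst; lra.
Qed.

(** Orthogonality of random signs: flipping the sign at n negates the correlation [S n m] for m !=
    n, which therefore vanishes. *)
Lemma signed_sum_energy c :
  \sum_e cabs (signed_sum e c) ^+ 2 = 2 ^+ N * \sum_n cabs (c n) ^+ 2.
Proof.
pose S n m : R[i] := \sum_e sgn e n * sgn e m.
have diag n : S n n = 2 ^+ N.
  rewrite /S; under eq_bigr do rewrite sgn_sqr.
  by rewrite sum_signs_cst mulr1.
have cross n m : n != m -> S n m = 0.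
  move=> nm; have SN : S n m = - S n m.
    rewrite {1}/S (reindex_inj (inv_inj (flipK n))) /S -sumrN.
    apply: eq_bigr => e _; rewrite sgn_flip sgn_flip_other ?mulNr//.
    by rewrite eq_sym.
  have : S n m *+ 2 = 0 by rewrite mulr2n {1}SN addNr.
  by move/eqP; rewrite mulrn_eq0/= => /eqP.
have E : \sum_e (cabs (signed_sum e c) ^+ 2)%:C%C =
    \sum_n \sum_m S n m * (c n * conjc (c m)).
  have -> : \sum_e (cabs (signed_sum e c) ^+ 2)%:C%C =
      \sum_e \sum_n \sum_m (sgn e n * sgn e m) * (c n * conjc (c m)).
    apply: eq_bigr => e _; rewrite -mulcJ /signed_sum.
    have -> : conjc (\sum_n sgn e n * c n) = \sum_n sgn e n * conjc (c n).
      rewrite rmorph_sum; apply: eq_bigr => n _.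
      by rewrite rmorphM; congr (_ * _); exact: conjc_real.
    rewrite mulr_suml; apply: eq_bigr => n _; rewrite mulr_sumr.
    by apply: eq_bigr => m _; ring.
  rewrite exchange_big; apply: eq_bigr => n _.
  rewrite exchange_big; apply: eq_bigr => m _.
  by rewrite /S mulr_suml.
have {}E : (\sum_e cabs (signed_sum e c) ^+ 2)%:C%C =
    (2 ^+ N * \sum_n cabs (c n) ^+ 2)%:C%C :> R[i].
  rewrite [LHS](rmorph_sum (real_complex R)) E realcM.
  rewrite (rmorph_sum (real_complex R)) mulr_sumr; apply: eq_bigr => n _.
  rewrite (bigD1 n)//= big1 ?addr0 => [|m mn]; last by rewrite cross ?mul0r// eq_sym.
  rewrite diag mulcJ; congr (_ * _).
  by rewrite -[RHS]/(real_complex R _) rmorphXn rmorph_nat.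
by move: E => [].
Qed.

End random_signs.

(** * Schroedinger waves *)

Section continuous_symbols.
Context {R : realType}.
Notation mu := (@leb2 R).
Implicit Types (m f : plane R -> R[i]) (F : plane R -> R[i]).

Definition ccont m : Prop :=
  continuous (fun x : R * R => complex.Re (m x)) /\
  continuous (fun x : R * R => complex.Im (m x)).

Lemma ccont_cst (z : R[i]) : ccont (fun=> z).
Proof. by split => x; exact: cst_continuous. Qed.

Lemma ccontM m f : ccont m -> ccont f -> ccont (fun x => m x * f x).
Proof.
move=> [m1 m2] [f1 f2]; split.
- under eq_fun do rewrite cReM; move=> x; apply: cvgB.
    by apply: cvgM; [exact: m1|exact: f1].
  by apply: cvgM; [exact: m2|exact: f2].
- under eq_fun do rewrite cImM; move=> x; apply: cvgD.
    by apply: cvgM; [exact: m1|exact: f2].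
  by apply: cvgM; [exact: m2|exact: f1].
Qed.

Lemma ccontD m f : ccont m -> ccont f -> ccont (fun x => m x + f x).
Proof.
move=> [m1 m2] [f1 f2]; split.
- by under eq_fun do rewrite cReD; move=> x; apply: cvgD; [exact: m1|exact: f1].
- by under eq_fun do rewrite cImD; move=> x; apply: cvgD; [exact: m2|exact: f2].
Qed.

Lemma ccont_sum I (s : seq I) (f : I -> plane R -> R[i]) :
  (forall i, ccont (f i)) -> ccont (fun x => \sum_(i <- s) f i x).
Proof.
move=> cf; elim: s => [|i s ih].
  by under eq_fun do rewrite big_nil; exact: ccont_cst.
by under eq_fun do rewrite big_cons; exact: ccontD.
Qed.

Lemma ccont_expi (h : R * R -> R) : continuous h -> ccont (fun x => expi (h x)).
Proof.
move=> ch; split => x /=; apply: (@continuous_comp _ _ _ h); try exact: ch.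
- exact: continuous_cos.
- exact: continuous_sin.
Qed.

Lemma continuous_linear2 (a b c : R) :
  continuous (fun x : R * R => a * x.1 + b * x.2 + c).
Proof.
apply: (@lipschitz_continuous2 _ _ (`|a| + `|b|)) => x y.
have -> : a * x.1 + b * x.2 + c - (a * y.1 + b * y.2 + c) =
  a * (x.1 - y.1) + b * (x.2 - y.2) by ring.
apply: le_trans (ler_normD _ _) _; rewrite !normrM mulrDl !mulrDr.
have : 0 <= `|a| * `|x.2 - y.2| by rewrite mulr_ge0.
have : 0 <= `|b| * `|x.1 - y.1| by rewrite mulr_ge0.
lra.
Qed.

Lemma continuous_quadratic (k c1 c2 : R) :
  continuous (fun x : R * R => k * ((x.1 - c1) ^+ 2 + (x.2 - c2) ^+ 2)).
Proof.
move=> x.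
have p1 := @continuous_linear2 1 0 (- c1) x; have p2 := @continuous_linear2 0 1 (- c2) x.
have E : (fun x : R * R => k * ((x.1 - c1) ^+ 2 + (x.2 - c2) ^+ 2)) =
  (fun x => k * ((1 * x.1 + 0 * x.2 + - c1) * (1 * x.1 + 0 * x.2 + - c1) +
     (0 * x.1 + 1 * x.2 + - c2) * (0 * x.1 + 1 * x.2 + - c2))).
  by apply/funext => y; ring.
rewrite E; apply: cvgM; first exact: cst_continuous.
by apply: cvgD; apply: cvgM.
Qed.

Lemma Cc_mul m F (M : R) : Cc F -> ccont m ->
  (forall x, F x != 0 -> cabs (m x) <= M) -> Cc (fun x => m x * F x).
Proof.
move=> CF cm mM; have [c1 c2 [B FB] [r r0 Fr]] := CF.
have [d1 d2] := ccontM cm (conj c1 c2).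
have B0 : 0 <= B := le_trans (cabs_ge0 _) (FB (0, 0)).
split => //.
- exists (`|M| * B) => x; rewrite cabsM.
  have [->|Fx] := eqVneq (F x) 0; first by rewrite cabs0 mulr0 mulr_ge0.
  apply: ler_pM; [exact: cabs_ge0|exact: cabs_ge0| |exact: FB].
  exact: le_trans (mM x Fx) (ler_norm M).
- exists r => // x h; apply: Fr; apply: contra_neq h => ->; exact: mulr0.
Qed.

Lemma C0infty_ccont (phi : R * R -> R[i]) : C0infty phi -> ccont phi.
Proof. by move=> [s1 s2 _]; split; [have [] := s1 [::]|have [] := s2 [::]]. Qed.

Lemma ccont_near m (x0 : plane R) (e : R) : ccont m -> 0 < e ->
  exists2 r, 0 < r & forall x, `|x.1 - x0.1| <= r -> `|x.2 - x0.2| <= r ->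
    cabs (m x - m x0) <= e.
Proof.
move=> [c1 c2] e0; have e2 : 0 < e / 2 by rewrite divr_gt0.
have /cvgrPdist_lt/(_ _ e2) h1 := c1 x0.
have /cvgrPdist_lt/(_ _ e2) h2 := c2 x0.
have /nbhs_ballP[d /= d0 Hd] : \forall x \near (x0 : R * R),
    `|complex.Re (m x0) - complex.Re (m x)| < e / 2 /\
    `|complex.Im (m x0) - complex.Im (m x)| < e / 2 by near do split.
exists (d / 2); first by rewrite divr_gt0.
move=> x x1 x2; have [|k1 k2] := Hd x.
  by split; rewrite /ball/= distrC; lra.
apply: le_trans (cabs_le _) _; rewrite cReD cImD cReN cImN distrC [X in _ + X]distrC; lra.
Unshelve. all: by end_near. Qed.

Lemma fourier_multiplier_ift m F (M : R) : Cc F -> ccont m ->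
  (forall x, F x != 0 -> cabs (m x) <= M) ->
  fourier_multiplier m (ift F) (ift (fun x => m x * F x)).
Proof.
move=> CF cm mM; exists F, (fun x => m x * F x); split.
- exact: fourier_ift.
- by apply: fourier_ift; exact: Cc_mul mM.
- exact: aeW.
Qed.

Definition chirp (t : R) (xi : plane R) : R[i] :=
  expi (- (4 * pi ^+ 2 * t * dot xi xi)).

Lemma continuous_dot2 : continuous (fun x : R * R => dot x x).
Proof.
have := @continuous_quadratic 1 0 0.
have -> : (fun x : R * R => 1 * ((x.1 - 0) ^+ 2 + (x.2 - 0) ^+ 2)) = (fun x => dot x x).
  by apply/funext => x; rewrite /dot; ring.
by [].
Qed.

Lemma ccont_chirp t : ccont (chirp t).
Proof.
apply: ccont_expi => x; apply: cvgN; apply: cvgM; first exact: cst_continuous.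
exact: continuous_dot2.
Qed.

(** The continuous representative of e^(it Delta) applied to [ift F]; focusing is read off from its
    values at points. *)
Definition evolution F t : plane R -> R[i] := ift (fun xi => chirp t xi * F xi).

Lemma Cc_chirp F t : Cc F -> Cc (fun xi => chirp t xi * F xi).
Proof.
move=> CF; apply: (@Cc_mul _ _ 1) => //; first exact: ccont_chirp.
by move=> x _; rewrite cabs_expi.
Qed.

Lemma schrodinger_evolution F t : Cc F -> schrodinger t (ift F) (evolution F t).
Proof.
move=> CF; apply: (@fourier_multiplier_ift _ _ 1) => //; first exact: ccont_chirp.
by move=> x _; rewrite cabs_expi.
Qed.

Lemma evolution_continuous F t : Cc F ->
  continuous (fun x : R * R => cabs (evolution F t x)).
Proof.
move=> /(Cc_chirp t)/ift_lipschitz[K hK].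
apply: (@lipschitz_continuous2 _ _ K) => x y; apply: le_trans (hK x y).
exact: cabs_dist.
Qed.

Definition phase (t : R) (x xi : plane R) : R :=
  2 * pi * dot x xi - 4 * pi ^+ 2 * t * dot xi xi.

Lemma measurable_dotxx : measurable_fun setT (fun xi : plane R => dot xi xi).
Proof. by apply: measurable_funD; apply: measurable_funM. Qed.

Lemma measurable_evolution_phase t x : measurable_fun setT (phase t x).
Proof.
apply: measurable_funB; first exact: measurable_phase.
by apply: measurable_funM; [exact: measurable_cst|exact: measurable_dotxx].
Qed.

Lemma evolutionE F t x :
  evolution F t x = Cint mu (fun xi => F xi * expi (phase t x xi)).
Proof.
by apply: eq_Cint => xi; rewrite /chirp /phase expiD; ring.
Qed.

(** On the support |xi|^2 <= 2 r^2, so the phase is Lipschitz in time uniformly in xi. Continuity in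
    s is what allows the window integrals to be translated and summed. *)
Lemma evolution_continuous_time F x (t0 : R) : Cc F ->
  continuous (fun s : R => cabs (evolution F (t0 + s) x)).
Proof.
move=> CF; have [M [r r0 [_ Fr]]] := Cc_bounded_support CF.
pose N1 := \int[mu]_x cabs (F x).
pose K := 4 * pi ^+ 2 * (r ^+ 2 + r ^+ 2) * N1.
have N0 : 0 <= N1 by apply: Rintegral_ge0 => y _; exact: cabs_ge0.
have K0 : 0 <= K.
  by rewrite /K mulr_ge0// mulr_ge0 ?addr_ge0 ?sqr_ge0// mulr_ge0 ?sqr_ge0.
have L (s s' : R) : `|cabs (evolution F (t0 + s) x) - cabs (evolution F (t0 + s') x)| <=
    K * `|s - s'|.
  apply: le_trans (cabs_dist _ _) _; rewrite !evolutionE /K mulrAC.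
  apply: osc_lipschitz; [exact: Cc_cint|exact: measurable_evolution_phase|
    exact: measurable_evolution_phase|].
  move=> xi /Fr[x1 x2].
  have -> : phase (t0 + s) x xi - phase (t0 + s') x xi =
     - (4 * pi ^+ 2 * (s - s') * dot xi xi) by rewrite /phase; ring.
  have p0 : 0 <= 4 * pi ^+ 2 :> R by rewrite mulr_ge0// sqr_ge0.
  have d0 : 0 <= dot xi xi by rewrite /dot -!expr2 addr_ge0// sqr_ge0.
  have d1 : dot xi xi <= r ^+ 2 + r ^+ 2.
    rewrite /dot -!expr2 -(real_normK (num_real xi.1)) -(real_normK (num_real xi.2)).
    by apply: lerD; rewrite lerXn2r ?nnegrE// ltW.
  rewrite normrN mulrAC normrM (ger0_norm (mulr_ge0 p0 d0)).
  by rewrite ler_wpM2r// ler_wpM2l.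
move=> s; apply/cvgrPdist_lt => e e0.
have K1 : 0 < K + 1 by rewrite ltr_wpDl.
near=> s'; apply: le_lt_trans (L s s') _.
have : `|s - s'| < e / (K + 1).
  near: s'; apply: (@cvgr_dist_lt _ _ _ (nbhs s) _ id s); first exact: cvg_id.
  by rewrite divr_gt0.
rewrite ltr_pdivlMr//; have : 0 <= `|s - s'| by []. 
move: `|s - s'| => a; nra.
Unshelve. all: by end_near. Qed.

(** The variation of the symbol and the chirp each cost a quarter of [cabs (m x0)]; the factor
    multiplying w thus stays within half of its central value, and at least half of the mass
    survives. *)
Lemma coherent_lower_bound (w : plane R -> R) m (x0 : plane R) (s : R) :
  rint mu w -> (forall x, 0 <= w x) -> cmeas m ->
  (forall x, w x != 0 -> cabs (m x - m x0) <= cabs (m x0) / 4) ->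
  (forall x, w x != 0 -> `|4 * pi ^+ 2 * s * dot x x| <= 4^-1) ->
  cabs (m x0) * \int[mu]_x w x / 2 <=
    cabs (Cint mu (fun x => (w x)%:C%C * (m x * chirp s x))).
Proof.
move=> iw w0 mm wm ws; set a := m x0; set I := Cint _ _.
have mw : measurable_fun setT w by move/measurable_int: iw => /measurable_EFinP.
have mc : cmeas (chirp s).
  apply: cmeas_expi; apply: measurable_funN; apply: measurable_funM; first exact: measurable_cst.
  exact: measurable_dotxx.
have close x : w x != 0 -> cabs (m x * chirp s x - a) <= cabs a / 2.
  move=> wx; have -> : m x * chirp s x - a = (m x - a) * chirp s x + a * (chirp s x - 1) by ring.
  apply: le_trans (cabsD _ _) _; rewrite !cabsM cabs_expi mulr1.
  have h1 := wm x wx.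
  have h2 : cabs (chirp s x - 1) <= 4^-1.
    by apply: le_trans (cabs_expi_sub1 _) _; rewrite normrN; exact: ws.
  have := cabs_ge0 a; rewrite -/a in h1; nra.
have i1 : cint mu (fun x => (w x)%:C%C * (m x * chirp s x)).
  apply: (cint_dom _ (rintZ (cabs a + cabs a / 2) iw)) => [|x].
    by apply: cmeasM; [exact: cmeasR|exact: cmeasM].
  rewrite cabsM cabsR (ger0_norm (w0 x)) mulrC.
  have [->|wx] := eqVneq (w x) 0; first by rewrite !mulr0.
  rewrite ler_wpM2r//; have := close x wx => h.
  rewrite -[m x * _](subrK a) addrC; apply: le_trans (cabsD _ _) _; lra.
have i2 : cint mu (fun x => (- a) * (w x)%:C%C) by apply: cintZ; exact: cintR.
have E : I - a * (\int[mu]_x w x)%:C%C =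
    Cint mu (fun x => (w x)%:C%C * (m x * chirp s x) + (- a) * (w x)%:C%C).
  rewrite (CintD i1 i2) -CintR CintZ ?mulNr//; exact: cintR.
have W0 : 0 <= \int[mu]_x w x by exact: Rintegral_ge0.
have d : cabs (I - a * (\int[mu]_x w x)%:C%C) <= cabs a / 2 * \int[mu]_x w x.
  rewrite E; apply: le_trans (cabs_Cint (cintD i1 i2)) _.
  rewrite -RintegralZl//; apply: le_Rintegral => //.
  - exact: cint_cabs (cintD i1 i2).
  - exact: rintZ.
  - move=> x _; have -> : (w x)%:C%C * (m x * chirp s x) + - a * (w x)%:C%C =
      (w x)%:C%C * (m x * chirp s x - a) by ring.
    rewrite cabsM cabsR (ger0_norm (w0 x)) mulrC.
    have [->|wx] := eqVneq (w x) 0; first by rewrite !mulr0.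
    by rewrite ler_wpM2r// close.
have : cabs (a * (\int[mu]_x w x)%:C%C) <=
    cabs (I - a * (\int[mu]_x w x)%:C%C) + cabs I.
  by rewrite cabsB -{1}(subrK I (a * _)) cabsD.
rewrite cabsM cabsR (ger0_norm W0); lra.
Qed.

End continuous_symbols.

(** * The estimate tested on a focusing wave and a randomly signed wave *)

Section bilinear.
Context {R : realType}.
Notation mu := (@leb2 R).
Notation leb := (@lebesgue_measure R).
Variables (x0 e0 : plane R) (r al : R) (phi psi : plane R -> R[i]).
Hypotheses (r_gt0 : 0 < r) (al_gt0 : 0 < al) (cphi : ccont phi) (cpsi : ccont psi).
Hypothesis phi_close : forall x, chi x0 r x != 0 ->
  cabs (phi x - phi x0) <= cabs (phi x0) / 4.
Hypothesis psi_close : forall x, chi e0 r x != 0 ->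
  cabs (psi x - psi e0) <= cabs (psi e0) / 4.
Variables (N : nat) (y : nat -> R).

(* The focusing points are chosen in [phase_recentred] so that the phase of a
   wave focusing there is the n-th phase of [S], up to a constant. *)
Let tau : R := al / (4 * pi ^+ 2 * r ^+ 2).
Let time (n : nat) : R := tau * n%:R.
Let pos (n : nat) : plane R :=
  (4 * pi * time n * x0.1 + y n / (2 * pi * r), 4 * pi * time n * x0.2).
Let S := expsum (phase_freq x0 r al) (coord1 x0 r) N y.
Let M := \int[mu]_x (chi x0 r x * cabs (S x) ^+ 2).
Let J := \int[mu]_x chi e0 r x.

Let pi_neq0 : (pi : R) != 0. Proof. by rewrite gt_eqF// pi_gt0. Qed.

Let wave_shift (n : nat) : R :=
  4 * pi ^+ 2 * time n * dot x0 x0 + y n * x0.1 / r.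

(** Completing the square about x0: [tau] makes 4 pi^2 t r^2 equal to al n, the drift 4 pi t x0 in
    [pos] cancels the linear term, and y_n / (2 pi r) produces the modulation. *)
Lemma phase_recentred n xi : phase (time n) (pos n) xi =
  wave_shift n - (n%:R * phase_freq x0 r al xi - y n * coord1 x0 r xi).
Proof.
rewrite /phase /wave_shift /phase_freq /coord1 /coord2 /pos /time /tau /dot/=.
have p0 := pi_neq0; move: pi p0 => p p0; field.
by rewrite p0 gt_eqF.
Qed.

Lemma continuous_coord1 : continuous (coord1 x0 r : R * R -> R).
Proof.
have <- : (fun x : R * R => r^-1 * x.1 + 0 * x.2 + - x0.1 / r) = coord1 x0 r.
  by apply/funext => x; rewrite /coord1; ring.
exact: continuous_linear2.
Qed.

Lemma continuous_phase_freq : continuous (phase_freq x0 r al : R * R -> R).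
Proof.
have <- : (fun x : R * R => al / r ^+ 2 * ((x.1 - x0.1) ^+ 2 + (x.2 - x0.2) ^+ 2)) =
    phase_freq x0 r al.
  by apply/funext => x; rewrite /phase_freq /coord1 /coord2; field; rewrite gt_eqF.
exact: continuous_quadratic.
Qed.

Lemma continuous_phase t x : continuous (phase t x : R * R -> R).
Proof.
move=> xi; apply: cvgB; last first.
  by apply: cvgM; [exact: cvg_cst|exact: continuous_dot2].
have := @continuous_linear2 R (2 * pi * x.1) (2 * pi * x.2) 0 xi.
have -> // : (fun z : R * R => 2 * pi * x.1 * z.1 + 2 * pi * x.2 * z.2 + 0) =
   (fun z => 2 * pi * dot x z).
by apply/funext => z; rewrite /dot; ring.
Qed.

Lemma ccont_S : ccont S.
Proof.
apply: ccont_sum => n; apply: ccont_expi => x; apply: cvgB.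
  by apply: cvgM; [exact: cvg_cst|exact: continuous_phase_freq].
by apply: cvgM; [exact: cvg_cst|exact: continuous_coord1].
Qed.

Definition focusing_data (xi : plane R) : R[i] := (chi x0 r xi)%:C%C * S xi.

Lemma Cc_focusing : Cc focusing_data.
Proof.
have [s1 s2] := ccont_S.
by apply: (@Cc_chiM _ _ _ r_gt0 _ N%:R) => // x _; exact: cabs_expsum.
Qed.

Lemma bounded_near_value (m : plane R -> R[i]) (x1 x : plane R) :
  cabs (m x - m x1) <= cabs (m x1) / 4 -> cabs (m x) <= 2 * cabs (m x1).
Proof.
move=> h; have : cabs (m x) <= cabs (m x - m x1) + cabs (m x1).
  by rewrite -{1}(subrK (m x1) (m x)) cabsD.
have := cabs_ge0 (m x1); lra.
Qed.

Lemma focusing_support xi : focusing_data xi != 0 -> chi x0 r xi != 0.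
Proof. by apply: contra_neq => E; rewrite /focusing_data E mul0r. Qed.

Lemma phi_bound xi : focusing_data xi != 0 -> cabs (phi xi) <= 2 * cabs (phi x0).
Proof. by move=> /focusing_support/phi_close; exact: bounded_near_value. Qed.

Lemma Cc_phi_focusing : Cc (fun x => phi x * focusing_data x).
Proof. exact: (Cc_mul Cc_focusing cphi phi_bound). Qed.

Definition focusing_wave : R -> plane R -> R[i] :=
  evolution (fun x => phi x * focusing_data x).

Lemma phaseD (t s : R) (x xi : plane R) :
  expi (phase (t + s) x xi) = expi (phase t x xi) * chirp s xi.
Proof. by rewrite /chirp -expiD; congr expi; rewrite /phase; ring. Qed.

Lemma rint_chi_S : rint mu (fun x => chi x0 r x * cabs (S x) ^+ 2).
Proof.
apply: (@rint_mul_bounded _ _ _ (N%:R ^+ 2)); first exact: rint_chi.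
  by have [/continuous_measurable2 s1 /continuous_measurable2 s2] := ccont_S; exact: cmeas_cabs2.
by move=> x; rewrite ger0_norm ?sqr_ge0// lerXn2r ?nnegrE ?cabs_ge0// cabs_expsum.
Qed.

Lemma ccont_cmeas (m : plane R -> R[i]) : ccont m -> cmeas m.
Proof. by case=> m1 m2; split; exact: continuous_measurable2. Qed.

Lemma cint_wave F t x : Cc F -> cint mu (fun xi => F xi * expi (phase t x xi)).
Proof.
by move=> CF; apply: cint_mul_expi; [exact: Cc_cint|exact: measurable_evolution_phase].
Qed.

(** Duality: once the unimodular constants [expi (wave_shift n)] are removed, the evaluations at the
    focusing points add up to a pairing with conj S. Since the data are chi S, this is the integral
    of chi |S|^2 against [phi] and the chirp, and the interactions between different n all enter
    constructively. *)
Lemma focusing_wave_lower (s : R) :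
  (forall x, chi x0 r x != 0 -> `|4 * pi ^+ 2 * s * dot x x| <= 4^-1) ->
  cabs (phi x0) * M / 2 <= \sum_(n < N) cabs (focusing_wave (time n + s) (pos n)).
Proof.
move=> hs.
have w0 x : 0 <= chi x0 r x * cabs (S x) ^+ 2 by rewrite mulr_ge0 ?chi_ge0 ?sqr_ge0.
have wn x : chi x0 r x * cabs (S x) ^+ 2 != 0 -> chi x0 r x != 0.
  by apply: contra_neq => ->; rewrite mul0r.
apply: (le_trans (coherent_lower_bound rint_chi_S w0 (ccont_cmeas cphi)
  (fun x h => phi_close (wn x h)) (fun x h => hs x (wn x h)))).
pose G n xi := conjc (expi (wave_shift n)) *
  (phi xi * focusing_data xi * expi (phase (time n + s) (pos n) xi)).
have iw n := cint_wave (time n + s) (pos n) Cc_phi_focusing.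
have iG (n : 'I_N) : cint mu (G n) by apply: cintZ; exact: iw.
have E : Cint mu (fun x => (chi x0 r x * cabs (S x) ^+ 2)%:C%C * (phi x * chirp s x)) =
    \sum_(n < N) conjc (expi (wave_shift n)) * focusing_wave (time n + s) (pos n).
  have -> : \sum_(n < N) conjc (expi (wave_shift n)) * focusing_wave (time n + s) (pos n) =
      \sum_(n < N) Cint mu (G n).
    apply: eq_bigr => n _; rewrite /focusing_wave evolutionE.
    exact/esym/(CintZ (conjc (expi (wave_shift n))) (iw n)).
  rewrite -(Cint_sum (index_enum _) iG); apply: eq_Cint => xi.
  have En (n : nat) : G n xi = (phi xi * chirp s xi * ((chi x0 r xi)%:C%C * S xi)) *
     conjc (expi (n%:R * phase_freq x0 r al xi - y n * coord1 x0 r xi)).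
    rewrite /G phaseD phase_recentred expiD expiN /focusing_data.
    have : conjc (expi (wave_shift n)) * expi (wave_shift n) = 1.
      by rewrite -expiN mulrC mulexpiN.
    move: (expi (wave_shift n)) => b ab.
    have -> : conjc b * (phi xi * ((chi x0 r xi)%:C%C * S xi) *
      (b * conjc (expi (n%:R * phase_freq x0 r al xi - y n * coord1 x0 r xi)) * chirp s xi)) =
      (conjc b * b) * ((phi xi * chirp s xi * ((chi x0 r xi)%:C%C * S xi)) *
     conjc (expi (n%:R * phase_freq x0 r al xi - y n * coord1 x0 r xi))) by ring.
    by rewrite ab mul1r.
  under eq_bigr do rewrite En.
  rewrite -mulr_sumr.
  have -> : \sum_(n < N) conjc (expi (n%:R * phase_freq x0 r al xi - y n * coord1 x0 r xi)) =
     conjc (S xi) by rewrite /S /expsum rmorph_sum.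
  rewrite realcM -mulcJ; ring.
rewrite E; apply: le_trans (cabs_sum _ _ _) _; apply: ler_sum => n _.
by rewrite cabsM cabsJ cabs_expi mul1r.
Qed.

Definition test_wave (m : nat) xi : R[i] := expi (- phase (time m) (pos m) xi).

Definition signed_data (e : {ffun 'I_N -> bool}) (xi : plane R) : R[i] :=
  (chi e0 r xi)%:C%C * signed_sum e (fun m => test_wave m xi).

Lemma ccont_test_wave m : ccont (test_wave m).
Proof. by apply: ccont_expi => x; apply: cvgN; exact: continuous_phase. Qed.

Lemma cabs_test_wave m xi : cabs (test_wave m xi) = 1.
Proof. exact: cabs_expi. Qed.

Lemma Cc_signed_data e : Cc (signed_data e).
Proof.
have [c1 c2] : ccont (fun xi => signed_sum e (fun m => test_wave m xi)).
  by apply: ccont_sum => n; apply: ccontM; [exact: ccont_cst|exact: ccont_test_wave].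
apply: (@Cc_chiM _ _ _ r_gt0 _ N%:R) => // x _.
apply: le_trans (cabs_sum _ _ _) _.
under eq_bigr do rewrite cabsM cabs_sgn mul1r cabs_test_wave.
by rewrite sumr_const card_ord.
Qed.

Lemma signed_support e xi : signed_data e xi != 0 -> chi e0 r xi != 0.
Proof. by apply: contra_neq => E; rewrite /signed_data E mul0r. Qed.

Lemma psi_bound e xi : signed_data e xi != 0 -> cabs (psi xi) <= 2 * cabs (psi e0).
Proof. by move=> /signed_support/psi_close; exact: bounded_near_value. Qed.

Lemma Cc_psi_signed e : Cc (fun x => psi x * signed_data e x).
Proof. exact: (Cc_mul (Cc_signed_data e) cpsi (@psi_bound e)). Qed.

Definition signed_wave e : R -> plane R -> R[i] :=
  evolution (fun x => psi x * signed_data e x).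

(** Summing over the signs isolates the summand m = n, whose phase is cancelled by evaluation at the
    n-th focusing point; the other summands may be arbitrary there. *)
Lemma signed_wave_lower (s : R) (n : 'I_N) :
  (forall x, chi e0 r x != 0 -> `|4 * pi ^+ 2 * s * dot x x| <= 4^-1) ->
  2 ^+ N * (cabs (psi e0) * J / 2) <=
    \sum_e cabs (signed_wave e (time n + s) (pos n)).
Proof.
move=> hs.
have [p1 p2] := ccontM cpsi (ccont_test_wave 0).
have CB (m : nat) : Cc (fun xi => psi xi * ((chi e0 r xi)%:C%C * test_wave m xi)).
  have [b1 b2] := ccont_test_wave m.
  have CF : Cc (fun xi => (chi e0 r xi)%:C%C * test_wave m xi).
    by apply: (@Cc_chiM _ _ _ r_gt0 _ 1) => // x _; rewrite cabs_test_wave.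
  apply: (@Cc_mul _ _ _ (2 * cabs (psi e0)) CF cpsi) => x h.
  apply: bounded_near_value; apply: psi_close.
  by apply: contra_neq h => ->; rewrite mul0r.
pose c (m : 'I_N) : R[i] := Cint mu (fun xi =>
  psi xi * ((chi e0 r xi)%:C%C * test_wave m xi) * expi (phase (time n + s) (pos n) xi)).
have E e : signed_wave e (time n + s) (pos n) = signed_sum e c.
  rewrite /signed_wave evolutionE /signed_sum /c.
  have -> : \sum_m sgn e m * Cint mu (fun xi =>
      psi xi * ((chi e0 r xi)%:C%C * test_wave m xi) * expi (phase (time n + s) (pos n) xi)) =
    \sum_(m < N) Cint mu (fun xi => sgn e m * (psi xi *
      ((chi e0 r xi)%:C%C * test_wave m xi) * expi (phase (time n + s) (pos n) xi))).
    by apply: eq_bigr => m _; exact/esym/(CintZ (sgn e m) (cint_wave _ _ (CB m))).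
  rewrite -Cint_sum; last by move=> m; exact: cintZ (cint_wave _ _ (CB m)).
  apply: eq_Cint => xi; rewrite /signed_data /signed_sum !mulr_sumr mulr_suml.
  by apply: eq_bigr => m _; ring.
under eq_bigr do rewrite E.
apply: le_trans (signed_sum_lower c n).
rewrite ler_pM2l ?exprn_gt0//.
have -> : c n = Cint mu (fun x => (chi e0 r x)%:C%C * (psi x * chirp s x)).
  apply: eq_Cint => xi; rewrite phaseD /test_wave.
  have : expi (phase (time n) (pos n) xi) * expi (- phase (time n) (pos n) xi) = 1.
    exact: mulexpiN.
  move: (expi (phase _ _ _)) (expi (- _)) => a b ab.
  have -> : psi xi * ((chi e0 r xi)%:C%C * b) * (a * chirp s xi) =
    (a * b) * ((chi e0 r xi)%:C%C * (psi xi * chirp s xi)) by ring.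
  by rewrite ab mul1r.
apply: coherent_lower_bound => //; [exact: rint_chi|exact: chi_ge0|exact: ccont_cmeas].
Qed.

(** As chi^2 <= chi, the quantity M of the lower bound also controls the squared norm of f. *)
Lemma focusing_energy : \int[mu]_x cabs (focusing_data x) ^+ 2 <= M.
Proof.
apply: le_Rintegral => //; [exact: Cc_rint2 Cc_focusing|exact: rint_chi_S|].
move=> x _; rewrite /focusing_data cabsM cabsR (ger0_norm (chi_ge0 _ _ x)) exprMn.
rewrite ler_wpM2r ?sqr_ge0// expr2 ler_piMl ?chi_ge0//; exact: chi_le1.
Qed.

Lemma signed_energy :
  \sum_e \int[mu]_x cabs (signed_data e x) ^+ 2 <= 2 ^+ N * (N%:R * J).
Proof.
have i2 e : rint mu (fun x => cabs (signed_data e x) ^+ 2) := Cc_rint2 (Cc_signed_data e).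
have [isum <-] := Rint_sum (index_enum _) i2.
have ic : rint mu (chi e0 r) := rint_chi e0 r_gt0.
rewrite mulrA -RintegralZl//; apply: le_Rintegral => //; first exact: rintZ.
move=> x _.
under eq_bigr do rewrite cabsM cabsR (ger0_norm (chi_ge0 _ _ x)) exprMn.
rewrite -mulr_sumr signed_sum_energy.
under eq_bigr do rewrite cabs_test_wave expr1n.
rewrite sumr_const card_ord mulrC ler_wpM2l ?mulr_ge0 ?exprn_ge0//.
rewrite expr2 ler_piMl ?chi_ge0//; exact: chi_le1.
Qed.

Variable C : R.
Hypothesis C_gt0 : 0 < C.
Hypothesis estimate : forall f g : plane R -> R[i], in_Lp 2%:E f -> in_Lp 2%:E g ->
  forall (Pf Pg : plane R -> R[i]) (u v : R -> plane R -> R[i]),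
    fourier_multiplier phi f Pf -> fourier_multiplier psi g Pg ->
    (forall t, schrodinger t Pf (u t)) -> (forall t, schrodinger t Pg (v t)) ->
    (L1Linfty (fun t x => (u t x * v t x)%R) <= C%:E * cnorm 2%:E f * cnorm 2%:E g)%E.

Variable d : R.
Hypotheses (d_gt0 : 0 < d) (d_tau : d < tau).
Hypothesis d_phi : forall s x, 0 <= s <= d -> chi x0 r x != 0 ->
  `|4 * pi ^+ 2 * s * dot x x| <= 4^-1.
Hypothesis d_psi : forall s x, 0 <= s <= d -> chi e0 r x != 0 ->
  `|4 * pi ^+ 2 * s * dot x x| <= 4^-1.

Let h e (n : nat) (s : R) : R :=
  cabs (focusing_wave (time n + s) (pos n)) * cabs (signed_wave e (time n + s) (pos n)).

Let h_continuous e n : continuous (h e n).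
Proof.
move=> s; have c1 := @evolution_continuous_time R _ (pos n) (time n) Cc_phi_focusing s.
have c2 := @evolution_continuous_time R _ (pos n) (time n) (Cc_psi_signed e) s.
exact: cvgM c1 c2.
Qed.

Let h_ge0 e n s : 0 <= h e n s.
Proof. by rewrite mulr_ge0 ?cabs_ge0. Qed.

Lemma M_ge0 : 0 <= M.
Proof. by apply: Rintegral_ge0 => x _; rewrite mulr_ge0 ?chi_ge0 ?sqr_ge0. Qed.

(** During the n-th window the supremum in x is tested at [pos n] only, which is legitimate because
    both waves are continuous in x. *)
Lemma windows_le e :
  (\sum_(n < N) \int[leb]_(s in `[0%R, d]) (h e n s)%:E <=
   (C * Num.sqrt M * Num.sqrt (\int[mu]_x cabs (signed_data e x) ^+ 2))%:E)%E.
Proof.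
have CF := Cc_focusing; have CG := Cc_signed_data e.
have mf := fourier_multiplier_ift CF cphi phi_bound.
have mg := fourier_multiplier_ift CG cpsi (@psi_bound e).
have su t := schrodinger_evolution t Cc_phi_focusing.
have sv t := schrodinger_evolution t (Cc_psi_signed e).
have est := estimate (in_L2_ift CF) (in_L2_ift CG) mf mg su sv.
apply: (@le_trans _ _ (L1Linfty (fun t x => focusing_wave t x * signed_wave e t x))).
  apply: (@sum_windows_le _ N tau d (h e)) => //; first exact: ltW.
    by move=> t; exact: Lnorm_ge0.
  move=> n s; rewrite /h -cabsM.
  apply: (@cnorm_oo_ge _ (fun x => focusing_wave (time n + s) x * signed_wave e (time n + s) x)).
  under eq_fun do rewrite cabsM; move=> x.
  have c1 := @evolution_continuous R _ (time n + s) Cc_phi_focusing x.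
  have c2 := @evolution_continuous R _ (time n + s) (Cc_psi_signed e) x.
  exact: cvgM c1 c2.
apply: le_trans est _; rewrite !EFinM.
apply: lee_pmul; [|exact: Lnorm_ge0| |exact: cnorm_ift].
  by apply: mule_ge0; [rewrite lee_fin ltW|exact: Lnorm_ge0].
apply: lee_wpmul2l; first by rewrite lee_fin ltW.
apply: le_trans (cnorm_ift CF) _; rewrite lee_fin ler_sqrt ?M_ge0//.
exact: focusing_energy.
Qed.

Lemma bilinear_conclusion : (0 < N)%N -> 0 < J ->
  d * (cabs (phi x0) * cabs (psi e0) * J / 4) * M <= C * Num.sqrt M * Num.sqrt (N%:R * J).
Proof.
move=> N0 J0.
have k0 : 0 < Num.sqrt (N%:R * J) by rewrite sqrtr_gt0 mulr_gt0// ltr0n.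
have k2 : Num.sqrt (N%:R * J) ^+ 2 = N%:R * J by rewrite sqr_sqrtr// mulr_ge0// ltW.
set k := Num.sqrt (N%:R * J) in k0 k2 *.
pose Z : R := 2 ^+ N * (cabs (psi e0) * J / 2) * (cabs (phi x0) * M / 2).
have upper : (\sum_e \sum_(n < N) \int[leb]_(s in `[0%R, d]) (h e n s)%:E <=
    (C * Num.sqrt M * (2 ^+ N * k))%:E)%E.
  apply: (@le_trans _ _ (\sum_e (C * Num.sqrt M *
     Num.sqrt (\int[mu]_x cabs (signed_data e x) ^+ 2))%:E)%E).
    by apply: lee_sum => e _; exact: windows_le.
  rewrite sumEFin lee_fin -mulr_sumr ler_wpM2l ?mulr_ge0 ?sqrtr_ge0 ?(ltW C_gt0)//.
  (* The square root is linearised by sqrt E <= E / (2 k) + k / 2, so that only the average energy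
     over the signs matters; k is the square root of the bound N J for that average. *)
  apply: (@le_trans _ _ (\sum_(e : {ffun 'I_N -> bool})
     ((2 * k)^-1 * \int[mu]_x cabs (signed_data e x) ^+ 2 + k / 2))).
    apply: ler_sum => e _.
    have E0 : 0 <= \int[mu]_x cabs (signed_data e x) ^+ 2.
      by apply: Rintegral_ge0 => x _; exact: sqr_ge0.
    have := sqr_sqrtr E0; move: (Num.sqrt _) => a <-.
    have -> : (2 * k)^-1 * a ^+ 2 + k / 2 = a + (2 * k)^-1 * (a - k) ^+ 2.
      by field; rewrite gt_eqF.
    by rewrite lerDl mulr_ge0 ?sqr_ge0// invr_ge0 mulr_ge0// ltW.
  rewrite big_split/= -mulr_sumr sum_signs_cst.
  have := signed_energy; rewrite -k2 => e2.
  have kk : 0 < (2 * k)^-1 by rewrite invr_gt0 mulr_gt0.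
  have : (2 * k)^-1 * \sum_e \int[mu]_x cabs (signed_data e x) ^+ 2 <=
    (2 * k)^-1 * (2 ^+ N * k ^+ 2) by rewrite ler_pM2l.
  have -> : (2 * k)^-1 * (2 ^+ N * k ^+ 2) = 2 ^+ N * k / 2 by field; rewrite gt_eqF.
  by rewrite mulrA; lra.
have mh e n : measurable_fun `[0%R, d] (fun s => (h e n s)%:E).
  apply/measurable_EFinP; apply: measurable_funTS; apply: continuous_measurable_fun.
  exact: h_continuous.
have lower : ((Z * d)%:E <=
    \sum_e \sum_(n < N) \int[leb]_(s in `[0%R, d]) (h e n s)%:E)%E.
  have -> : (\sum_e \sum_(n < N) \int[leb]_(s in `[0%R, d]) (h e n s)%:E =
      \int[leb]_(s in `[0%R, d]) \sum_e \sum_(n < N) (h e n s)%:E)%E.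
    rewrite ge0_integral_sum//; last 2 first.
    - by move=> e; apply: emeasurable_sum => n; exact: mh.
    - by move=> e s _; apply: sume_ge0 => n _; rewrite lee_fin.
    apply: eq_bigr => e _; rewrite ge0_integral_sum//; first by move=> n; exact: mh.
    by move=> n s _; rewrite lee_fin.
  have -> : (Z * d)%:E = (\int[leb]_(s in `[0%R, d]) Z%:E)%E.
    have := lebesgue_measure_itv `[0%R, d]%R; rewrite /= lte_fin d_gt0 -EFinB subr0 => vol.
    rewrite integral_cst//; exact/esym/(congr1 (mule Z%:E) vol).
  apply: ge0_le_integral => //.
  - move=> s _; rewrite lee_fin /Z.
    have := M_ge0 => M0.
    have := cabs_ge0 (phi x0); have := cabs_ge0 (psi e0) => b0 a0.
    apply: mulr_ge0; last by apply: mulr_ge0; rewrite ?invr_ge0// mulr_ge0.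
    apply: mulr_ge0; first exact: exprn_ge0.
    by apply: mulr_ge0; rewrite ?invr_ge0// mulr_ge0// ltW.
  - by apply: emeasurable_sum => e; apply: emeasurable_sum => n; exact: mh.
  - move=> s; rewrite /= in_itv/= => sd.
    under eq_bigr do rewrite sumEFin.
    (* With n outside, the focusing factor is independent of the signs, and the signed factor is
       averaged for each n separately. *)
    rewrite sumEFin lee_fin exchange_big/= /Z.
    have fl := focusing_wave_lower (fun x => @d_phi s x sd).
    have B0 : 0 <= 2 ^+ N * (cabs (psi e0) * J / 2) :> R.
      apply: mulr_ge0; first exact: exprn_ge0.
      by apply: mulr_ge0; rewrite ?invr_ge0// mulr_ge0 ?cabs_ge0// ltW.
    apply: le_trans (ler_wpM2l B0 fl) _; rewrite mulr_sumr; apply: ler_sum => n _.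
    rewrite /h -mulr_sumr mulrC ler_wpM2l ?cabs_ge0//.
    exact: signed_wave_lower (fun x => @d_psi s x sd).
have := le_trans lower upper; rewrite lee_fin /Z => H.
have n0 : 0 < 2 ^+ N :> R by rewrite exprn_gt0.
rewrite -(ler_pM2l n0).
have -> : 2 ^+ N * (d * (cabs (phi x0) * cabs (psi e0) * J / 4) * M) =
  2 ^+ N * (cabs (psi e0) * J / 2) * (cabs (phi x0) * M / 2) * d by field.
by apply: (le_trans H); rewrite le_eqVlt; apply/orP; left; apply/eqP; ring.
Qed.

End bilinear.

(** * Choice of the parameters and the contradiction *)

Section window.
Context {R : realType}.
Notation mu := (@leb2 R).

Lemma small_parameter : 0 < (1024^-1 : R) /\ (1024^-1 : R) * 1024 <= 1.
Proof. by rewrite invr_gt0 ltr0n mulVf ?pnatr_eq0. Qed.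

(** Read off from [Riesz_Bessel_failure] with A = 1: as |S|^2 <= N^2, a bump of mass 0 would make
    the integral of chi |S|^2 vanish, whereas it is at least N. *)
Lemma chi_mass_gt0 (x0 : plane R) (r : R) : 0 < r -> 0 < \int[mu]_x chi x0 r x.
Proof.
move=> r0.
have [a0 a1] := small_parameter.
have [N [y [N0 le]]] := Riesz_Bessel_failure x0 r0 a0 a1 1.
have n0 : 0 < N%:R :> R by rewrite ltr0n.
set S := expsum _ _ N y in le.
have iS : rint mu (fun x => chi x0 r x * cabs (S x) ^+ 2) := rint_chi_S x0 1024^-1 r0 N y.
have J0 : 0 <= \int[mu]_x chi x0 r x by apply: Rintegral_ge0 => x _; exact: chi_ge0.
rewrite lt_neqAle J0 andbT eq_sym; apply/eqP => JE.
have : \int[mu]_x (chi x0 r x * cabs (S x) ^+ 2) <= N%:R ^+ 2 * \int[mu]_x chi x0 r x.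
  rewrite -RintegralZl//; last exact: rint_chi.
  apply: le_Rintegral => //; first by apply: rintZ; exact: rint_chi.
  move=> x _; rewrite mulrC ler_wpM2r ?chi_ge0// lerXn2r ?nnegrE ?cabs_ge0 ?cabs_expsum//.
by rewrite JE mulr0; move: le; lra.
Qed.

(** D bounds |xi|^2 on the support of the bump, so 4 pi^2 s |xi|^2 <= 4 pi^2 D / (16 pi^2 D) =
    1/4. *)
Lemma window_phase_small (x0 : plane R) (r d D s : R) (x : plane R) : 0 < r -> 0 < D ->
  (`|x0.1| + r) ^+ 2 + (`|x0.2| + r) ^+ 2 <= D -> d <= (16 * pi ^+ 2 * D)^-1 ->
  0 <= s <= d -> chi x0 r x != 0 -> `|4 * pi ^+ 2 * s * dot x x| <= 4^-1.
Proof.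
move=> r0 D0 hD hd /andP[s0 sd] /(chi_support r0)[x1 x2].
have p0 : 0 < (pi : R) ^+ 2 by rewrite exprn_gt0// pi_gt0.
have sqle (a b : R) : `|a - b| <= r -> a * a <= (`|b| + r) ^+ 2.
  move=> ab; have : `|a| <= `|b| + r.
    by have := ler_distD 0 a b; have := ler_normD (a - b) b; rewrite subrK; lra.
  by move=> h; rewrite -expr2 -(real_normK (num_real a)) lerXn2r// nnegrE addr_ge0// ltW.
have dx0 : 0 <= dot x x by rewrite /dot addr_ge0// -expr2 sqr_ge0.
have dxD : dot x x <= D by have := sqle _ _ x1; have := sqle _ _ x2; rewrite /dot; lra.
rewrite ger0_norm; last by rewrite mulr_ge0// mulr_ge0// mulr_ge0// ltW.
have le1 : s * dot x x <= (16 * pi ^+ 2 * D)^-1 * D.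
  by apply: ler_pM => //; exact: le_trans sd hd.
have E : (4 * pi ^+ 2) * ((16 * pi ^+ 2 * D)^-1 * D) = 4^-1 :> R.
  by move: (pi_gt0 R); move: pi => p pp; field; rewrite !gt_eqF.
by rewrite -mulrA -[leRHS]E ler_wpM2l// mulr_ge0// ltW.
Qed.

End window.

Theorem theorem1p3 (R : realType) (phi psi : R * R -> R[i])
  (phiC : C0infty phi) (psiC : C0infty psi)
  (phi0 : exists xi, phi xi != 0) (psi0 : exists xi, psi xi != 0) :
  ~ exists C : R, 0 < C /\
      forall f g : R * R -> R[i], in_Lp 2%:E f -> in_Lp 2%:E g ->
      forall (Pf Pg : R * R -> R[i]) (u v : R -> R * R -> R[i]),
        fourier_multiplier phi f Pf -> fourier_multiplier psi g Pg ->
        (forall t, schrodinger t Pf (u t)) ->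
        (forall t, schrodinger t Pg (v t)) ->
        (L1Linfty (fun t x => (u t x * v t x)%R)
           <= C%:E * cnorm 2%:E f * cnorm 2%:E g)%E.
Proof.
move=> [C [C0 estimate]].
have [x0 phix0] := phi0; have [e0 psie0] := psi0.
have cphi := C0infty_ccont phiC; have cpsi := C0infty_ccont psiC.
have cabs_gt0 (z : R[i]) : z != 0 -> 0 < cabs z.
  move=> z0; rewrite lt_neqAle cabs_ge0 andbT eq_sym; apply: contra_neq z0.
  exact: ComplexField.Normc.eq0_normc.
have a0 := cabs_gt0 _ phix0; have b0 := cabs_gt0 _ psie0.
have a4 : 0 < cabs (phi x0) / 4 by rewrite divr_gt0.
have b4 : 0 < cabs (psi e0) / 4 by rewrite divr_gt0.
have [r1 r1_gt0 close1] := ccont_near x0 cphi a4.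
have [r2 r2_gt0 close2] := ccont_near e0 cpsi b4.
pose r : R := Num.min r1 r2.
have r0 : 0 < r by rewrite lt_min r1_gt0.
have rr1 : r <= r1 by rewrite ge_min lexx.
have rr2 : r <= r2 by rewrite ge_min lexx orbT.
have phi_close x : chi x0 r x != 0 -> cabs (phi x - phi x0) <= cabs (phi x0) / 4.
  move=> /(chi_support r0)[h1 h2]; apply: close1; first exact: le_trans h1 rr1.
  exact: le_trans h2 rr1.
have psi_close x : chi e0 r x != 0 -> cabs (psi x - psi e0) <= cabs (psi e0) / 4.
  move=> /(chi_support r0)[h1 h2]; apply: close2; first exact: le_trans h1 rr2.
  exact: le_trans h2 rr2.
pose al : R := 1024^-1.
have [al0 al1] : 0 < al /\ al * 1024 <= 1 := small_parameter.
pose tau : R := al / (4 * pi ^+ 2 * r ^+ 2).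
have p0 : 0 < (pi : R) ^+ 2 by rewrite exprn_gt0// pi_gt0.
have tau0 : 0 < tau by rewrite divr_gt0// mulr_gt0 ?exprn_gt0// mulr_gt0.
pose Dx := (`|x0.1| + r) ^+ 2 + (`|x0.2| + r) ^+ 2.
pose De := (`|e0.1| + r) ^+ 2 + (`|e0.2| + r) ^+ 2.
have Dx0 : 0 <= Dx by apply: addr_ge0; exact: sqr_ge0.
have De0 : 0 <= De by apply: addr_ge0; exact: sqr_ge0.
pose D := Dx + De + 1.
have D0 : 0 < D by rewrite /D; lra.
pose d := Num.min (tau / 2) (16 * pi ^+ 2 * D)^-1.
have dD : d <= (16 * pi ^+ 2 * D)^-1 by rewrite ge_min lexx orbT.
have d0 : 0 < d.
  rewrite lt_min divr_gt0// invr_gt0; apply: mulr_gt0 => //; exact: mulr_gt0.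
have dtau : d < tau.
  by apply: (@le_lt_trans _ _ (tau / 2)); rewrite ?ge_min ?lexx// ltr_pdivrMr// ltr_pMr// ltr1n.
have DxD : Dx <= D by rewrite /D -addrA lerDl addr_ge0.
have DeD : De <= D by rewrite /D addrAC [Dx + 1]addrC addrC lerDl addr_ge0.
have d_phi s x : 0 <= s <= d -> chi x0 r x != 0 -> `|4 * pi ^+ 2 * s * dot x x| <= 4^-1.
  exact: window_phase_small r0 D0 DxD dD.
have d_psi s x : 0 <= s <= d -> chi e0 r x != 0 -> `|4 * pi ^+ 2 * s * dot x x| <= 4^-1.
  exact: window_phase_small r0 D0 DeD dD.
have J0 := chi_mass_gt0 e0 r0.
set J := \int[_]_x _ in J0.
pose k := d * (cabs (phi x0) * cabs (psi e0) * J / 4).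
have k0 : 0 < k by rewrite mulr_gt0// divr_gt0// mulr_gt0// mulr_gt0.
(* The estimate will give k M <= C sqrt(M) sqrt(N J), that is M <= (C^2 J / k^2) N; the requested
   constant exceeds this one by 1. *)
have [N [y [N0 large]]] := Riesz_Bessel_failure x0 r0 al0 al1 (C ^+ 2 * J / k ^+ 2 + 1).
have := bilinear_conclusion r0 cphi cpsi phi_close psi_close y C0 estimate d0 dtau
  d_phi d_psi N0 J0.
set M := \int[_]_x _ in large *; rewrite -/J -/k => le1; clearbody k M.
have n0 : 0 < N%:R :> R by rewrite ltr0n.
have M0 : 0 <= M.
  apply: le_trans large; rewrite mulr_ge0 ?ler0n// addr_ge0// divr_ge0 ?sqr_ge0//.
  by rewrite mulr_ge0 ?sqr_ge0// ltW.
have le2 : (k * M) ^+ 2 <= (C * Num.sqrt M * Num.sqrt (N%:R * J)) ^+ 2.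
  by apply: lerXn2r le1; rewrite nnegrE !mulr_ge0 ?sqrtr_ge0// ltW.
have NJ0 : 0 <= N%:R * J by rewrite mulr_ge0// ltW.
move: le2; rewrite !exprMn !sqr_sqrtr// => le2.
have M1 : 0 < M.
  apply: lt_le_trans large; rewrite mulr_gt0// ltr_wpDl// divr_ge0 ?sqr_ge0// mulr_ge0 ?sqr_ge0//.
  exact: ltW.
have le3 : k ^+ 2 * M <= C ^+ 2 * (N%:R * J).
  by rewrite -(ler_pM2r M1) -mulrA -expr2 [leRHS]mulrAC.
have k2 : 0 < k ^+ 2 by rewrite exprn_gt0.
have : k ^+ 2 * ((C ^+ 2 * J / k ^+ 2 + 1) * N%:R) <= C ^+ 2 * (N%:R * J).
  by apply: le_trans le3; rewrite ler_pM2l.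
have -> : k ^+ 2 * ((C ^+ 2 * J / k ^+ 2 + 1) * N%:R) = C ^+ 2 * (N%:R * J) + k ^+ 2 * N%:R.
  by field; rewrite gt_eqF.
by rewrite gerDl leNgt mulr_gt0.
Qed.
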